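(* Let $\mathscr{C}$ be a class of Polish groups contained in the class $\mathscr{G}_{\mathrm{inv}}$ of Polish groups admitting a (compatible) bi-invariant metric, and let $G$ and $H$ be countable groups which are measure equivalent. Then $G$ is Bernoulli $\mathscr{C}$-superrigid if and only if $H$ is Bernoulli $\mathscr{C}$-superrigid.
   Context: Two countable discrete groups $G$ and $H$ are measure equivalent if there exist commuting, essentially free, measure preserving actions of $G$ and $H$ on a standard $\sigma$-finite nonzero measure space such that each of the two actions admits a measurable fundamental domain of finite measure. For a countable group $G$ and a probability space $K$, the Bernoulli action $G\curvearrowright K^G$ is $(gx)(h)=x(g^{-1}h)$ with product measure; $[0,1]$ carries Lebesgue measure. An extension of p.m.p. actions of $G$ is a measure preserving $G$-equivariant map $q:X\to Y$. Such an extension is relatively $\mathscr{C}$-superrigid if every measurable cocycle $w:G\times X\to L$ with $L\in\mathscr{C}$ is cohomologous to a cocycle of the form $(g,x)\mapsto w_0(g,q(x))$ for a measurable cocycle $w_0:G\times Y\to L$. (Cohomologous: $w'(g,x)=F(gx)w(g,x)F(x)^{-1}$ for a measurable $F:X\to L$, for all $g$ and a.e. $x$.) $G$ is Bernoulli $\mathscr{C}$-superrigid if for every p.m.p. action $G\curvearrowright Y$, the extension $Y\otimes[0,1]^G\to Y$ (diagonal action on the product, projection to $Y$) is relatively $\mathscr{C}$-superrigid. *)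

(* Defs.v *)
From HB Require Import structures.
From mathcomp Require Import all_boot all_order all_algebra.
From mathcomp Require Import all_classical all_reals all_analysis.
Set Implicit Arguments. Unset Strict Implicit. Unset Printing Implicit Defensive.
Import Order.TTheory GRing.Theory Num.Theory.
Local Open Scope classical_set_scope.
Local Open Scope ring_scope.

Record cgroup := CGroup {
  cg_car :> countType;
  cg_mul : cg_car -> cg_car -> cg_car;
  cg_inv : cg_car -> cg_car;
  cg_one : cg_car;
  cg_mulA : forall x y z, cg_mul x (cg_mul y z) = cg_mul (cg_mul x y) z;
  cg_mul1 : forall x, cg_mul cg_one x = x;
  cg_mulV : forall x, cg_mul (cg_inv x) x = cg_one }.

Section Metric.
Variables (R : realType) (T : Type) (d : T -> T -> R).
Definition is_metric : Prop :=
  [/\ forall x y, 0 <= d x y, forall x y, d x y = 0 <-> x = y,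
      forall x y, d x y = d y x & forall x y z, d x z <= d x y + d y z].
Definition metric_open (U : set T) : Prop :=
  forall x, U x -> exists2 e : R, 0 < e & forall y, d x y < e -> U y.
Definition metric_complete : Prop :=
  forall s : nat -> T,
    (forall e : R, 0 < e -> exists N, forall m n, (N <= m)%N -> (N <= n)%N ->
        d (s m) (s n) < e) ->
    exists x, forall e : R, 0 < e -> exists N, forall n, (N <= n)%N -> d (s n) x < e.
Definition metric_separable : Prop :=
  exists D : set T, countable D /\
    forall x (e : R), 0 < e -> exists2 y, D y & d x y < e.
End Metric.

Definition compatible_metric (R : realType) (T : topologicalType)
    (d : T -> T -> R) : Prop :=
  is_metric d /\ forall U : set T, open U <-> metric_open d U.

Record PolishGroup (R : realType) := PGroup {
  pg_car :> topologicalType;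
  pg_mul : pg_car -> pg_car -> pg_car;
  pg_inv : pg_car -> pg_car;
  pg_one : pg_car;
  pg_mulA : forall x y z, pg_mul x (pg_mul y z) = pg_mul (pg_mul x y) z;
  pg_mul1 : forall x, pg_mul pg_one x = x;
  pg_mulV : forall x, pg_mul (pg_inv x) x = pg_one;
  pg_mul_cont : continuous (fun p : pg_car * pg_car => pg_mul p.1 p.2);
  pg_inv_cont : continuous pg_inv;
  pg_polish : exists d : pg_car -> pg_car -> R,
     [/\ compatible_metric d, metric_complete d & metric_separable d] }.

Definition G_inv (R : realType) (L : PolishGroup R) : Prop :=
  exists d : L -> L -> R, compatible_metric d /\
    forall x y z, d (pg_mul z x) (pg_mul z y) = d x y /\
                  d (pg_mul x z) (pg_mul y z) = d x y.

Definition borel_measurable (R : realType) (dX : measure_display)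
    (X : measurableType dX) (L : PolishGroup R) (f : X -> L) : Prop :=
  forall B : set L, <<s (@open L) >> B -> measurable (f @^-1` B).

Definition standard_borel (R : realType) (dX : measure_display)
    (X : measurableType dX) : Prop :=
  exists d : X -> X -> R, [/\ is_metric d, metric_complete d, metric_separable d &
    (measurable : set (set X)) = <<s metric_open d >>].

Definition is_action (G : cgroup) (X : Type) (a : G -> X -> X) : Prop :=
  (forall x, a (cg_one G) x = x) /\
  (forall g h x, a (cg_mul g h) x = a g (a h x)).

Definition mp_action (R : realType) (G : cgroup) (dX : measure_display)
    (X : measurableType dX) (mu : set X -> \bar R) (a : G -> X -> X) : Prop :=
  [/\ is_action a, forall g, measurable_fun setT (a g) &
      forall g (A : set X), measurable A -> mu (a g @^-1` A) = mu A].

Definition cocycle (R : realType) (G : cgroup) (dX : measure_display)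
    (X : measurableType dX) (mu : {measure set X -> \bar R}) (a : G -> X -> X)
    (L : PolishGroup R) (w : G -> X -> L) : Prop :=
  (forall g, borel_measurable (w g)) /\
  forall g h, {ae mu, forall x, w (cg_mul g h) x = pg_mul (w g (a h x)) (w h x)}.

Definition cohomologous (R : realType) (G : cgroup) (dX : measure_display)
    (X : measurableType dX) (mu : {measure set X -> \bar R}) (a : G -> X -> X)
    (L : PolishGroup R) (w w' : G -> X -> L) : Prop :=
  exists F : X -> L, borel_measurable F /\
    forall g, {ae mu, forall x,
      w' g x = pg_mul (pg_mul (F (a g x)) (w g x)) (pg_inv (F x))}.

Definition rel_superrigid (R : realType) (C : PolishGroup R -> Prop)
    (G : cgroup) (dX dY : measure_display)
    (X : measurableType dX) (Y : measurableType dY)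
    (mu : {measure set X -> \bar R}) (nu : {measure set Y -> \bar R})
    (a : G -> X -> X) (b : G -> Y -> Y) (q : X -> Y) : Prop :=
  forall L : PolishGroup R, C L ->
  forall w : G -> X -> L, cocycle mu a w ->
  exists w0 : G -> Y -> L, cocycle nu b w0 /\
    cohomologous mu a w (fun g x => w0 g (q x)).

(* [0,1]^G is modelled inside the function type G -> R (the product measure
   below is concentrated on [0,1]^G); the alias only provides the pointed
   (inhabited choice) structure needed by g_sigma_algebraType *)
Definition gfun (G : Type) (R : realType) := G -> R.
HB.instance Definition _ (G : Type) (R : realType) := gen_eqMixin (gfun G R).
HB.instance Definition _ (G : Type) (R : realType) := gen_choiceMixin (gfun G R).
HB.instance Definition _ (G : Type) (R : realType) :=
  isPointed.Build (gfun G R) (fun _ => 0%R).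

Definition bern_gen (R : realType) (G : cgroup) (dY : measure_display)
    (Y : measurableType dY) : set (set (Y * gfun G R)) :=
  [set S | (exists A : set Y, measurable A /\ S = fst @^-1` A) \/
           (exists g (B : set R), measurable B /\
              S = (fun z : Y * gfun G R => z.2 g) @^-1` B)].

Notation bern_space R G Y := (g_sigma_algebraType (@bern_gen R G _ Y)).

(* lam is the product measure nu (x) Leb_[0,1]^{(x) G}: it is determined by its
   values on cylinder sets *)
Definition is_bernoulli_measure (R : realType) (G : cgroup)
    (dY : measure_display) (Y : measurableType dY)
    (nu : {measure set Y -> \bar R})
    (lam : {measure set bern_space R G Y -> \bar R}) : Prop :=
  forall (A : set Y) (s : seq G) (B : G -> set R),
    measurable A -> uniq s -> (forall g, measurable (B g)) ->
    lam ([set z : bern_space R G Y | A z.1 /\ forall g, g \in s -> B g (z.2 g)])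
    = (nu A * \prod_(g <- s) (@lebesgue_measure R) (B g `&` `[0%R, 1%R]))%E.

Definition bern_action (R : realType) (G : cgroup) (dY : measure_display)
    (Y : measurableType dY) (b : G -> Y -> Y) :
    G -> bern_space R G Y -> bern_space R G Y :=
  fun g z => (b g z.1, fun h => z.2 (cg_mul (cg_inv g) h)).

Definition bernoulli_superrigid (R : realType) (C : PolishGroup R -> Prop)
    (G : cgroup) : Prop :=
  forall (dY : measure_display) (Y : measurableType dY)
         (nu : probability Y R) (b : G -> Y -> Y),
    standard_borel R Y -> mp_action nu b ->
  forall lam : {measure set bern_space R G Y -> \bar R},
    is_bernoulli_measure nu lam ->
    rel_superrigid C lam nu (@bern_action R G dY Y b) b fst.

Definition ess_free (R : realType) (G : cgroup) (dX : measure_display)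
    (X : measurableType dX) (m : {measure set X -> \bar R}) (a : G -> X -> X) :=
  forall g, g <> cg_one G -> {ae m, forall x, a g x <> x}.

Definition finite_fundamental_domain (R : realType) (G : cgroup)
    (dX : measure_display) (X : measurableType dX)
    (m : {measure set X -> \bar R}) (a : G -> X -> X) : Prop :=
  exists D : set X, [/\ measurable D, (m D < +oo)%E &
    {ae m, forall x, exists! g, D (a g x)}].

Definition measure_equivalent (R : realType) (G H : cgroup) : Prop :=
  exists (dO : measure_display) (O : measurableType dO)
         (m : {measure set O -> \bar R}) (a : G -> O -> O) (b : H -> O -> O),
  [/\ standard_borel R O /\ sigma_finite setT m /\ m setT <> 0%E,
      mp_action m a /\ mp_action m b,
      (forall g h x, a g (b h x) = b h (a g x)),
      ess_free m a /\ ess_free m b &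
      finite_fundamental_domain m a /\ finite_fundamental_domain m b].

(* Main.v *)
(* If H is finite, almost every point of [0,1]^H has a unique smallest label,
   so every cocycle is trivial.  Let H be infinite, let Omega be a coupling with
   fundamental domains D of G and E of H, let H act on Y and let w be a cocycle
   of Y x [0,1]^H.  Identifying E with Omega / H, the group G acts on E x Y
   through the return cocycle of G into H.  A single label in [0,1] splits, via
   its binary digits, into countably many independent ones, and the points of an
   H-orbit inject equivariantly into G x nat; hence E x Y x [0,1]^G carries an
   H-valued cocycle together with a map to Y x [0,1]^H intertwining the actions
   along it.  Superrigidity of G untwists the pull-back of w to a cocycle of
   E x Y.  Moving the untwisting function to D and declaring the labels used by
   the orbit to be independent coordinates, one gets F on V x Y x [0,1]^H, where
   V = D x [0,1]^(G x nat), conjugating w to a cocycle of V x Y.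

   For a bi-invariant metric d, the function Psi(v', v, y, c) =
   F(v', y, c) F(v, y, c)^-1 is moved by left and right multiplications that do
   not depend on c, so d(Psi(v', v, y, c), Psi(v', v, y, c')) is invariant under
   H.  As H is infinite, the Bernoulli shift is mixing relative to the other
   coordinates, so each set where this distance is less than e does not depend
   on c'; by separability the distance is then zero.  Hence F(v, y, c) =
   A(v, y) F0(y, c), and F0 conjugates w to a cocycle of Y. *)

Require Import Defs.
From HB Require Import structures.
From mathcomp Require Import all_boot all_order all_algebra.
From mathcomp Require Import all_classical all_reals all_analysis.
From mathcomp Require Import measurable_realfun.
From mathcomp Require Import ring lra.
Set Implicit Arguments. Unset Strict Implicit. Unset Printing Implicit Defensive.
Import Order.TTheory GRing.Theory Num.Theory.
Import numFieldNormedType.Exports.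
Local Open Scope classical_set_scope.
Local Open Scope ring_scope.

(** No infinite product measure is constructed. The i.i.d. law on the labels of [H] is read off from
    the given Bernoulli measure; re-indexing along an injection into the infinite group [H] yields
    it for [G * nat]; the Bernoulli measure of [G] is a push-forward of the latter. Countably many
    labels per element of [G] are needed because an [H]-orbit may meet one [G]-translate of the
    fundamental domain many times. Actions must satisfy their laws everywhere, whereas fundamental
    domains behave well only almost everywhere. Hence a conull set invariant under both groups is
    fixed, and induced actions live on the whole of the coupling, as the identity off the domain;
    the space to which superrigidity of [G] is applied is then a plain product of standard spaces.
    Passing from [D] to [E] along [H]-orbits respects null sets but not the measure, which is enough
    for almost everywhere identities. Two points [v'], [v] over the same labels are compared because
    [w] then cancels. The actions on [V] and [Y] need not be ergodic, so mixing is available only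
    relative to them. *)

Lemma measurable_preimage dX dY (X : measurableType dX) (Y : measurableType dY)
  (f : X -> Y) A : measurable_fun setT f -> measurable A -> measurable (f @^-1` A).
Proof. by move=> mf mA; rewrite -[X in measurable X]setTI; exact: mf. Qed.

(** * Measure preserving and nonsingular maps, almost everywhere statements, products *)

Section Law.
Context {R : realType}.
Local Open Scope ereal_scope.

Definition law_preserving dX dY (X : measurableType dX) (Y : measurableType dY)
    (mu : probability X R) (nu : probability Y R) (f : X -> Y) : Prop :=
  measurable_fun setT f /\
  forall A, measurable A -> mu (f @^-1` A) = nu A.

Definition nonsingular dX dY (X : measurableType dX) (Y : measurableType dY)
    (mu : probability X R) (nu : probability Y R) (f : X -> Y) : Prop :=
  measurable_fun setT f /\
  forall A, measurable A -> nu A = 0 -> mu (f @^-1` A) = 0.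

Definition pprod dX dY (X : measurableType dX) (Y : measurableType dY)
  (P : probability X R) (Q : probability Y R) : probability (X * Y)%type R :=
  P \x Q.

Lemma pprodE dX dY (X : measurableType dX) (Y : measurableType dY)
    (P : probability X R) (Q : probability Y R) A B :
  measurable A -> measurable B -> pprod P Q (A `*` B) = P A * Q B.
Proof. exact: product_measure1E. Qed.

Lemma pprod_integral dX dY (X : measurableType dX) (Y : measurableType dY)
    (P : probability X R) (Q : probability Y R) A :
  pprod P Q A = \int[P]_x Q (xsection A x).
Proof. by []. Qed.

Lemma law_nonsingular dX dY (X : measurableType dX) (Y : measurableType dY)
    (mu : probability X R) (nu : probability Y R) (f : X -> Y) :
  law_preserving mu nu f -> nonsingular mu nu f.
Proof. by move=> [mf h]; split=> // A mA A0; rewrite h. Qed.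

Lemma law_comp dX dY dZ (X : measurableType dX) (Y : measurableType dY)
    (Z : measurableType dZ) (mu : probability X R) (nu : probability Y R)
    (ro : probability Z R) (f : X -> Y) (g : Y -> Z) :
  law_preserving mu nu f -> law_preserving nu ro g ->
  law_preserving mu ro (g \o f).
Proof.
move=> [mf hf] [mg hg]; split; first exact: measurableT_comp.
move=> A mA; rewrite comp_preimage hf ?hg//.
by rewrite -[X in measurable X]setTI; exact: mg.
Qed.

Lemma law_id dX (X : measurableType dX) (mu : probability X R) :
  law_preserving mu mu id.
Proof. by split=> //; exact: measurable_id. Qed.

Lemma nonsingular_comp dX dY dZ (X : measurableType dX)
    (Y : measurableType dY) (Z : measurableType dZ) (mu : probability X R)
    (nu : probability Y R) (ro : probability Z R) (f : X -> Y) (g : Y -> Z) :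
  nonsingular mu nu f -> nonsingular nu ro g -> nonsingular mu ro (g \o f).
Proof.
move=> [mf hf] [mg hg]; split; first exact: measurableT_comp.
move=> A mA A0; rewrite comp_preimage hf ?hg//.
by rewrite -[X in measurable X]setTI; exact: mg.
Qed.

Lemma nonsingular_ae dX dY (X : measurableType dX) (Y : measurableType dY)
    (mu : probability X R) (nu : probability Y R)
    (f : X -> Y) (P : Y -> Prop) : nonsingular mu nu f ->
  {ae nu, forall y, P y} -> {ae mu, forall x, P (f x)}.
Proof.
move=> [mf hf] [N [mN N0 PN]]; exists (f @^-1` N); split.
- by rewrite -[X in measurable X]setTI; exact: mf.
- exact: hf.
- by move=> x /= Px; apply: PN.
Qed.

Lemma law_ae dX dY (X : measurableType dX) (Y : measurableType dY)
    (mu : probability X R) (nu : probability Y R)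
    (f : X -> Y) (P : Y -> Prop) : law_preserving mu nu f ->
  {ae nu, forall y, P y} -> {ae mu, forall x, P (f x)}.
Proof. by move=> /law_nonsingular; exact: nonsingular_ae. Qed.

Lemma ae_forall_count dX (X : measurableType dX)
    (mu : {measure set X -> \bar R}) (T : countType) (P : T -> X -> Prop) :
  (forall t, {ae mu, forall x, P t x}) -> {ae mu, forall x, forall t, P t x}.
Proof.
move=> h.
have : {ae mu, forall x, forall n, if unpickle n is Some t then P t x else True}.
  apply: ae_foralln => n; case: (unpickle n) => [t|]; first exact: h.
  exact: aeW.
by apply: filterS => x hx t; move: (hx (pickle t)); rewrite pickleK.
Qed.

(** The measures of the sections of a null set form a nonnegative function with zero integral. Only
    the measurable null set covering the failure of [P] is cut into sections, so [P] may be
    arbitrary. *)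
Lemma ae_fubini dX dY (X : measurableType dX) (Y : measurableType dY)
    (mu : probability X R) (nu : probability Y R)
    (P : X * Y -> Prop) :
  {ae (pprod mu nu), forall z, P z} ->
  {ae mu, forall x, {ae nu, forall y, P (x, y)}}.
Proof.
move=> [N [mN N0 PN]].
pose F : X -> \bar R := nu \o xsection N.
have mF : measurable_fun setT F by exact: measurable_fun_xsection.
have : {ae mu, forall x, F x = 0}.
  have [h _] := ae_eq_integral_abs mu measurableT mF.
  have /h : \int[mu]_x `|F x| = 0.
    rewrite -[RHS]N0 pprod_integral; apply: eq_integral => x _ /=.
    by rewrite gee0_abs.
  by apply: filterS => x; apply.
apply: filterS => x /= Nx; exists (xsection N x); split => //.
  exact: measurable_xsection.
by move=> y /= Py; rewrite /xsection/=; apply/mem_set; exact: PN.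
Qed.

Lemma ae_exists dX (X : measurableType dX) (mu : probability X R)
    (P : X -> Prop) : {ae mu, forall x, P x} -> exists x, P x.
Proof.
move=> [N [mN N0 PN]]; apply: contrapT => /forallNP h.
have NT : N = setT by apply/seteqP; split=> // x _; apply: PN; exact: h.
by move: N0; rewrite NT probability_setT => /eqP; rewrite onee_eq0.
Qed.

Lemma fst_law dX dY (X : measurableType dX) (Y : measurableType dY)
    (mu : probability X R) (nu : probability Y R) :
  law_preserving (pprod mu nu) mu fst.
Proof.
split; first exact: measurable_fst.
move=> A mA; rewrite (_ : fst @^-1` A = A `*` setT).
  by rewrite pprodE// (probability_setT nu) mule1.
by apply/seteqP; split=> // -[x y] //= [].
Qed.

Lemma snd_law dX dY (X : measurableType dX) (Y : measurableType dY)
    (mu : probability X R) (nu : probability Y R) :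
  law_preserving (pprod mu nu) nu snd.
Proof.
split; first exact: measurable_snd.
move=> A mA; rewrite (_ : snd @^-1` A = setT `*` A).
  by rewrite pprodE// (probability_setT mu) mul1e.
by apply/seteqP; split=> // -[x y] //= [].
Qed.

(** Integrate over the fibres first: over [x], the preimage of [A] has the [nu']-measure of the
    section of [A] at [t x], and [t] then changes variables in the outer integral. Actions whose
    group element depends on the base point have this form. *)
Lemma skew_law dX dX' dY dY' (X : measurableType dX) (X' : measurableType dX')
    (Y : measurableType dY) (Y' : measurableType dY')
    (mu : probability X R) (mu' : probability X' R)
    (nu : probability Y R)
    (nu' : probability Y' R)
    (t : X -> X') (s : X -> Y -> Y') :
  law_preserving mu mu' t ->
  measurable_fun setT (fun z : X * Y => s z.1 z.2) ->
  {ae mu, forall x, forall A, measurable A -> nu (s x @^-1` A) = nu' A} ->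
  law_preserving (pprod mu nu) (pprod mu' nu') (fun z => (t z.1, s z.1 z.2)).
Proof.
move=> [mt ht] ms hs.
have mf : measurable_fun setT (fun z : X * Y => (t z.1, s z.1 z.2)).
  apply: measurable_fun_pair => //.
  exact: measurableT_comp mt (@measurable_fst _ _ X Y).
split=> // A mA; rewrite pprod_integral.
pose F : X' -> \bar R := nu' \o xsection A.
have mS : measurable_fun setT F by exact: measurable_fun_xsection.
transitivity (\int[mu]_x F (t x)).
  apply: ae_eq_integral => //.
  - apply: measurable_fun_xsection.
    by rewrite -[X in measurable X]setTI; exact: mf.
  - exact: measurableT_comp.
  - move: hs; apply: filterS => x hx _ /=.
    apply: etrans (hx (xsection A (t x)) (measurable_xsection _ mA)).
    by congr (nu _); apply/seteqP; split=> y; rewrite /xsection /= !inE.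
rewrite -[LHS](@ge0_integral_pushforward _ _ _ _ R t mt mu setT F)//.
apply: eq_measure_integral => B mB _; exact: ht.
Qed.

(** When the base map only respects null sets, a null set of the product still has null sections at
    [t x] for almost every [x]. *)
Lemma skew_nonsingular dX dX' dY dY' (X : measurableType dX)
    (X' : measurableType dX') (Y : measurableType dY) (Y' : measurableType dY')
    (mu : probability X R) (mu' : probability X' R)
    (nu : probability Y R)
    (nu' : probability Y' R)
    (t : X -> X') (s : X -> Y -> Y') :
  nonsingular mu mu' t ->
  measurable_fun setT (fun z : X * Y => s z.1 z.2) ->
  {ae mu, forall x, forall A, measurable A -> nu (s x @^-1` A) = nu' A} ->
  nonsingular (pprod mu nu) (pprod mu' nu') (fun z => (t z.1, s z.1 z.2)).
Proof.
move=> nst ms hs; have [mt _] := nst.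
have mf : measurable_fun setT (fun z : X * Y => (t z.1, s z.1 z.2)).
  apply: measurable_fun_pair => //.
  exact: measurableT_comp mt (@measurable_fst _ _ X Y).
split=> // A mA A0.
have aeA : {ae mu' \x nu', forall z, ~ A z}.
  by exists A; split => // z /= /contrapT.
have aex := nonsingular_ae nst (ae_fubini aeA).
rewrite pprod_integral; rewrite -(integral0 mu setT).
apply: ae_eq_integral => //.
- apply: measurable_fun_xsection.
  by rewrite -[X in measurable X]setTI; exact: mf.
- move: aex hs; apply: filterS2 => x hx hsx _ /=.
  transitivity (nu' (xsection A (t x))).
    apply: etrans (hsx (xsection A (t x)) (measurable_xsection _ mA)).
    by congr (nu _); apply/seteqP; split=> y; rewrite /xsection /= !inE.
  apply: measure_negligible; first exact: measurable_xsection.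
  by apply: negligibleS hx => y; rewrite /xsection /= inE => Ay; apply.
Qed.

Lemma pushforward_prob dX dY (X : measurableType dX) (Y : measurableType dY)
    (P : probability X R) (f : X -> Y) : measurable_fun setT f ->
  exists Q : probability Y R, law_preserving P Q f.
Proof.
move=> mf; exists (distribution P (mfun_Sub (mem_set mf : f \in mfun))).
by split=> // A mA.
Qed.

(** Glues countably many measurable maps along a measurable choice of index; this makes maps such as
    [b (k x) x], with [k x] in a countable group, measurable. *)
Lemma measurable_fun_count dX dY (X : measurableType dX)
    (Y : measurableType dY) (T : countType) (k : X -> T) (f : T -> X -> Y) :
  (forall t, measurable (k @^-1` [set t])) ->
  (forall t, measurable_fun setT (f t)) ->
  measurable_fun setT (fun x => f (k x) x).
Proof.
move=> mk mf _ A mA; rewrite setTI.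
rewrite (_ : _ @^-1` A =
    \bigcup_n (if unpickle n is Some t then k @^-1` [set t] `&` f t @^-1` A
               else set0)).
  apply: bigcupT_measurable => n; case: (unpickle n) => [t|] //.
  by apply: measurableI => //; rewrite -[X in measurable X]setTI; exact: mf.
apply/seteqP; split=> [x /= Ax|x [n _]].
  by exists (pickle (k x)) => //; rewrite pickleK.
by case: (unpickle n) => [t|] //= [<-].
Qed.

End Law.

(** * Group identities from a left unit and left inverses *)

Section Groups.
Variables (T : Type) (m : T -> T -> T) (i : T -> T) (e : T).
Hypotheses (mA : forall x y z, m x (m y z) = m (m x y) z)
  (m1 : forall x, m e x = x) (mV : forall x, m (i x) x = e).

(** Right inverses come from multiplying by the inverse of [i x]. Only bare operations appear, so
    the section serves countable and Polish groups alike. *)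
Lemma grp_mulV x : m x (i x) = e.
Proof.
rewrite -[LHS]m1 -{1}(mV (i x)) -mA (mA (i x)) mV m1; exact: mV.
Qed.

Lemma grp_mul1 x : m x e = x.
Proof. by rewrite -(mV x) mA grp_mulV m1. Qed.

Lemma grp_mulK x y : m (m y x) (i x) = y.
Proof. by rewrite -mA grp_mulV grp_mul1. Qed.

Lemma grp_mulVK x y : m (m y (i x)) x = y.
Proof. by rewrite -mA mV grp_mul1. Qed.

Lemma grp_Kmul x y : m (i x) (m x y) = y.
Proof. by rewrite mA mV m1. Qed.

Lemma grp_KVmul x y : m x (m (i x) y) = y.
Proof. by rewrite mA grp_mulV m1. Qed.

Lemma grp_inv_uniq x y : m x y = e -> y = i x.
Proof. by move=> xy; rewrite -(grp_Kmul x y) xy grp_mul1. Qed.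

Lemma grp_invK x : i (i x) = x.
Proof. by apply/esym/grp_inv_uniq/mV. Qed.

Lemma grp_invM x y : i (m x y) = m (i y) (i x).
Proof. by apply/esym/grp_inv_uniq; rewrite mA grp_mulK grp_mulV. Qed.

Lemma grp_inv1 : i e = e.
Proof. by apply/esym/grp_inv_uniq/m1. Qed.

Lemma grp_mulI x y z : m x y = m x z -> y = z.
Proof. by move=> h; rewrite -(grp_Kmul x y) h grp_Kmul. Qed.

Lemma grp_Imul x y z : m y x = m z x -> y = z.
Proof. by move=> h; rewrite -(grp_mulK x y) h grp_mulK. Qed.

End Groups.

Definition cgMV (G : cgroup) := grp_mulV (@cg_mulA G) (@cg_mul1 G) (@cg_mulV G).
Definition cgM1 (G : cgroup) := grp_mul1 (@cg_mulA G) (@cg_mul1 G) (@cg_mulV G).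
Definition cgMK (G : cgroup) := grp_mulK (@cg_mulA G) (@cg_mul1 G) (@cg_mulV G).
Definition cgMVK (G : cgroup) := grp_mulVK (@cg_mulA G) (@cg_mul1 G) (@cg_mulV G).
Definition cgKM (G : cgroup) := grp_Kmul (@cg_mulA G) (@cg_mul1 G) (@cg_mulV G).
Definition cgKVM (G : cgroup) := grp_KVmul (@cg_mulA G) (@cg_mul1 G) (@cg_mulV G).
Definition cg_invK (G : cgroup) := grp_invK (@cg_mulA G) (@cg_mul1 G) (@cg_mulV G).
Definition cg_invM (G : cgroup) := grp_invM (@cg_mulA G) (@cg_mul1 G) (@cg_mulV G).
Definition cg_inv1 (G : cgroup) := grp_inv1 (@cg_mulA G) (@cg_mul1 G) (@cg_mulV G).
Definition cg_mulI (G : cgroup) := grp_mulI (@cg_mulA G) (@cg_mul1 G) (@cg_mulV G).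
Definition cg_Imul (G : cgroup) := grp_Imul (@cg_mulA G) (@cg_mul1 G) (@cg_mulV G).

(** * Polish groups and Borel maps into them *)

Section Pol.
Context {R : realType} (L : PolishGroup R).
Definition pgMV := grp_mulV (@pg_mulA R L) (@pg_mul1 R L) (@pg_mulV R L).
Definition pgMK := grp_mulK (@pg_mulA R L) (@pg_mul1 R L) (@pg_mulV R L).
Definition pgMVK := grp_mulVK (@pg_mulA R L) (@pg_mul1 R L) (@pg_mulV R L).
Definition pg_invK := grp_invK (@pg_mulA R L) (@pg_mul1 R L) (@pg_mulV R L).
Definition pg_invM := grp_invM (@pg_mulA R L) (@pg_mul1 R L) (@pg_mulV R L).

Lemma metric_ball_open T (d : T -> T -> R) x (e : R) :
  is_metric d -> metric_open d [set y | d x y < e].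
Proof.
move=> [_ _ _ dtri] y /= xy; exists (e - d x y); first by rewrite subr_gt0.
move=> z yz /=; apply: le_lt_trans (dtri x y z) _.
by rewrite -ltrBrDl.
Qed.

(** Balls of radius [1/(k+1)] around a countable dense set, numbered through [pickle]; numbers that
    code no pair give the empty set. *)
Lemma metric_countable_base T (d : T -> T -> R) :
  is_metric d -> metric_separable d ->
  exists U : nat -> set T, (forall n, metric_open d (U n)) /\
    forall V x, metric_open d V -> V x -> exists n, U n x /\ U n `<=` V.
Proof.
move=> dm [D [cD dD]]; have [_ dz dsym dtri] := dm.
have /countable_injP[f finj] := cD.
have [D0|/set0P[y0 _]] := eqVneq D set0.
  exists (fun=> set0); split=> [n x //|V x _ _].
  by have [y] := dD x 1 ltr01; rewrite D0.
pose g (n : nat) : T :=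
  if pselect (exists2 y, D y & f y = n) is left p then sval (cid2 p) else y0.
have gP y : D y -> g (f y) = y.
  move=> Dy; rewrite /g; case: pselect => [p|]; last by case; exists y.
  case: (cid2 p) => z /= Dz fz.
  by apply: finj; rewrite ?inE.
pose U n := if unpickle n is Some (i, k) then
   [set y | d (g i) y < (k.+1%:R : R)^-1] else set0.
exists U; split.
  move=> n; rewrite /U; case: (unpickle n) => [[i k]|]; last by [].
  exact: metric_ball_open.
move=> V x oV Vx; have [e e0 eV] := oV _ Vx.
have [k hk] : exists k : nat, (k.+1%:R : R)^-1 < e / 2.
  have e20 : 0 < e / 2 by rewrite divr_gt0.
  exists (Num.truncn (e / 2)^-1); rewrite invf_plt ?posrE//.
  exact: truncnS_gt.
have k0 : 0 < (k.+1%:R : R)^-1 by rewrite invr_gt0.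
have [y Dy xy] := dD x _ k0.
exists (pickle (f y, k)); rewrite /U pickleK /= gP//; split.
  by rewrite /= dsym.
move=> z /= yz; apply: eV; apply: le_lt_trans (dtri x y z) _.
rewrite [e]splitr; apply: ltrD; exact: lt_trans hk.
Qed.

Lemma pg_countable_base : exists U : nat -> set L, (forall n, open (U n)) /\
    forall V x, open V -> V x -> exists n, U n x /\ U n `<=` V.
Proof.
have [d [[dm dc] _ ds]] := pg_polish L.
have [U [oU hU]] := metric_countable_base dm ds.
exists U; split; first by move=> n; apply/dc.
by move=> V x /dc oV; exact: hU.
Qed.

Section Borel.
Context {dX : measure_display} (X : measurableType dX).

Lemma borel_measurable_open (f : X -> L) :
  (forall U, open U -> measurable (f @^-1` U)) -> borel_measurable f.
Proof.
move=> h B; pose S := [set C : set L | measurable (f @^-1` C)].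
suff : <<s @open L >> `<=` S by apply.
apply: smallest_sub => //; split=> /=.
- by rewrite /S /= preimage_set0.
- move=> A SA; rewrite /S /= setTD preimage_setC; exact: measurableC.
- by move=> A SA; rewrite /S /= preimage_bigcup; exact: bigcupT_measurable.
Qed.

Lemma measurable_preimage_open (f : X -> L) U :
  borel_measurable f -> open U -> measurable (f @^-1` U).
Proof. by move=> hf oU; apply: hf; exact: sub_sigma_algebra. Qed.

Lemma borel_measurable_cst (l : L) : borel_measurable (fun _ : X => l).
Proof. by move=> B _; rewrite preimage_cst; case: ifP. Qed.

(** By continuity the preimage of [V] under multiplication is open, hence a union of basic
    rectangles, countably many by second countability; each pulls back to an intersection of two
    measurable sets. No sigma-algebra on [L * L] enters. *)
Lemma borel_measurable_mul (f g : X -> L) : borel_measurable f ->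
  borel_measurable g -> borel_measurable (fun x => pg_mul (f x) (g x)).
Proof.
move=> mf mg; apply: borel_measurable_open => V oV.
have [U [oU hU]] := pg_countable_base.
pose W := (fun p : L * L => pg_mul p.1 p.2) @^-1` V.
have oW : open W by move/continuousP : (@pg_mul_cont R L); apply.
rewrite (_ : _ @^-1` V = \bigcup_n (if unpickle n is Some (i, j) then
    if pselect (U i `*` U j `<=` W) then f @^-1` U i `&` g @^-1` U j else set0
    else set0)).
  apply: bigcupT_measurable => n; case: (unpickle n) => [[i j]|] //.
  case: (pselect _) => /= ?; last exact: measurable0.
  by apply: measurableI; exact: measurable_preimage_open.
apply/seteqP; split=> [x Vx|x [n _]].
  have : nbhs (f x, g x) W by apply: open_nbhs_nbhs; split.
  move=> [[A B] /= [nA nB] AB].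
  have [i [ix iA]] := hU _ _ (@open_interior _ A) nA.
  have [j [jx jB]] := hU _ _ (@open_interior _ B) nB.
  exists (pickle (i, j)) => //; rewrite pickleK.
  case: pselect => // -[] [a b] [/= /iA/interior_subset Aa /jB/interior_subset Bb].
  exact: (AB (a, b)).
case: (unpickle n) => [[i j]|] //; case: (pselect _) => // h [/= fx gx].
exact: (h (f x, g x)).
Qed.

Lemma borel_measurable_inv (f : X -> L) : borel_measurable f ->
  borel_measurable (fun x => pg_inv (f x)).
Proof.
move=> mf; apply: borel_measurable_open => V oV.
have oW : open (@pg_inv R L @^-1` V).
  by move/continuousP : (@pg_inv_cont R L); apply.
exact: (measurable_preimage_open mf oW).
Qed.

Lemma borel_measurable_count (T : countType) (k : X -> T) (f : T -> X -> L) :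
  (forall t, measurable (k @^-1` [set t])) ->
  (forall t, borel_measurable (f t)) -> borel_measurable (fun x => f (k x) x).
Proof.
move=> mk mf A mA; rewrite (_ : _ @^-1` A =
    \bigcup_n (if unpickle n is Some t then k @^-1` [set t] `&` f t @^-1` A
               else set0)).
  apply: bigcupT_measurable => n; case: (unpickle n) => [t|] //.
  by apply: measurableI => //; exact: mf.
apply/seteqP; split=> [x /= Ax|x [n _]].
  by exists (pickle (k x)) => //; rewrite pickleK.
by case: (unpickle n) => [t|] //= [<-].
Qed.

End Borel.

Lemma borel_measurable_comp dX dY (X : measurableType dX)
    (Y : measurableType dY) (f : Y -> L) (g : X -> Y) :
  borel_measurable f -> measurable_fun setT g -> borel_measurable (f \o g).
Proof.
move=> mf mg B mB; rewrite comp_preimage.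
by rewrite -[X in measurable X]setTI; apply: mg => //; exact: mf.
Qed.

End Pol.

(** * Independent uniform labels *)

Definition coord_gen (R : realType) (I : Type) : set (set (gfun I R)) :=
  [set S | exists i (B : set R), measurable B /\
     S = (fun x : gfun I R => x i) @^-1` B].

Notation iseq R I := (g_sigma_algebraType (@coord_gen R I)).

Section Iseq.
Context {R : realType}.
Local Open Scope ereal_scope.

Local Notation unif B := (@lebesgue_measure R (B `&` `[0%R, 1%R])).

Lemma measurable_to_iseq dX (X : measurableType dX) (I : Type)
    (f : X -> iseq R I) :
  (forall i, measurable_fun setT (fun x => f x i : R)) -> measurable_fun setT f.
Proof.
move=> h; apply: (@measurability _ _ X (iseq R I) setT f (@coord_gen R I) erefl).
move=> _ [_ [i [B [mB ->]]] <-]; exact: (h i).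
Qed.

Lemma measurable_coord (I : Type) (i : I) :
  measurable_fun setT (fun x : iseq R I => x i : R).
Proof. by move=> _ B mB; rewrite setTI; apply: sub_sigma_algebra; exists i, B. Qed.

Lemma measurable_to_bern dX (X : measurableType dX) (G : cgroup) dY
    (Y : measurableType dY) (f : X -> bern_space R G Y) :
  measurable_fun setT (fun x => (f x).1) ->
  (forall g, measurable_fun setT (fun x => (f x).2 g : R)) ->
  measurable_fun setT f.
Proof.
move=> h1 h2; apply: (@measurability _ _ X (bern_space R G Y) setT f (@bern_gen R G _ Y) erefl).
move=> _ [_ [[A [mA ->]]|[g [B [mB ->]]]] <-]; first exact: h1.
exact: (h2 g).
Qed.

Lemma measurable_bern_fst (G : cgroup) dY (Y : measurableType dY) :
  measurable_fun setT (fun z : bern_space R G Y => z.1).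
Proof. by move=> _ B mB; rewrite setTI; apply: sub_sigma_algebra; left; exists B. Qed.

Lemma measurable_bern_coord (G : cgroup) dY (Y : measurableType dY) g :
  measurable_fun setT (fun z : bern_space R G Y => z.2 g : R).
Proof.
by move=> _ B mB; rewrite setTI; apply: sub_sigma_algebra; right; exists g, B.
Qed.

Lemma measurable_cylinder dX (X : measurableType dX) (I : eqType) (f : X -> I -> R)
    (s : seq I) (B : I -> set R) :
  (forall i, measurable_fun setT (fun x => f x i)) ->
  (forall i, measurable (B i)) ->
  measurable [set x | forall i, i \in s -> B i (f x i)].
Proof.
move=> mf mB; elim: s => [|i s IH].
  by rewrite (_ : [set x | _] = setT)//; apply/seteqP; split.
rewrite (_ : [set x | _] = (fun x => f x i) @^-1` B i `&`
    [set x | forall i, i \in s -> B i (f x i)]).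
  by apply: measurableI => //; rewrite -[X in measurable X]setTI; exact: mf.
apply/seteqP; split => x /=.
  move=> h; split; first by apply: h; rewrite inE eqxx.
  by move=> j js; apply: h; rewrite inE js orbT.
by move=> [hi hs] j; rewrite inE => /orP[/eqP->//|]; exact: hs.
Qed.

Lemma measurable_box (I J : eqType) (f : J -> I) (s : seq J) (B : J -> set R) :
  (forall j, measurable (B j)) ->
  measurable [set x : iseq R I | forall j, j \in s -> B j (x (f j))].
Proof.
move=> mB; apply: (@measurable_cylinder _ (iseq R I) J (fun x j => x (f j)) s B) => //.
by move=> j; exact: measurable_coord.
Qed.

Definition iid (I : countType) (P : probability (iseq R I) R) :=
  forall (s : seq I) (B : I -> set R), uniq s -> (forall i, measurable (B i)) ->
  P [set x | forall i, i \in s -> B i (x i)] = \prod_(i <- s) unif (B i).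

Lemma unif01 : unif setT = 1.
Proof. by rewrite setTI lebesgue_measure_itv /= lte_fin ltr01 sube0. Qed.

Lemma iid_map (I J : countType) (P : probability (iseq R I) R) (s : seq J)
    (f : J -> I) (B : J -> set R) : iid P -> uniq s -> {in s &, injective f} ->
  (forall j, measurable (B j)) ->
  P [set x | forall j, j \in s -> B j (x (f j))] = \prod_(j <- s) unif (B j).
Proof.
move=> iP us fi mB.
(* [B' i] gathers all constraints on coordinate [i]. For [i] in [map f s] there is exactly one, by
   injectivity on [s]. *)
pose B' i := [set t | forall j, j \in s -> f j = i -> B j t].
have mB' i : measurable (B' i).
  rewrite (_ : B' i = [set t | forall j, j \in s ->
      (if f j == i then B j else setT) t]).
    apply: (@measurable_cylinder _ (measurableTypeR R) J (fun t _ => t) s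
      (fun j => if f j == i then B j else setT)).
      by move=> j; exact: measurable_id.
    by move=> j; case: ifP.
  apply/seteqP; split=> t h j js; move: (h j js).
    by case: eqP => [fj|//]; apply.
  by case: eqP => // fj Bj _.
transitivity (P [set x | forall i, i \in map f s -> B' i (x i)]).
  congr (P _); apply/seteqP; split=> x /= h.
    by move=> i _ j js <-; exact: h.
  by move=> j js; apply: (h _ (map_f f js)).
rewrite iP ?map_inj_in_uniq// big_map; apply: eq_big_seq => j js.
congr (lebesgue_measure (_ `&` _)); apply/seteqP; split=> t /=; first exact.
by move=> Bj k ks /(fi _ _ ks js) ->.
Qed.

Section Cylinders.
Context dY (Y : measurableType dY) (I : countType).

Definition cylinders : set (set (Y * iseq R I)) :=
  [set C | exists (A : set Y) (s : seq I) (B : I -> set R),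
    [/\ measurable A, uniq s, forall i, measurable (B i) &
      C = [set z | A z.1 /\ forall i, i \in s -> B i (z.2 i)]]].

Lemma cylinders_measurable C : cylinders C -> measurable C.
Proof.
move=> [A [s [B [mA us mB ->]]]].
rewrite (_ : [set z | _] = fst @^-1` A `&`
   [set z : Y * iseq R I | forall i, i \in s -> B i (z.2 i)]) //.
apply: measurableI.
  by rewrite -[X in measurable X]setTI; exact: measurable_fst.
apply: (@measurable_cylinder _ (Y * iseq R I)%type I (fun z i => z.2 i) s B) => // i.
exact: measurableT_comp (measurable_coord i) (@measurable_snd _ _ Y (iseq R I)).
Qed.

Lemma cylinders_generate : (@measurable _ (Y * iseq R I)%type) = <<s cylinders >>.
Proof.
apply/seteqP; split; last first.
  apply: smallest_sub; [exact: sigma_algebra_measurable|exact: cylinders_measurable].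
(* The same points with the sigma-algebra of cylinders: it suffices that the identity from this
   space to the product is measurable. *)
pose T := g_sigma_algebraType cylinders.
have mid : measurable_fun setT (id : T -> Y * iseq R I).
  apply/measurable_fun_pairP; split.
    move=> _ A mA; rewrite setTI; apply: sub_sigma_algebra.
    exists A, [::], (fun=> setT); split=> //.
    by apply/seteqP; split=> // z [].
  apply: measurable_to_iseq => i _ B mB; rewrite setTI; apply: sub_sigma_algebra.
  exists setT, [:: i], (fun=> B); split=> //.
  apply/seteqP; split=> z /=.
    by move=> Bz; split=> // j; rewrite inE => /eqP ->.
  by move=> [_]; apply; rewrite inE.
by move=> A mA; move: (mid measurableT A mA); rewrite setTI.
Qed.

Lemma cylinders_setI : setI_closed cylinders.
Proof.
move=> _ _ [A [s [B [mA us mB ->]]]] [A' [s' [B' [mA' us' mB' ->]]]].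
exists (A `&` A'), (undup (s ++ s')),
  (fun i => (if i \in s then B i else setT) `&` (if i \in s' then B' i else setT)).
split; [exact: measurableI|exact: undup_uniq| |].
  by move=> i; apply: measurableI; case: ifP.
apply/seteqP; split=> z /=.
  move=> [[Az Bz] [Az' Bz']]; split=> // i _.
  by split; case: ifP => // ?; [exact: Bz|exact: Bz'].
move=> [[Az Az'] h]; split; split=> // i is_.
  by have := h i; rewrite mem_undup mem_cat is_ => /(_ isT) [].
by have := h i; rewrite mem_undup mem_cat is_ orbT => /(_ isT) [].
Qed.

(** Cylinders are closed under intersection, generate, and include the whole space, so their values
    determine a probability. This serves for uniqueness of i.i.d. laws and for recognising the
    Bernoulli measure as a product. *)
Lemma iid_prod_unique (mu : probability Y R) (P : probability (iseq R I) R)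
    (M : probability (Y * iseq R I)%type R) : iid P ->
  (forall (A : set Y) (s : seq I) (B : I -> set R), measurable A -> uniq s ->
    (forall i, measurable (B i)) ->
    M [set z | A z.1 /\ forall i, i \in s -> B i (z.2 i)] =
    mu A * \prod_(i <- s) unif (B i)) ->
  forall X, measurable X -> M X = pprod mu P X.
Proof.
move=> iP h X mX; apply/esym.
apply: (measure_unique cylinders (fun=> setT)) => //.
- exact: cylinders_generate.
- exact: cylinders_setI.
- move=> _; exists setT, [::], (fun=> setT); split=> //.
  by apply/seteqP; split.
- by rewrite bigcup_const//; exists 0%N.
- move=> _ [A [s [B [mA us mB ->]]]].
  apply: etrans _ (esym (h A s B mA us mB)).
  rewrite (_ : [set z | _] = A `*` [set x | forall i, i \in s -> B i (x i)]) //.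
  have mb : measurable [set x : iseq R I | forall i, i \in s -> B i (x i)].
    exact: (@measurable_box I I id s B).
  apply: etrans (pprodE mu P mA mb) _; congr (_ * _); exact: iP.
- move=> _; exact: (@le_lt_trans _ _ 1 _ _ (probability_le1 (pprod mu P) measurableT) (ltey 1)).
Qed.

End Cylinders.

Lemma iid_unique (I : countType) (P Q : probability (iseq R I) R) :
  iid P -> iid Q -> forall A, measurable A -> P A = Q A.
Proof.
(* A one-point factor turns a law of labels into a product, to which [iid_prod_unique] applies. *)
move=> iP iQ A mA; pose D : probability unit R := dirac tt.
have E (P' : probability (iseq R I) R) :
    (pprod D P') (snd @^-1` A) = P' A by exact: (snd_law D P').2.
rewrite -(E P) -(E Q); apply: iid_prod_unique => //.
- move=> B s C mB us mC.
  rewrite (_ : [set z | _] = B `*` [set x | forall i, i \in s -> C i (x i)]) //.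
  have mb : measurable [set x : iseq R I | forall i, i \in s -> C i (x i)].
    exact: (@measurable_box I I id s C).
  by rewrite pprodE//; congr (_ * _); exact: iP.
- by rewrite -[X in measurable X]setTI; exact: measurable_snd.
Qed.

Lemma iid_law dX (T : measurableType dX) (I : countType)
    (mu : probability T R) (P : probability (iseq R I) R) (f : T -> iseq R I) :
  iid P -> (forall i, measurable_fun setT (fun x => f x i : R)) ->
  (forall (s : seq I) (B : I -> set R), uniq s -> (forall i, measurable (B i)) ->
    mu [set x | forall i, i \in s -> B i (f x i)] = \prod_(i <- s) unif (B i)) ->
  law_preserving mu P f.
Proof.
move=> iP mf h; have mf' := measurable_to_iseq mf.
have [Q hQ] := pushforward_prob mu mf'.
split=> // A mA; rewrite hQ.2//; apply: iid_unique => // s B us mB.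
rewrite -hQ.2 ?h//.
exact: measurable_box.
Qed.

Definition reindex (I J : Type) (r : J -> option I) (b : iseq R I)
  (x : iseq R J) : iseq R J := fun j => if r j is Some i then b i else x j.

(** Positions with [r j = Some i] read distinct entries of [b] and the others read [x], so two
    independent families are combined without repetition. Independence, absence of ties and
    resampling along an orbit all rest on this. *)
Lemma reindex_law (I J : countType) (P : probability (iseq R I) R)
    (Q : probability (iseq R J) R) (r : J -> option I) : iid P -> iid Q ->
  (forall j k i, r j = Some i -> r k = Some i -> j = k) ->
  law_preserving (pprod P Q) Q (fun z => reindex r z.1 z.2).
Proof.
move=> iP iQ ri; apply: iid_law => //.
  move=> j; rewrite /reindex; case: (r j) => [i|].
    exact: measurableT_comp (measurable_coord i) (@measurable_fst _ _ _ _).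
  exact: measurableT_comp (measurable_coord j) (@measurable_snd _ _ _ _).
move=> s B us mB; pose s1 := [seq j <- s | r j]; pose s2 := [seq j <- s | ~~ r j].
(* The factorisation below reads [r j] through a default index [i0]; if [I] is empty, [reindex]
   returns [x] unchanged. *)
case: (pselect (exists i : I, True)) => [[i0 _]|noI]; last first.
  have r0 j : r j = None by case: (r j) => // i; case: noI; exists i.
  rewrite (_ : [set z | _] = setT `*` [set x | forall j, j \in s -> B j (x j)]).
    have mb : measurable [set x : iseq R J | forall j, j \in s -> B j (x j)].
      exact: (@measurable_box J J id s B).
    by rewrite pprodE// probability_setT mul1e; exact: iQ.
  apply/seteqP; split=> z /=.
    by move=> h; split=> // j js; move: (h j js); rewrite /reindex r0.
  by move=> [_ h] j js; rewrite /reindex r0; exact: h.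
pose f j := odflt i0 (r j).
rewrite (_ : [set z | _] = [set x | forall j, j \in s1 -> B j (x (f j))] `*`
    [set x | forall j, j \in s2 -> B j (x j)]); last first.
  apply/seteqP; split=> z /=.
    move=> h; split=> j; rewrite mem_filter => /andP[rj js]; move: (h j js) rj.
      by rewrite /reindex /f; case: (r j).
    by rewrite /reindex; case: (r j).
  move=> [h1 h2] j js; move: (h1 j) (h2 j); rewrite !mem_filter js /reindex /f.
  by case: (r j) => [i|] /= h h'; [exact: h|exact: h'].
have m1 : measurable [set x : iseq R I | forall j, j \in s1 -> B j (x (f j))].
  exact: measurable_box.
have m2 : measurable [set x : iseq R J | forall j, j \in s2 -> B j (x j)].
  exact: (@measurable_box J J id s2 B).
rewrite pprodE//.
have E1 := @iid_map I J P s1 f B iP (filter_uniq _ us) _ mB.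
have E2 := iQ s2 B (filter_uniq _ us) mB.
apply: etrans (congr2 mule (E1 _) E2) _; last first.
  by rewrite -big_cat; apply: perm_big; rewrite perm_filterC.
move=> j k; rewrite !mem_filter => /andP[rj _] /andP[rk _]; rewrite /f.
case Ej: (r j) rj => [i|]//; case Ek: (r k) rk => [i'|]// _ _ /= e.
by apply: (ri j k i) => //; rewrite e.
Qed.

Lemma inj_law (I J : countType) (P : probability (iseq R I) R)
    (Q : probability (iseq R J) R) (f : J -> I) : iid P -> iid Q ->
  injective f -> law_preserving P Q (fun x => (fun j => x (f j)) : iseq R J).
Proof.
move=> iP iQ fi; apply: iid_law => //.
  by move=> j; exact: measurable_coord.
by move=> s B us mB; apply: iid_map => // ? ? _ _ /fi.
Qed.

Lemma iid_inj (I J : countType) (P : probability (iseq R I) R) (f : J -> I) :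
  iid P -> injective f -> exists Q : probability (iseq R J) R, iid Q.
Proof.
move=> iP fi.
have [|Q hQ] := @pushforward_prob R _ _ _ _ P (fun x => (fun j => x (f j)) : iseq R J).
  by apply: measurable_to_iseq => j; exact: measurable_coord.
exists Q => s B us mB; rewrite -hQ.2.
  by apply: (iid_map iP) => // ? ? _ _ /fi.
exact: measurable_box.
Qed.

Definition depends_on (I : Type) (K : I -> bool) (A : set (iseq R I)) :=
  forall x y : iseq R I, (forall i, K i -> x i = y i) -> A x -> A y.

(** Replacing the coordinates in [K] by those of an independent copy keeps the law; then [A] sees
    only the first copy and [B] only the second. *)
Lemma iid_indep (I : countType) (P : probability (iseq R I) R) (K : I -> bool)
    (A B : set (iseq R I)) : iid P -> measurable A -> measurable B ->
  depends_on K A -> depends_on (fun i => ~~ K i) B ->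
  P (A `&` B) = P A * P B.
Proof.
move=> iP mA mB dA dB; pose r i := if K i then Some i else None.
have ri j k i : r j = Some i -> r k = Some i -> j = k.
  by rewrite /r; case: ifP => // _; case: ifP => // _ [->] [->].
rewrite -(reindex_law iP iP ri).2; last exact: measurableI.
rewrite -pprodE//; congr (pprod P P _).
have e1 x y i : K i -> reindex r x y i = x i by rewrite /reindex /r => ->.
have e2 x y i : ~~ K i -> reindex r x y i = y i by rewrite /reindex /r => /negbTE ->.
apply/seteqP; split=> -[x y] /= [Ax By]; split.
- by apply: dA Ax => i Ki; rewrite e1.
- by apply: dB By => i Ki; rewrite e2.
- by apply: dA Ax => i Ki; rewrite e1.
- by apply: dB By => i Ki; rewrite e2.
Qed.

End Iseq.

(** * Relative mixing of the Bernoulli shift *)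

Section ProductMore.
Context {R : realType}.
Local Open Scope ereal_scope.

Lemma prod_law dX dX' dY dY' (X : measurableType dX) (X' : measurableType dX')
    (Y : measurableType dY) (Y' : measurableType dY')
    (mu : probability X R) (mu' : probability X' R)
    (nu : probability Y R)
    (nu' : probability Y' R)
    (f : X -> X') (g : Y -> Y') :
  law_preserving mu mu' f -> law_preserving nu nu' g ->
  law_preserving (pprod mu nu) (pprod mu' nu') (fun z => (f z.1, g z.2)).
Proof.
move=> hf [mg hg]; apply: (skew_law hf (s := fun _ => g)).
  exact: measurableT_comp mg (@measurable_snd _ _ X Y).
exact: aeW.
Qed.

Lemma swap_law dX dY (X : measurableType dX) (Y : measurableType dY)
    (mu : probability X R) (nu : probability Y R) :
  law_preserving (pprod mu nu) (pprod nu mu) (fun z => (z.2, z.1)).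
Proof.
have ms : measurable_fun setT (fun z : X * Y => (z.2, z.1)).
  by apply: measurable_fun_pair; [exact: measurable_snd|exact: measurable_fst].
split=> // A mA; have [Q hQ] := pushforward_prob (pprod mu nu) ms.
apply: etrans (hQ.2 A mA) _; apply/esym.
apply: (product_measure_unique (m1 := nu) (m2 := mu) (m' := Q)) => // B C mB mC.
apply: etrans (esym (hQ.2 _ (measurableX mB mC))) _.
have -> : (fun z : X * Y => (z.2, z.1)) @^-1` (B `*` C) = C `*` B.
  by apply/seteqP; split=> z [].
by rewrite pprodE// muleC.
Qed.

Lemma ae_of_sections dX dY (X : measurableType dX) (Y : measurableType dY)
    (mu : probability X R) (nu : probability Y R)
    (E : set (X * Y)) : measurable E ->
  {ae mu, forall x, {ae nu, forall y, E (x, y)}} ->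
  {ae pprod mu nu, forall z, E z}.
Proof.
move=> mE h; have mC := measurableC mE.
exists (~` E); split=> //; rewrite pprod_integral -(integral0 mu setT).
apply: ae_eq_integral => //; first exact: measurable_fun_xsection.
apply: filterS h => x hx _ /=; apply: measure_negligible.
  exact: measurable_xsection.
by apply: negligibleS hx => y; rewrite /xsection /= inE.
Qed.

(** The sets approximable from the algebra [A] form a sigma-algebra. *)
Lemma sigma_algebra_approx dX (X : measurableType dX) (Q : probability X R)
    (A : set (set X)) : A `<=` measurable -> A set0 ->
  setC_closed A -> setU_closed A -> forall S, <<s A >> S ->
  forall e : R, (0 < e)%R -> exists S', A S' /\
    Q ((S `\` S') `|` (S' `\` S)) <= e%:E.
Proof.
move=> Am A0 AC AU S AS.
pose good := [set S : set X | measurable S /\ forall e : R, (0 < e)%R ->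
  exists S', A S' /\ Q ((S `\` S') `|` (S' `\` S)) <= e%:E].
have msd (B C : set X) : measurable B -> measurable C -> measurable ((B `\` C) `|` (C `\` B)).
  by move=> mB mC; apply: measurableU; exact: measurableD.
suff: <<s A >> `<=` good by move=> /(_ _ AS)[].
have goodU (B C : set X) : good B -> good C -> good (B `|` C).
  move=> [mB hB] [mC hC]; split; first exact: measurableU.
  move=> e e0; have e20 : (0 < e / 2)%R by rewrite divr_gt0.
  have [B' [AB' eB]] := hB _ e20; have [C' [AC' eC]] := hC _ e20.
  exists (B' `|` C'); split; first exact: AU.
  have mB' := Am _ AB'; have mC' := Am _ AC'.
  have mBB := msd _ _ mB mB'; have mCC := msd _ _ mC mC'.
  apply: (@le_trans _ _ (Q (((B `\` B') `|` (B' `\` B)) `|`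
                           ((C `\` C') `|` (C' `\` C))))).
    apply: le_measure; rewrite ?inE.
    - by apply: msd; exact: measurableU.
    - exact: measurableU.
    - move=> x [[[Bx|Cx] nx]|[[Bx|Cx] nx]].
      + by left; left; split=> // ?; apply: nx; left.
      + by right; left; split=> // ?; apply: nx; right.
      + by left; right; split=> // ?; apply: nx; left.
      + by right; right; split=> // ?; apply: nx; right.
  apply: le_trans (measureU2 _ mBB mCC) _.
  by rewrite [e]splitr EFinD; exact: leeD.
apply: smallest_sub; last first.
  move=> B AB; split; first exact: Am.
  move=> e e0; exists B; split=> //.
  by rewrite setDv setU0 measure0 lee_fin ltW.
split.
- split=> // e e0; exists set0; split=> //.
  by rewrite setDv setU0 measure0 lee_fin ltW.
- move=> B [mB hB]; rewrite setTD; split; first exact: measurableC.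
  move=> e e0; have [B' [AB' eB]] := hB _ e0.
  exists (~` B'); split; first exact: AC.
  by rewrite !setDE !setCK setUC (setIC (~` B')) (setIC (~` B)) -!setDE.
- move=> F hF; have mF i : measurable (F i) by have [] := hF i.
  have mUF : measurable (\bigcup_k F k) by exact: bigcupT_measurable.
  split=> // e e0.
  have e20 : (0 < e / 2)%R by rewrite divr_gt0.
  (* Finite unions remain approximable. By continuity from above some [U n] misses less than [e / 2]
     of the full union, and the other [e / 2] pays for approximating that [U n]. *)
  pose U n := \big[setU/set0]_(i < n) F i.
  have mU n : measurable (U n) by exact: bigsetU_measurable.
  have gU n : good (U n).
    rewrite /U; elim: n => [|n IH].
      rewrite big_ord0; split=> // d d0; exists set0; split=> //.
      by rewrite setDv setU0 measure0 lee_fin ltW.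
    by rewrite big_ord_recr /=; exact: goodU.
  have cvgD : Q ((\bigcup_k F k) `\` U n) @[n --> \oo] --> 0.
    rewrite (_ : 0 = Q (\bigcap_n ((\bigcup_k F k) `\` U n))); last first.
      rewrite (_ : \bigcap_n _ = set0) ?measure0//.
      apply/seteqP; split=> // x h; have [[k _ Fk] _] := h 0%N I.
      have [_] := h k.+1 I; apply; rewrite /U -bigcup_mkord; exists k => //=.
    apply: nonincreasing_cvg_mu.
    - by rewrite (le_lt_trans (probability_le1 _ _)) ?ltey//; exact: measurableD.
    - by move=> n; exact: measurableD.
    - by apply: bigcapT_measurable => n; exact: measurableD.
    - move=> n m nm; apply/subsetPset; apply: setDS.
      by apply: subset_bigsetU.
  have [n hn] : exists n, Q ((\bigcup_k F k) `\` U n) < (e / 2)%:E.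
    have [N _ hN] := cvgD _ (@open_ereal_lt' R 0 (e / 2)%:E (ltac:(by rewrite lte_fin))).
    by exists N; exact: (hN N (leqnn N)).
  have [S' [AS' eS']] := (gU n).2 _ e20.
  exists S'; split=> //; have mS' := Am _ AS'.
  apply: (@le_trans _ _ (Q (((\bigcup_k F k) `\` U n) `|`
     ((U n `\` S') `|` (S' `\` U n))))).
    apply: le_measure; rewrite ?inE.
    - exact: msd.
    - by apply: measurableU; [exact: measurableD|exact: msd].
    - move=> x [[Fx nS]|[Sx nF]].
        by case: (pselect (U n x)) => Ux; [right; left|left].
      right; right; split=> // Ux; apply: nF.
      by move: Ux; rewrite /U -bigcup_mkord => -[k _ Fk]; exists k.
  apply: le_trans (measureU2 _ _ _) _; [exact: measurableD|exact: msd|].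
  rewrite [e]splitr EFinD; apply: leeD => //; exact: ltW.
Qed.

End ProductMore.

Section Mixing.
Context {R : realType} (H : cgroup).
Local Open Scope ereal_scope.

Definition shift (h : H) (x : iseq R H) : iseq R H :=
  fun k => x (cg_mul (cg_inv h) k).

Lemma shift_law (P : probability (iseq R H) R) (h : H) : iid P ->
  law_preserving P P (shift h).
Proof. by move=> iP; apply: inj_law => // k l /cg_mulI. Qed.

Lemma infinite_notin (K : seq H) : infinite_set [set: H] -> exists h, h \notin K.
Proof.
move=> infH; apply: contrapT => /forallNP h; apply: infH.
rewrite (_ : [set: H] = [set` K]); first exact: finite_seq.
by apply/seteqP; split=> // x _ /=; apply/negPn/negP => xK; exact: (h x).
Qed.

Variables (dM : measure_display) (M : measurableType dM) (mu : probability M R).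
Variables (T : H -> M -> M) (P : probability (iseq R H) R).
Hypotheses (infH : infinite_set [set: H]) (iP : iid P)
  (Tmu : forall h, law_preserving mu mu (T h)).

(** Sets depending on finitely many labels, the same ones for every [m], form an algebra containing
    the cylinders. *)
Lemma fdep_approx (S : set (M * iseq R H)) (e : R) : measurable S -> (0 < e)%R ->
  exists (K : seq H) (S' : set (M * iseq R H)),
   [/\ measurable S', forall m, depends_on (fun i => i \in K) [set b | S' (m, b)] &
     (pprod mu P) ((S `\` S') `|` (S' `\` S)) <= e%:E].
Proof.
move=> mS e0.
pose A : set (set (M * iseq R H)) := [set S' | measurable S' /\
  exists K : seq H, forall m, depends_on (fun i => i \in K) [set b | S' (m, b)]].
have sA : <<s A >> S.
  move: S mS; rewrite cylinders_generate; apply: smallest_sub.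
    exact: smallest_sigma_algebra.
  move=> C cC; apply: sub_sigma_algebra; split; first exact: cylinders_measurable.
  move: cC => [B [s [D [mB us mD ->]]]].
  exists s => m x y xy /= [Bm h]; split=> // i is_; rewrite -xy//; exact: h.
have [||||S' [[mS' [K hK]] hS']] := @sigma_algebra_approx R _ _ (pprod mu P) A _ _ _ _ S sA e e0.
- by move=> ? [].
- by split; [exact: measurable0|exists [::] => m x y _ []].
- move=> B [mB [K hK]]; split; first exact: measurableC.
  by exists K => m x y xy /= nB By; apply: nB; apply: (hK m y x) => // i /xy.
- move=> B C [mB [K hK]] [mC [K' hK']]; split; first exact: measurableU.
  exists (K ++ K') => m x y xy /= [Bx|Cx].
    by left; apply: (hK m x y) => // i iK; apply: xy; rewrite mem_cat iK.
  by right; apply: (hK' m x y) => // i iK; apply: xy; rewrite mem_cat iK orbT.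
- by exists K, S'.
Qed.

(* A set invariant under the diagonal action is approximated by one depending
   on finitely many coordinates K; moving K off itself makes the two copies of
   the approximation independent over M. *)
Lemma relative_mixing (S : set (M * iseq R H)) : measurable S ->
  (forall h, {ae pprod mu P, forall z, S z <-> S (T h z.1, shift h z.2)}) ->
  {ae pprod mu (pprod P P), forall z, S (z.1, z.2.1) -> S (z.1, z.2.2)}.
Proof.
move=> mS Sinv.
pose Q3 := (pprod mu (pprod P P))%E; pose Q := (pprod mu P).
have l1 : law_preserving Q3 Q (fun z => (z.1, z.2.1)).
  exact: (prod_law (law_id _) (fst_law P P)).
have l2 : law_preserving Q3 Q (fun z => (z.1, z.2.2)).
  exact: (prod_law (law_id _) (snd_law P P)).
have lh h : law_preserving Q Q (fun z => (T h z.1, shift h z.2)).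
  exact: (prod_law (Tmu h) (shift_law h iP)).
pose Bad := [set z : M * (iseq R H * iseq R H) | S (z.1, z.2.1) /\ ~ S (z.1, z.2.2)].
have mBad : measurable Bad.
  apply: measurableI; first exact: (measurable_preimage l1.1 mS).
  by apply: measurableC; exact: (measurable_preimage l2.1 mS).
suff Bad0 : Q3 Bad = 0.
  by exists Bad; split=> // z /= /not_implyP.
have Bad_fin : Q3 Bad \is a fin_num by exact: fin_num_measure.
suff Bade (e : R) : (0 < e)%R -> Q3 Bad <= (4 * e)%:E.
  apply/eqP; rewrite -(fineK Bad_fin) eqe eq_le fine_ge0 ?measure_ge0// andbT.
  rewrite leNgt; apply/negP => x0.
  have := Bade (fine (Q3 Bad) / 8)%R; rewrite divr_gt0// => /(_ isT).
  by rewrite -{1}(fineK Bad_fin) lee_fin; lra.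
move=> e0; have [K [S' [mS' dS' eS']]] := fdep_approx mS e0.
(* Avoiding every [i k^-1] with [i], [k] in [K] makes [h^-1 K] disjoint from [K]. *)
have [h hh] := infinite_notin [seq cg_mul i (cg_inv k) | i <- K, k <- K] infH.
have hK i : i \in K -> cg_mul (cg_inv h) i \notin K.
  move=> iK; apply/negP => iK'; move/negP: hh; apply.
  apply/allpairsP; exists (i, cg_mul (cg_inv h) i); split=> //=.
  by rewrite cg_invM cg_invK cg_mulA cgMV cg_mul1.
pose E := (S `\` S') `|` (S' `\` S).
have mE : measurable E by apply: measurableU; exact: measurableD.
pose sh := fun z : M * iseq R H => (T h z.1, shift h z.2).
pose p1 := fun z : M * (iseq R H * iseq R H) => (z.1, z.2.1).
pose p2 := fun z : M * (iseq R H * iseq R H) => (z.1, z.2.2).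
have [N [mN N0 SN]] := Sinv h.
have QN : Q N <= 0 by rewrite /Q N0.
pose C := [set z : M * (iseq R H * iseq R H) | S' (p1 z) /\ ~ S' (sh (p2 z))].
have msh := (lh h).1; have mp1 := l1.1; have mp2 := l2.1.
have lh2 : law_preserving Q3 Q (sh \o p2) by exact: law_comp l2 (lh h).
have mC : measurable C.
  apply: measurableI; first exact: (measurable_preimage mp1 mS').
  by apply: measurableC; exact: (measurable_preimage lh2.1 mS').
pose r i := if i \in K then Some i else None.
have ri j k i : r j = Some i -> r k = Some i -> j = k.
  by rewrite /r; case: ifP => // _; case: ifP => // _ [->] [->].
pose D := [set z : M * iseq R H | S' z /\ ~ S' (sh z)].
have mD : measurable D.
  apply: measurableI => //.
  by apply: measurableC; exact: (measurable_preimage msh mS').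
have lr : law_preserving Q3 Q (fun z => (z.1, reindex r z.2.1 z.2.2)).
  exact: (prod_law (law_id _) (reindex_law iP iP ri)).
(* In [D] the two occurrences of [S'] read disjoint sets of labels, so drawing them from two
   independent sequences does not change the probability. *)
have CD : Q3 C = Q D.
  apply: etrans _ (lr.2 D mD); congr (Q3 _).
  have e1 x y i : i \in K -> reindex r x y i = x i by rewrite /reindex /r => ->.
  have e2 x y i : i \in K -> shift h (reindex r x y) i = shift h y i.
    by move=> iK; rewrite /shift /reindex /r (negbTE (hK _ iK)).
  apply/seteqP; split=> -[m [x y]] [] /= h1 h2; split.
  - by apply: (dS' m x) => // i iK; rewrite e1.
  - by move=> h3; apply: h2; apply: (dS' (T h m) _ (shift h y)) h3 => i iK; rewrite e2.
  - by apply: (dS' m _ x) h1 => i iK; rewrite e1.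
  - by move=> h3; apply: h2; apply: (dS' (T h m) (shift h y)) h3 => i iK; rewrite e2.
(* One [e] for each exchange of [S] and [S']: unshifted and shifted, first for [Bad] with two label
   sequences, then for [D] with one. The trailing zero is for the null set [N] where invariance
   fails. *)
have four : (4 * e)%:E = e%:E + (e%:E + (e%:E + (e%:E + 0))).
  by rewrite adde0 -!EFinD; congr EFin; ring.
have leU d (X : measurableType d) (m : {measure set X -> \bar R}) (A B1 B2 : set X) x y :
    measurable B1 -> measurable B2 -> measurable A -> A `<=` B1 `|` B2 ->
    m B1 <= x -> m B2 <= y -> m A <= x + y.
  move=> mB1 mB2 mA AB h1 h2; apply: (@le_trans _ _ (m (B1 `|` B2))).
    by apply: le_measure; rewrite ?inE//; exact: measurableU.
  by apply: le_trans (measureU2 _ mB1 mB2) _; exact: leeD.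
have QD : Q D <= e%:E + (e%:E + 0).
  apply: (leU _ _ (pprod mu P) D E (sh @^-1` E `|` N)) => //.
  - by apply: measurableU => //; exact: (measurable_preimage msh mE).
  - move=> z [S'z nS'].
    case: (pselect (S z)) => Sz; last by left; right.
    case: (pselect (S (sh z))) => Ssz; first by right; left; left.
    by right; right; apply: SN => /= -[/(_ Sz)].
  - have mshE := measurable_preimage msh mE.
    apply: (leU _ _ (pprod mu P) _ (sh @^-1` E) N) => //; first exact: measurableU.
      by apply: (le_trans _ eS'); rewrite -((lh h).2 E mE).
rewrite four.
apply: (leU _ _ (pprod mu (pprod P P))%E Bad (p1 @^-1` E)
    ((sh \o p2) @^-1` E `|` (p2 @^-1` N `|` C))) => //.
- exact: (measurable_preimage mp1 mE).
- apply: measurableU; first exact: (measurable_preimage lh2.1 mE).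
  by apply: measurableU => //; exact: (measurable_preimage mp2 mN).
- move=> z [Sz nSz].
  case: (pselect (S' (p1 z))) => S1; last by left; left.
  case: (pselect (S (sh (p2 z)))) => Ssz.
    by right; right; left; apply: SN => /= -[_ /(_ Ssz)].
  case: (pselect (S' (sh (p2 z)))) => S2; first by right; left; right.
  by right; right; right.
- by apply: (le_trans _ eS'); rewrite -(l1.2 E mE).
apply: (leU _ _ (pprod mu (pprod P P))%E _ ((sh \o p2) @^-1` E) (p2 @^-1` N `|` C)) => //.
- exact: (measurable_preimage lh2.1 mE).
- by apply: measurableU => //; exact: (measurable_preimage mp2 mN).
- apply: measurableU; first exact: (measurable_preimage lh2.1 mE).
  by apply: measurableU => //; exact: (measurable_preimage mp2 mN).
- by apply: (le_trans _ eS'); rewrite -(lh2.2 E mE).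
rewrite -[X in _ <= X]add0e.
apply: (leU _ _ (pprod mu (pprod P P))%E _ (p2 @^-1` N) C) => //.
- exact: (measurable_preimage mp2 mN).
- by apply: measurableU => //; exact: (measurable_preimage mp2 mN).
- by apply: (@le_trans _ _ (Q N)); [rewrite -(l2.2 N mN)|exact: QN].
- by apply: (le_trans _ QD); rewrite -CD.
Qed.

End Mixing.

Section Assoc.
Context {R : realType}.
Local Open Scope ereal_scope.

Lemma assoc_law dX dY dZ (X : measurableType dX) (Y : measurableType dY)
    (Z : measurableType dZ) (P : probability X R) (Q : probability Y R)
    (S : probability Z R) :
  law_preserving (pprod (pprod P Q) S) (pprod P (pprod Q S))
    (fun z => (z.1.1, (z.1.2, z.2))).
Proof.
have mf : measurable_fun setT (fun z : (X * Y) * Z => (z.1.1, (z.1.2, z.2))).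
  have m1 := @measurable_fst _ _ (X * Y)%type Z.
  apply: measurable_fun_pair; first exact: measurableT_comp (@measurable_fst _ _ X Y) m1.
  apply: measurable_fun_pair; last exact: measurable_snd.
  exact: measurableT_comp (@measurable_snd _ _ X Y) m1.
split=> // A mA; have mB := measurable_preimage mf mA.
set B := _ @^-1` A in mB *; rewrite !pprod_integral.
pose f : X * Y -> \bar R := fun p => S (xsection B p).
have mfS : measurable_fun setT f by exact: measurable_fun_xsection.
have f0 p : 0 <= f p by exact: measure_ge0.
transitivity (\int[P]_x fubini_F Q f x).
  exact: (@fubini_tonelli1 _ _ _ _ _ P Q f mfS f0).
apply: eq_integral => x _; rewrite pprod_integral; apply: eq_integral => y _.
by congr (S _); apply/seteqP; split=> z; rewrite /xsection /= !inE /= inE.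
Qed.

(** Peels off the outer factor, so that iteration resamples the innermost coordinate of a nested
    product. *)
Lemma resample_right_law dX dY dZ (X : measurableType dX) (Y : measurableType dY)
    (Z : measurableType dZ) (P : probability X R) (Q : probability Y R)
    (S : probability Z R) (f : Y * Z -> Y) :
  law_preserving (pprod Q S) Q f ->
  law_preserving (pprod (pprod P Q) S) (pprod P Q)
    (fun z => (z.1.1, f (z.1.2, z.2))).
Proof. by move=> hf; exact: law_comp (assoc_law P Q S) (prod_law (law_id _) hf). Qed.

End Assoc.

(** * Removing the dependence on the auxiliary factor *)

Section BiInvariant.
Context {R : realType} (L : PolishGroup R) (d : L -> L -> R).
Hypotheses (dc : compatible_metric d)
  (dinv : forall x y z, d (pg_mul z x) (pg_mul z y) = d x y /\
                        d (pg_mul x z) (pg_mul y z) = d x y).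

Lemma dist_mulV x y : d x y = d (pg_mul x (pg_inv y)) (pg_one L).
Proof. by rewrite -(pgMV y) (dinv _ _ (pg_inv y)).2. Qed.

(** Right invariance turns the distance of two functions into the distance of the single function
    [f g^-1] from the unit, and a ball around the unit is open. *)
Lemma measurable_dist_lt dX (X : measurableType dX) (f g : X -> L) (e : R) :
  borel_measurable f -> borel_measurable g -> measurable [set x | d (f x) (g x) < e].
Proof.
move=> mf mg; have [dm dT] := dc; have [_ _ dsym _] := dm.
rewrite (_ : [set x | _] = (fun x => pg_mul (f x) (pg_inv (g x))) @^-1`
    [set l | d (pg_one L) l < e]).
  apply: measurable_preimage_open.
    by apply: borel_measurable_mul => //; exact: borel_measurable_inv.
  by apply/dT; exact: metric_ball_open.
by apply/seteqP; split=> x /=; rewrite (dist_mulV (f x) (g x)) (dsym (pg_one L)).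
Qed.

Lemma small_dist_eq x y : (forall n : nat, d x y < n.+1%:R^-1) -> x = y.
Proof.
move=> h; have [[d0 dz _ _] _] := dc; apply/dz/eqP.
rewrite eq_le d0 andbT leNgt; apply/negP => xy.
have := h (Num.truncn (d x y)^-1); apply/negP; rewrite -leNgt.
by rewrite invf_ple ?posrE// ltW// truncnS_gt.
Qed.

Lemma measurable_eq_fun dX (X : measurableType dX) (f g : X -> L) :
  borel_measurable f -> borel_measurable g -> measurable [set x | f x = g x].
Proof.
move=> mf mg.
rewrite (_ : [set x | _] = \bigcap_n [set x | d (f x) (g x) < n.+1%:R^-1]).
  by apply: bigcapT_measurable => n; exact: measurable_dist_lt.
have [[d0 dz _ _] _] := dc.
apply/seteqP; split=> x /=.
  by move=> /dz e n _ /=; rewrite e invr_gt0.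
by move=> h; apply: small_dist_eq => n; exact: h.
Qed.

(* The union of the null sets of a countable base is null. *)
Lemma near_itself_pos dX (X : measurableType dX) (P : probability X R)
    (f : X -> L) (e : R) : borel_measurable f -> 0 < e ->
  {ae P, forall x, P [set y | d (f x) (f y) < e] <> 0%E}.
Proof.
move=> mf e0; have [U [oU hU]] := pg_countable_base L.
have [dm dT] := dc; have [_ dz dsym dtri] := dm.
pose N n := if pselect (P (f @^-1` U n) = 0%E) then f @^-1` U n else set0.
have mU n : measurable (f @^-1` U n) by exact: measurable_preimage_open.
have mN n : measurable (N n).
  by rewrite /N; case: (pselect _) => /= _; [exact: mU|exact: measurable0].
have N0 n : P (N n) = 0%E by rewrite /N; case: (pselect _) => //= _; rewrite measure0.
have : P.-negligible (\bigcup_n N n).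
  by apply: negligible_bigcup => n; exists (N n); split; [exact: mN|exact: N0|].
apply: negligibleS => x /= /contrapT Px.
have e20 : 0 < e / 2 by rewrite divr_gt0.
have oB : open [set y | d (f x) y < e / 2] by apply/dT; exact: metric_ball_open.
have [n [Unx UB]] : exists n, U n (f x) /\ U n `<=` [set y | d (f x) y < e / 2].
  by apply: hU => //=; rewrite (iffRL (dz _ _) erefl).
exists n => //; rewrite /N; case: (pselect _) => //= nP; apply: nP.
apply: (@subset_measure0 _ _ _ P _ [set y | d (f x) (f y) < e]) => //.
  by apply: measurable_dist_lt => //; exact: borel_measurable_cst.
by move=> y /= /UB /= h; apply: lt_trans h _; lra.
Qed.

End BiInvariant.

Section Descent.
Context {R : realType} (H : cgroup) (L : PolishGroup R).
Variables (dV dY : measure_display) (V : measurableType dV) (Y : measurableType dY).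
Variables (muV : probability V R) (nu : probability Y R)
  (P : probability (iseq R H) R).
Variables (tV : H -> V -> V) (b : H -> Y -> Y).
Hypotheses (infH : infinite_set [set: H]) (iP : iid P) (Linv : G_inv L)
  (tVmu : forall h, law_preserving muV muV (tV h))
  (bnu : forall h, law_preserving nu nu (b h)).

Local Notation B := (iseq R H).
Local Notation nuP := (pprod nu P).
Local Notation Q := (pprod muV nuP).

Definition diag (h : H) (z : Y * B) : Y * B := (b h z.1, shift h z.2).

Lemma diag_law h : law_preserving nuP nuP (diag h).
Proof. exact: (prod_law (bnu h) (shift_law h iP)). Qed.

Variables (w : H -> Y * B -> L) (F : V * (Y * B) -> L) (u : H -> V * Y -> L).
Hypotheses (mF : borel_measurable F)
  (mu_ : forall h, borel_measurable (u h)).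
Hypothesis Fwu : forall h, {ae Q, forall z, u h (z.1, z.2.1) =
  pg_mul (pg_mul (F (tV h z.1, diag h z.2)) (w h z.2)) (pg_inv (F z))}.

Let Psi (z : V * (V * (Y * B))) : L :=
  pg_mul (F (z.1, z.2.2)) (pg_inv (F z.2)).

Let mv1 : measurable_fun setT (fun z : V * (V * (Y * B)) => (z.1, z.2.2)).
Proof.
apply: measurable_fun_pair; first exact: measurable_fst.
exact: measurableT_comp (@measurable_snd _ _ V (Y * B)%type) (@measurable_snd _ _ V _).
Qed.

Let mPsi : borel_measurable Psi.
Proof.
apply: borel_measurable_mul; first exact: (borel_measurable_comp mF mv1).
apply: borel_measurable_inv.
exact: (borel_measurable_comp mF (@measurable_snd _ _ V (V * (Y * B))%type)).
Qed.

Let resample (z : (V * (V * (Y * B))) * B) : V * (V * (Y * B)) :=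
  (z.1.1, (z.1.2.1, (z.1.2.2.1, z.2))).

Let mresample : measurable_fun setT resample.
Proof.
have m1 := @measurable_fst _ _ (V * (V * (Y * B)))%type B.
have m2 := @measurable_snd _ _ (V * (V * (Y * B)))%type B.
apply: measurable_fun_pair.
  exact: measurableT_comp (@measurable_fst _ _ V _) m1.
have m3 := measurableT_comp (@measurable_snd _ _ V (V * (Y * B))%type) m1.
apply: measurable_fun_pair.
  exact: measurableT_comp (@measurable_fst _ _ V _) m3.
apply: measurable_fun_pair => //.
have m4 := measurableT_comp (@measurable_snd _ _ V (Y * B)%type) m3.
exact: measurableT_comp (@measurable_fst _ _ Y B) m4.
Qed.

Let M := pprod muV Q.

Let Psi_resample :
  {ae M, forall z, {ae P, forall c, Psi (resample (z, c)) = Psi z}}.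
Proof.
have [d [dc dinv]] := Linv.
(* The original labels belong to the base of the product; the resampled ones form the coordinate in
   which mixing is applied. *)
pose S e := [set z : (V * (V * (Y * B))) * B | d (Psi z.1) (Psi (resample z)) < e].
have mS e : measurable (S e).
  apply: (measurable_dist_lt dc dinv).
    exact: (borel_measurable_comp mPsi (@measurable_fst _ _ _ _)).
  exact: (borel_measurable_comp mPsi mresample).
pose T h (z : V * (V * (Y * B))) := (tV h z.1, (tV h z.2.1, diag h z.2.2)).
have lT h : law_preserving M M (T h).
  exact: (prod_law (tVmu h) (prod_law (tVmu h) (diag_law h))).
have l2 : law_preserving M Q snd by exact: snd_law.
have l1 : law_preserving M Q (fun z => (z.1, z.2.2)).
  exact: (prod_law (law_id _) (snd_law muV nuP)).
have PsiT h : {ae M, forall z, Psi (T h z) =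
    pg_mul (pg_mul (u h (z.1, z.2.2.1)) (Psi z)) (pg_inv (u h (z.2.1, z.2.2.1)))}.
  move: (law_ae l1 (Fwu h)) (law_ae l2 (Fwu h)); apply: filterS2 => z /= -> ->.
  rewrite /Psi /T /= !pg_invM pg_invK !pg_mulA pgMVK.
  by rewrite pgMVK pgMK.
have lres : law_preserving (pprod M P) M resample.
  apply: (@resample_right_law R _ _ _ V (V * (Y * B))%type B muV Q P
    (fun p => (p.1.1, (p.1.2.1, p.2)))).
  apply: (@resample_right_law R _ _ _ V (Y * B)%type B muV nuP P
    (fun p => (p.1.1, p.2))).
  exact: (prod_law (fst_law nu P) (law_id P)).
(* [PsiT] is used at [z] and at its resampled copy. The factors [u h] read only [V] and [Y], so they
   are the same at both and bi-invariance removes them. *)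
have inv e h : {ae pprod M P, forall z, S e z <-> S e (T h z.1, shift h z.2)}.
  move: (law_ae (fst_law M P) (PsiT h)) (law_ae lres (PsiT h)).
  apply: filterS2 => z h1 h2.
  change (S e z <-> d (Psi (T h z.1)) (Psi (T h (resample z))) < e).
  rewrite h1 h2.
  by rewrite (dinv _ _ _).2 (dinv _ _ _).1.
(* Mixing yields an implication, void if almost no resampling stayed within [e]. Fibre by fibre in
   the labels, [near_itself_pos] excludes this. *)
have pos e : 0 < e -> {ae M, forall z, P (xsection (S e) z) <> 0%E}.
  move=> e0; pose E := [set z | P (xsection (S e) z) <> 0%E].
  have mE : measurable E.
    pose f : V * (V * (Y * B)) -> \bar R := P \o xsection (S e).
    have mf : measurable_fun setT f by exact: measurable_fun_xsection.
    rewrite (_ : E = ~` (f @^-1` [set 0%E])); first exact/measurableC/measurable_preimage.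
    by apply/seteqP; split.
  apply: (ae_of_sections mE); apply: aeW => v'.
  have mE1 := measurable_preimage (@pair1_measurable _ _ _ _ v') mE.
  apply: (ae_of_sections mE1); apply: aeW => v.
  have mE2 := measurable_preimage (@pair1_measurable _ _ _ _ v) mE1.
  apply: (ae_of_sections mE2); apply: aeW => y.
  pose f (c : B) := Psi (v', (v, (y, c))).
  have mf : borel_measurable f.
    apply: (borel_measurable_comp mPsi).
    apply: measurableT_comp (@pair1_measurable _ _ _ _ v') _.
    apply: measurableT_comp (@pair1_measurable _ _ _ _ v) _.
    exact: pair1_measurable.
  move: (near_itself_pos dc dinv P mf e0); apply: filterS => c hc.
  rewrite /E /= => h; apply: hc; rewrite -h; congr (P _).
  by apply/seteqP; split=> c' /=; rewrite /xsection /S /= inE.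
have all n : {ae M, forall z, {ae P, forall c, S n.+1%:R^-1 (z, c)}}.
  have n0 : 0 < (n.+1%:R^-1 : R) by rewrite invr_gt0.
  move: (ae_fubini (relative_mixing infH iP lT (mS n.+1%:R^-1) (inv n.+1%:R^-1))) (pos _ n0).
  apply: filterS2 => z /ae_fubini /= h hp.
  have [c [Sc hc]] : exists c, S n.+1%:R^-1 (z, c) /\
      {ae P, forall c', S n.+1%:R^-1 (z, c) -> S n.+1%:R^-1 (z, c')}.
    apply: contrapT => /forallNP nh; apply: hp.
    apply: measure_negligible; first exact: measurable_xsection.
    apply: negligibleS h => c; rewrite /xsection /= inE => Sc hc.
    by apply: (nh c); split.
  by apply: filterS hc => c'; apply.
have : {ae M, forall z, forall n, {ae P, forall c, S n.+1%:R^-1 (z, c)}}.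
  by apply: ae_foralln => n; exact: all.
apply: filterS => z hz.
have : {ae P, forall c, forall n, S n.+1%:R^-1 (z, c)} by exact: ae_foralln.
by apply: filterS => c hc; apply/esym/(small_dist_eq dc) => n; exact: hc.
Qed.

Lemma descent : exists (F0 : Y * B -> L) (w0 : H -> Y -> L),
  [/\ borel_measurable F0, forall h, borel_measurable (w0 h) &
   forall h, {ae nuP, forall z, w0 h z.1 =
     pg_mul (pg_mul (F0 (diag h z)) (w h z)) (pg_inv (F0 z))}].
Proof.
have [d [dc dinv]] := Linv.
have [v0 hv0] := ae_exists (ae_fubini Psi_resample).
pose E := [set z : (V * (Y * B)) * B | Psi (resample ((v0, z.1), z.2)) = Psi (v0, z.1)].
have mE : measurable E.
  have m1 : measurable_fun setT (fun z : (V * (Y * B)) * B => ((v0, z.1), z.2)).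
    apply: measurable_fun_pair; last exact: measurable_snd.
    exact: measurableT_comp (@pair1_measurable _ _ _ _ v0) (@measurable_fst _ _ _ _).
  apply: (measurable_eq_fun dc dinv).
    exact: (borel_measurable_comp mPsi (measurableT_comp mresample m1)).
  apply: (borel_measurable_comp mPsi).
  exact: measurableT_comp (@pair1_measurable _ _ _ _ v0) (@measurable_fst _ _ _ _).
have aeE := law_ae (swap_law P Q) (ae_of_sections mE hv0).
(* Since [Psi (v0, _)] almost surely ignores the labels, evaluating at one generic sequence [b0]
   defines the factor [A] measurably. *)
have [b0 hb0] := ae_exists (ae_fubini aeE).
pose F0 z := F (v0, z).
pose A (z : V * Y) := pg_mul (F (z.1, (z.2, b0))) (pg_inv (F (v0, (z.2, b0)))).
have mb0 : measurable_fun setT (fun z : V * Y => (z.1, (z.2, b0))).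
  apply: measurable_fun_pair; first exact: measurable_fst.
  exact: measurableT_comp (@pair2_measurable _ _ _ _ b0) (@measurable_snd _ _ V Y).
have mF0 : borel_measurable F0 by exact: (borel_measurable_comp mF (@pair1_measurable _ _ _ _ v0)).
have mA : borel_measurable A.
  apply: borel_measurable_mul; first exact: (borel_measurable_comp mF mb0).
  apply: borel_measurable_inv; apply: (borel_measurable_comp mF).
  apply: measurableT_comp (@pair1_measurable _ _ _ _ v0) _.
  exact: measurableT_comp (@pair2_measurable _ _ _ _ b0) (@measurable_snd _ _ V Y).
have FA : {ae Q, forall z, F z = pg_mul (A (z.1, z.2.1)) (F0 z.2)}.
  move: hb0; apply: filterS => -[v [y c]]; rewrite /E /resample /Psi /= /A /F0 /= => e.
  have -> : F (v0, (y, c)) =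
      pg_mul (pg_mul (F (v0, (y, b0))) (pg_inv (F (v, (y, b0))))) (F (v, (y, c))).
    by rewrite e pgMVK.
  by rewrite !pg_mulA pgMVK pgMV pg_mul1.
clearbody A.
have lT h : law_preserving Q Q (fun z => (tV h z.1, diag h z.2)).
  exact: (prod_law (tVmu h) (diag_law h)).
pose W h (z : V * Y) := pg_mul (pg_mul (pg_inv (A (tV h z.1, b h z.2))) (u h z)) (A z).
have key h : {ae Q, forall z, W h (z.1, z.2.1) =
    pg_mul (pg_mul (F0 (diag h z.2)) (w h z.2)) (pg_inv (F0 z.2))}.
  move: FA (law_ae (lT h) FA) (Fwu h); apply: filterS3 => -[v z] /= e1 e2 e3.
  rewrite /W /= e3 e1 e2 /= (pg_invM (A (v, z.1)) (F0 z)) !pg_mulA pg_mulV pg_mul1.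
  by rewrite pgMVK.
(* [W h] almost surely equals an expression free of [V], so [V] may be frozen at a single [v1];
   countability of [H] gives one that works for all [h]. *)
have [v1 hv1] := ae_exists (ae_fubini (ae_forall_count key)).
exists F0, (fun h y => W h (v1, y)); split=> //.
  move=> h; apply: borel_measurable_mul; last first.
    exact: (borel_measurable_comp mA (@pair1_measurable _ _ _ _ v1)).
  apply: borel_measurable_mul; last first.
    exact: (borel_measurable_comp (@mu_ h) (@pair1_measurable _ _ _ _ v1)).
  apply: borel_measurable_inv; apply: (borel_measurable_comp mA).
  exact: measurableT_comp (@pair1_measurable _ _ _ _ (tV h v1)) (bnu h).1.
by move=> h; apply: filterS hv1 => z; exact.
Qed.

End Descent.

(** * Binary digits *)

Section Digits.
Context {R : realType}.
Implicit Types (eps : nat -> bool) (u x : R).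

Local Notation hp n := ((2^-1 : R) ^+ n).

Lemma hp_gt0 n : 0 < hp n. Proof. by rewrite exprn_gt0// invr_gt0. Qed.

Lemma hpS n : hp n = hp n.+1 + hp n.+1.
Proof. by rewrite exprS; lra. Qed.

Lemma hp_expr n : 2 ^+ n * hp n = 1.
Proof. by rewrite -exprMn divff ?expr1n. Qed.

(* Most significant bit first. *)
Fixpoint dnum eps n : nat := if n is m.+1 then ((dnum eps m).*2 + eps m)%N else 0%N.

(** The number with binary digits [eps], as the limit of its truncations; their integer numerators
    can be compared directly with [truncn]. *)
Definition bin eps : R := limn (fun n => (dnum eps n)%:R * hp n).

Lemma dnumSE eps n : (dnum eps n.+1)%:R = 2 * (dnum eps n)%:R + (eps n)%:R :> R.
Proof. by rewrite /= natrD -muln2 natrM mulrC. Qed.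

Lemma dnum_lowerS eps n :
  (dnum eps n)%:R * hp n <= (dnum eps n.+1)%:R * hp n.+1.
Proof.
rewrite dnumSE hpS; have := hp_gt0 n.+1.
have : 0 <= (eps n)%:R :> R by []; nra.
Qed.

Lemma dnum_upperS eps n :
  ((dnum eps n.+1)%:R + 1) * hp n.+1 <= ((dnum eps n)%:R + 1) * hp n.
Proof.
rewrite dnumSE (hpS n); have := hp_gt0 n.+1.
have : (eps n)%:R <= 1 :> R by case: (eps n). nra.
Qed.

Lemma dnum_upperS_lt eps n : eps n = false ->
  ((dnum eps n.+1)%:R + 1) * hp n.+1 < ((dnum eps n)%:R + 1) * hp n.
Proof.
move=> e; have e0 : (eps n)%:R = 0 :> R by rewrite e.
by rewrite dnumSE e0 (hpS n); have := hp_gt0 n.+1; nra.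
Qed.

Lemma dnum_lower_mono eps n m : (n <= m)%N ->
  (dnum eps n)%:R * hp n <= (dnum eps m)%:R * hp m.
Proof.
elim: m => [|m IH]; first by rewrite leqn0 => /eqP ->.
rewrite leq_eqVlt => /orP[/eqP -> //|]; rewrite ltnS => /IH h.
exact: le_trans h (dnum_lowerS _ _).
Qed.

Lemma dnum_upper_mono eps n m : (n <= m)%N ->
  ((dnum eps m)%:R + 1) * hp m <= ((dnum eps n)%:R + 1) * hp n.
Proof.
elim: m => [|m IH]; first by rewrite leqn0 => /eqP ->.
rewrite leq_eqVlt => /orP[/eqP -> //|]; rewrite ltnS => /IH h.
exact: le_trans (dnum_upperS _ _) h.
Qed.

Lemma dnum_le_upper eps n m :
  (dnum eps m)%:R * hp m <= ((dnum eps n)%:R + 1) * hp n.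
Proof.
apply: le_trans (dnum_lower_mono eps (leq_maxl m n)) _.
apply: le_trans (dnum_upper_mono eps (leq_maxr m n)).
by rewrite ler_pM2r ?hp_gt0// lerDl.
Qed.

Lemma bin_cvg eps : (fun n => (dnum eps n)%:R * hp n) @ \oo --> bin eps.
Proof.
apply: nondecreasing_is_cvgn; first by move=> n m; exact: dnum_lower_mono.
by exists (((dnum eps 0)%:R + 1) * hp 0) => _ [n _ <-]; exact: dnum_le_upper.
Qed.

Lemma bin_ge eps n : (dnum eps n)%:R * hp n <= bin eps.
Proof.
apply: (nondecreasing_cvgn_le (u_ := fun n => (dnum eps n)%:R * hp n)).
  by move=> k m; exact: dnum_lower_mono.
by apply: cvgP; exact: bin_cvg.
Qed.

Lemma bin_le eps n : bin eps <= ((dnum eps n)%:R + 1) * hp n.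
Proof.
apply: limr_le; first by apply: cvgP; exact: bin_cvg.
by apply: nearW => m; exact: dnum_le_upper.
Qed.

(** The upper ends of the dyadic intervals decrease, strictly at each zero digit. Strictness is what
    lets [truncn] recover the digits. *)
Lemma bin_lt eps n : (exists2 m, (n <= m)%N & eps m = false) ->
  bin eps < ((dnum eps n)%:R + 1) * hp n.
Proof.
move=> [m nm em]; apply: le_lt_trans (bin_le eps m.+1) _.
exact: lt_le_trans (dnum_upperS_lt em) (dnum_upper_mono eps nm).
Qed.

Lemma bin_unique eps x N :
  (forall n, (N <= n)%N -> (dnum eps n)%:R * hp n <= x <= ((dnum eps n)%:R + 1) * hp n) ->
  bin eps = x.
Proof.
move=> h; apply: (@cvg_lim _ _ _ _ _ _ x) => //.
apply: (@squeeze_cvgr _ _ _ _ (fun n => x - hp n) (cst x)).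
- exists N => // n Nn; have /andP[h1 h2] := h n Nn.
  by rewrite /= h1 andbT lerBlDr; move: h2; rewrite mulrDl mul1r.
- rewrite -[X in _ --> X]subr0; apply: cvgB; first exact: cvg_cst.
  by apply: cvg_expr; rewrite ger0_norm ?invr_ge0// invf_lt1 ?ltr1n.
- exact: cvg_cst.
Qed.

Definition digit u j : bool := odd (Num.truncn (2 ^+ j.+1 * u)).

(** Passing from [2^n u] to [2^(n+1) u] doubles the integer part and adds its new parity, which is
    the next digit. *)
Lemma dnum_digit u n : 0 <= u < 1 -> dnum (digit u) n = Num.truncn (2 ^+ n * u).
Proof.
move=> /andP[u0 u1]; elim: n => [|n IH].
  by rewrite /= expr0 mul1r; apply/esym/truncn_def; rewrite u0.
have v0 : 0 <= 2 ^+ n * u by rewrite mulr_ge0// exprn_ge0.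
rewrite [LHS]/= IH -[RHS]odd_double_half addnC -/(digit u n); congr (_ + _.*2)%N.
apply/truncn_def; set k := Num.truncn (2 ^+ n.+1 * u).
have /andP[k1 k2] : k%:R <= 2 ^+ n.+1 * u < k.+1%:R.
  by apply: truncn_itv; rewrite mulr_ge0// exprn_ge0.
have kE : k%:R = (odd k)%:R + 2 * (k./2)%:R :> R.
  by rewrite -{1}(odd_double_half k) natrD -muln2 natrM mulrC.
have o0 : 0 <= (odd k)%:R :> R by [].
have o1 : (odd k)%:R <= 1 :> R by case: (odd k).
rewrite -!natr1 exprS -mulrA kE in k1 k2 *.
by apply/andP; split; lra.
Qed.

Lemma dnum_digit_itv u n : 0 <= u < 1 ->
  (dnum (digit u) n)%:R * hp n <= u < ((dnum (digit u) n)%:R + 1) * hp n.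
Proof.
move=> u01; have /andP[u0 u1] := u01; rewrite dnum_digit//.
have v0 : 0 <= 2 ^+ n * u by rewrite mulr_ge0// exprn_ge0.
have /andP[k1 k2] := truncn_itv v0.
have E : u = (2 ^+ n * u) * hp n by rewrite mulrAC hp_expr mul1r.
by rewrite {2 3}E ler_pM2r ?hp_gt0// ltr_pM2r ?hp_gt0// k1 /= natr1.
Qed.

Lemma bin_digit u : 0 <= u < 1 -> bin (digit u) = u.
Proof.
move=> u01; apply: (@bin_unique _ _ 0%N) => n _.
by have /andP[-> /ltW ->] := dnum_digit_itv n u01.
Qed.

(** Excludes the second expansion of dyadic numbers, the one ending in ones. Between these sequences
    and [[0,1)], [bin] and [digit] are mutually inverse. *)
Definition many_zeros eps := forall n, exists2 m, (n <= m)%N & eps m = false.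

Lemma many_zeros_digit u : 0 <= u < 1 -> many_zeros (digit u).
Proof.
move=> u01 n; apply: contrapT => h.
have h1 m : (n <= m)%N -> digit u m.
  by move=> nm; apply: contrapT => /negP/negbTE um; apply: h; exists m.
have /andP[_ lt] := dnum_digit_itv n u01.
(* With only ones from [n] on, the upper end of the dyadic interval would stay fixed and [u] would
   equal it, against the half-open interval. *)
have const m : (n <= m)%N -> ((dnum (digit u) m)%:R + 1) * hp m =
    ((dnum (digit u) n)%:R + 1) * hp n.
  elim: m => [|m IH]; first by rewrite leqn0 => /eqP ->.
  rewrite leq_eqVlt => /orP[/eqP -> //|]; rewrite ltnS => nm.
  have e1 : (digit u m)%:R = 1 :> R by rewrite h1.
  by rewrite -IH// dnumSE e1 (hpS m); ring.
have : bin (digit u) = ((dnum (digit u) n)%:R + 1) * hp n.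
  apply: (@bin_unique _ _ n) => m nm; rewrite -(const m nm) lexx andbT.
  by rewrite ler_pM2r ?hp_gt0// lerDl.
by rewrite bin_digit// => e; move: lt; rewrite -e ltxx.
Qed.

Lemma bin01 eps : many_zeros eps -> 0 <= bin eps < 1.
Proof.
move=> mz; have := bin_ge eps 0; have := bin_lt (mz 0%N).
by rewrite /= add0r !expr0 mulr1 mul0r => -> ->.
Qed.

Lemma digit_bin eps : many_zeros eps -> digit (bin eps) = eps.
Proof.
move=> mz; apply/funext => j.
have -> : digit (bin eps) j = odd (dnum eps j.+1); last first.
  by rewrite /= oddD odd_double; case: (eps j).
rewrite /digit; congr (odd _); apply: truncn_def.
have h0 := hp_gt0 j.+1; have h1 := bin_ge eps j.+1; have h2 := bin_lt (mz j.+1).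
rewrite -(@ler_pM2r _ (hp j.+1))// -(@ltr_pM2r _ (hp j.+1))//.
by rewrite mulrAC hp_expr mul1r h1 -natr1.
Qed.

(** Changing one binary digit is a translation on each of two pieces of [[0,1)], whence it preserves
    Lebesgue measure. *)
Definition flip j u : R := if 0 <= u < 1 then
  (if digit u j then u - hp j.+1 else u + hp j.+1) else u.

Lemma flip_spec j u : 0 <= u < 1 -> 0 <= flip j u < 1 /\
  forall i, digit (flip j u) i = digit u i (+) (i == j).
Proof.
move=> u01; pose eps i := digit u i (+) (i == j).
have mz : many_zeros eps.
  move=> n; have [m nm em] := many_zeros_digit u01 (maxn n j.+1).
  exists m; first exact: leq_trans (leq_maxl _ _) nm.
  rewrite /eps em; apply/eqP => mj.
  by move: nm; rewrite mj geq_max ltnn andbF.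
suff E : bin eps = flip j u.
  by rewrite -E; split; [exact: bin01|move=> i; rewrite digit_bin].
pose s : R := if digit u j then - hp j.+1 else hp j.+1.
(* Beyond position [j] the two sequences agree, so their truncations keep the constant difference
   [s]. *)
have dE k : (dnum eps (j.+1 + k))%:R * hp (j.+1 + k) =
    (dnum (digit u) (j.+1 + k))%:R * hp (j.+1 + k) + s.
  elim: k => [|k IH].
    have low n : (n <= j)%N -> dnum eps n = dnum (digit u) n.
      elim: n => //= n IH nj; rewrite IH ?(ltnW nj)// /eps.
      by rewrite (ltn_eqF nj) addbF.
    rewrite addn0 !dnumSE low// /eps eqxx /s.
    have e0 : (false : nat)%:R = 0 :> R by [].
    have e1 : (true : nat)%:R = 1 :> R by [].
    by case: (digit u j); rewrite /= ?e0 ?e1; ring.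
  rewrite addnS (dnumSE eps (j.+1 + k)) (dnumSE (digit u) (j.+1 + k)).
  move: IH; rewrite (hpS (j.+1 + k)).
  have -> : eps (j.+1 + k)%N = digit u (j.+1 + k)%N.
    rewrite /eps; have -> : (j.+1 + k == j)%N = false; last by rewrite addbF.
    by apply/negbTE; rewrite neq_ltn orbC addSn ltnS leq_addr.
  move: (dnum eps _)%:R (dnum (digit u) _)%:R (hp _) => A B h.
  by move=> IH; rewrite !mulrDr in IH; rewrite !mulrDl; lra.
have -> : flip j u = u + s by rewrite /flip u01 /s; case: ifP.
apply: (@bin_unique _ _ j.+1) => n jn.
have /andP[h1 /ltW h2] := dnum_digit_itv n u01.
rewrite -(subnKC jn) in h1 h2 *; rewrite mulrDl dE mul1r.
by rewrite mulrDl mul1r in h2; apply/andP; split; lra.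
Qed.

End Digits.

(** * Flipping a digit preserves the uniform law *)

Section FlipLaw.
Context {R : realType}.
Local Notation leb := (@lebesgue_measure R).
Local Notation unif B := (leb (B `&` `[0%R, 1%R])).
Implicit Types (u c : R) (A B : set R).

Lemma lebesgue_measure_translate c A : measurable A ->
  leb ((fun x => x + c) @^-1` A) = leb A.
Proof.
move=> mA; rewrite -[LHS]/(pushforward leb
  ((fun x => x + c) : measurableTypeR R -> measurableTypeR R) A).
apply/esym/lebesgue_measure_unique => //=.
  by apply: measurable_funD; [exact: measurable_id|exact: measurable_cst].
move=> mc _ [[a b]] _ <-.
rewrite /pushforward /= (_ : _ @^-1` _ = `]a - c, b - c]%classic); last first.
  by apply/seteqP; split=> x; rewrite /= !in_itv /= ltrBlDr lerBrDr.
rewrite !lebesgue_measure_itv /= !lte_fin ltrD2r.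
by case: ifP => // _; congr (_%:E); ring.
Qed.

Lemma measurable_digit j : measurable [set u : R | digit u j].
Proof.
pose f u : R := 2 ^+ j.+1 * u.
have mf : measurable_fun setT f by apply: measurable_funM; [exact: measurable_cst|exact: measurable_id].
rewrite (_ : [set u | _] =
  f @^-1` (\bigcup_n (if odd n then `[n%:R, n.+1%:R[%classic else set0))).
  apply: (measurable_preimage mf); apply: bigcupT_measurable => n.
  by case: ifP.
apply/seteqP; split=> u /=.
  rewrite /digit => ou; exists (Num.truncn (2 ^+ j.+1 * u)) => //.
  rewrite ou /= in_itv /=; apply: truncn_itv.
  rewrite leNgt; apply/negP => u0; move: ou.
  by rewrite (_ : Num.truncn _ = 0%N)//; apply/truncn0Pn; rewrite -ltNge (lt_trans u0).
move=> [n _]; case: ifP => //= on; rewrite in_itv /= => h.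
by rewrite /digit (truncn_def h).
Qed.

Lemma measurable_flip j : measurable_fun setT (@flip R j).
Proof.
have mI : measurable `[0%R : R, 1%R[%classic by [].
have E u : flip j u = if (u \in `[0%R, 1%R[%classic) then
    (if digit u j then u - 2^-1 ^+ j.+1 else u + 2^-1 ^+ j.+1) else u.
  by rewrite mem_setE in_itv.
rewrite (funext E); apply: measurable_fun_ifT.
- apply: (measurable_fun_bool true); rewrite setTI.
  rewrite (_ : _ @^-1` _ = `[0%R : R, 1%R[%classic)//.
  by apply/seteqP; split=> x /=; [move=> /set_mem|move=> ?; exact: mem_set].
- apply: measurable_fun_ifT.
  + apply: (measurable_fun_bool true); rewrite setTI.
    exact: (measurable_digit j).
  + by apply: measurable_funB; [exact: measurable_id|exact: measurable_cst].
  + by apply: measurable_funD; [exact: measurable_id|exact: measurable_cst].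
- exact: measurable_id.
Qed.

(** [flip j] exchanges the halves where digit [j] is one and zero, by the translations [- h] and
    [+ h]. *)
Lemma flip_unif j B : measurable B -> unif (flip j @^-1` B) = unif B.
Proof.
move=> mB; pose h : R := 2^-1 ^+ j.+1.
pose I := `[0%R : R, 1%R[%classic.
pose D1 := I `&` [set u | digit u j]; pose D0 := I `&` ~` [set u | digit u j].
have mI : measurable I by exact: measurable_itv.
have mD1 : measurable D1 by apply: measurableI => //; exact: (measurable_digit j).
have mD0 : measurable D0.
  by apply: measurableI => //; apply: measurableC; exact: (measurable_digit j).
have IE u : I u = (0 <= u < 1) by rewrite /I /= in_itv.
(* The flip acts on [[0,1)], so the endpoint [1] is dropped as a null set. *)
have split2 A : measurable A -> unif A = (leb (A `&` D1) + leb (A `&` D0))%E.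
  move=> mA.
  have -> : unif A = leb (A `&` I).
    apply/eqP; rewrite eq_le; apply/andP; split.
      have m1 : measurable (A `&` I) by exact: measurableI.
      have m2 : measurable [set (1 : R)] by exact: measurable_set1.
      apply: (@le_trans _ _ (leb ((A `&` I) `|` [set 1%R]))).
        apply: le_measure; rewrite ?inE; [exact: measurableI|exact: measurableU|].
        move=> x [Ax]; rewrite /I /= !in_itv /= => /andP[x0]; rewrite le_eqVlt.
        by move=> /orP[/eqP ->|x1]; [right|left; split=> //; rewrite x0].
      apply: (le_trans (measureU2 (@lebesgue_measure R) m1 m2)).
      have l1 : (leb [set 1%R] <= 0)%E by rewrite lebesgue_measure_set1.
      by rewrite -[leRHS]adde0; apply: leeD => //; exact: l1.
    apply: le_measure; rewrite ?inE; [exact: measurableI|exact: measurableI|].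
    move=> x [Ax]; rewrite /I /= !in_itv /= => /andP[x0 x1].
    by split=> //; rewrite x0 ltW.
  rewrite -measureU//.
  - congr (leb _); rewrite -setIUr; congr (_ `&` _).
    by rewrite /D1 /D0 -setIUr setUv setIT.
  - exact: measurableI.
  - exact: measurableI.
  - by apply/seteqP; split=> x // [[_ [_ h1]] [_ [_ h2]]].
have mfB : measurable (flip j @^-1` B) by exact: measurable_preimage (measurable_flip j) mB.
have fd u : I u -> flip j u = if digit u j then u - h else u + h.
  by rewrite IE /flip => ->.
have fI u : I u -> I (flip j u) /\ digit (flip j u) j = ~~ digit u j.
  by rewrite !IE => /flip_spec -/(_ j)[h1 h2]; split=> //; rewrite h2 eqxx addbT.
rewrite (split2 _ mfB) (split2 _ mB) addeC; congr (_ + _)%E.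
- rewrite -[RHS](@lebesgue_measure_translate h); last exact: measurableI.
  congr (leb _); apply/seteqP; split=> u /=.
    move=> [Bu [Iu /negP/negbTE du]]; have [I2 d2] := fI _ Iu; move: Bu I2 d2.
    rewrite (fd _ Iu) du => Bu I2 d2.
    by split=> //; split=> //=; rewrite d2.
  move=> [Bu [Iu /= du]]; have [I2 d2] := fI _ Iu; rewrite (fd _ Iu) du /= addrK in I2 d2.
  split; last by split=> //=; rewrite d2.
  by rewrite /= (fd _ I2) d2.
- rewrite -[RHS](@lebesgue_measure_translate (- h)); last exact: measurableI.
  congr (leb _); apply/seteqP; split=> u /=.
    move=> [Bu [Iu /= nu]]; have [I2 d2] := fI _ Iu; move: Bu I2 d2.
    rewrite (fd _ Iu) nu => Bu I2 d2.
    by split=> //; split=> //=; rewrite d2.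
  move=> [Bu [Iu /negP/negbTE du]]; have [I2 d2] := fI _ Iu; move: I2 d2.
  rewrite (fd _ Iu) du /= subrK => I2 d2; split; last by split.
  by rewrite /= (fd _ I2) d2.
Qed.

End FlipLaw.

(** * Merging a sequence of labels into one label *)

Section Merge.
Context {R : realType}.
Local Notation leb := (@lebesgue_measure R).
Local Notation unif B := (leb (B `&` `[0%R, 1%R])).
Local Notation hp n := ((2^-1 : R) ^+ n).

Lemma measurable_bin dX (X : measurableType dX) (eps : X -> nat -> bool) :
  (forall n, measurable [set x | eps x n]) ->
  measurable_fun setT (fun x => @bin R (eps x)).
Proof.
move=> me; apply: (measurable_fun_cvg (h := fun n x => (dnum (eps x) n)%:R * hp n)).
  move=> n; apply: measurable_funM; last exact: measurable_cst.
  elim: n => [|n IH]; first exact: measurable_cst.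
  rewrite (_ : (fun x => _) = (fun x => 2 * (dnum (eps x) n)%:R +
     (if eps x n then 1 else 0))); last first.
    by apply/funext => x; rewrite dnumSE; case: (eps x n).
  apply: measurable_funD.
    by apply: measurable_funM => //; exact: measurable_cst.
  apply: measurable_fun_ifT; [|exact: measurable_cst|exact: measurable_cst].
  by apply: (measurable_fun_bool true); rewrite setTI; exact: me.
by move=> x _; exact: bin_cvg.
Qed.

Lemma unif_compl0 (B : set R) : measurable B -> `[0%R, 1%R[ `<=` B -> unif (~` B) = 0%E.
Proof.
move=> mB IB; apply: (@subset_measure0 _ _ _ (@lebesgue_measure R) _ [set 1%R]).
- by apply: measurableI => //; exact: measurableC.
- exact: measurable_set1.
- move=> x /= [nB]; rewrite in_itv /= => /andP[x0]; rewrite le_eqVlt.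
  by move=> /orP[/eqP //|x1]; case: nB; apply: IB; rewrite /= in_itv /= x0.
- exact: lebesgue_measure_set1.
Qed.

Lemma coordinatewise_law (I : countType) (P : probability (iseq R I) R)
    (t : I -> R -> R) : iid P -> (forall i, measurable_fun setT (t i)) ->
  (forall i B, measurable B -> unif (t i @^-1` B) = unif B) ->
  law_preserving P P (fun v => (fun i => t i (v i)) : iseq R I).
Proof.
move=> iP mt ht; apply: iid_law => //.
  by move=> i; exact: measurableT_comp (mt i) (measurable_coord i).
move=> s B us mB; have mtB i : measurable (t i @^-1` B i).
  exact: (measurable_preimage (mt i) (mB i)).
apply: etrans (iP s (fun i => t i @^-1` B i) us mtB) _.
by apply: eq_bigr => i _; exact: ht.
Qed.

Lemma iid_unit_ae (I : countType) (P : probability (iseq R I) R) : iid P ->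
  {ae P, forall v, forall i, 0 <= v i < 1}.
Proof.
move=> iP; apply: ae_forall_count => i.
have mI : measurable (`[0%R : R, 1%R[%classic) by exact: measurable_itv.
exists [set v | forall j, j \in [:: i] -> (~` `[0%R : R, 1%R[) (v j)]; split.
- by apply: (@measurable_box R I I id [:: i] (fun=> _)) => j; exact: measurableC.
- apply: etrans (iP [:: i] (fun=> ~` `[0%R : R, 1%R[) isT (fun _ => measurableC mI)) _.
  by rewrite big_seq1; exact: unif_compl0.
- by move=> v /= nv j; rewrite inE => /eqP ->; rewrite in_itv.
Qed.

Section Pairing.
Variables (e : nat -> nat * nat) (e' : nat * nat -> nat).
Hypotheses (eK : cancel e e') (e'K : cancel e' e).

Definition merged (v : nat -> R) (n : nat) : bool := digit (v (e n).1) (e n).2.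
Definition merge (v : nat -> R) : R := bin (merged v).
Definition split_digits (k : nat) (u : R) : R := bin (fun i => digit u (e' (k, i))).

Local Notation good v := (forall k : nat, 0 <= v k < 1).

(** The label [0] alone supplies the zeros: [m] bounds the digit positions met at indices below [n],
    so a zero digit of this label beyond [m] sits at an index at least [n]. *)
Lemma many_zeros_merged (v : nat -> R) : good v -> many_zeros (merged v).
Proof.
move=> gv n; pose m := \max_(i < n) (e i).2.
have [i mi di] := many_zeros_digit (gv 0%N) m.+1.
exists (e' (0%N, i)); last by rewrite /merged e'K.
rewrite leqNgt; apply/negP => lt.
have : (i <= m)%N.
  have := @leq_bigmax _ (fun j : 'I_n => (e j).2) (Ordinal lt).
  by rewrite /= e'K.
by rewrite leqNgt mi.
Qed.

Lemma split_merge (v : nat -> R) k : good v -> split_digits k (merge v) = v k.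
Proof.
move=> gv; rewrite /split_digits /merge digit_bin; last exact: many_zeros_merged.
rewrite -[RHS](bin_digit (gv k)); congr (bin _); apply/funext => i.
by rewrite /merged e'K.
Qed.

Lemma measurable_merge : measurable_fun setT (merge : iseq R nat -> R).
Proof.
apply: measurable_bin => n.
exact: (measurable_preimage (measurable_coord (e n).1) (measurable_digit (e n).2)).
Qed.

Lemma measurable_split_digits k : measurable_fun setT (split_digits k).
Proof. by apply: measurable_bin => n; exact: measurable_digit. Qed.

Section MergeLaw.
Variables (P : probability (iseq R nat) R) (iP : iid P).

Let G : set (iseq R nat) := [set v | good v].
Let Ev n i : set (iseq R nat) := [set v | good v /\ dnum (merged v) n = i].

Let mG : measurable G.
Proof.
rewrite (_ : G = \bigcap_k ((fun v : iseq R nat => v k) @^-1` `[0%R, 1%R[%classic)).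
  apply: bigcapT_measurable => k.
  exact: (measurable_preimage (measurable_coord k) (measurable_itv _)).
apply/seteqP; split=> v /=.
  by move=> gv k _; rewrite /= in_itv /=.
by move=> h k; have := h k I; rewrite /= in_itv.
Qed.

Let mdig n : measurable [set v : iseq R nat | merged v n].
Proof.
exact: (measurable_preimage (measurable_coord (e n).1) (measurable_digit (e n).2)).
Qed.

Let mEv n i : measurable (Ev n i).
Proof.
rewrite (_ : Ev n i = G `&` [set v | dnum (merged v) n = i]) //.
apply: measurableI => //; elim: n i => [|n IH] i.
  case: (eqVneq i 0%N) => [->|i0].
    by rewrite (_ : [set v | _] = setT)//; apply/seteqP; split.
  rewrite (_ : [set v | _] = set0)//; apply/seteqP; split=> // v /= h.
  by move: i0; rewrite -h.
rewrite (_ : [set v | _] =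
   ([set v : iseq R nat | dnum (merged v) n = i./2] `&`
     (if odd i then [set v : iseq R nat | merged v n] else ~` [set v | merged v n]))).
  apply: measurableI => //; case: ifP => _; first exact: mdig.
  by apply: measurableC; exact: mdig.
have E a (b : bool) : (a.*2 + b)%N = i <-> a = i./2 /\ b = odd i.
  split=> [<-|[-> ->]]; last by rewrite addnC odd_double_half.
  by rewrite addnC half_bit_double oddD odd_double addbF oddb.
apply/seteqP; split=> v /=.
  by move=> /E[h1 h2]; split=> //; rewrite -h2; case: ifP => //= ->.
move=> [h1 h2]; apply/E; split=> //; move: h2; case: (odd i) => //=.
by move=> /negP/negbTE.
Qed.

Let flipc n (v : iseq R nat) : iseq R nat :=
  fun i => if i == (e n).1 then flip (e n).2 (v i) else v i.

Let flipc_law n : law_preserving P P (flipc n).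
Proof.
apply: (@coordinatewise_law _ P
  (fun i u => if i == (e n).1 then flip (e n).2 u else u) iP).
  by move=> i; case: eqP => _; [exact: measurable_flip|exact: measurable_id].
by move=> i B mB; case: eqP => _ //; exact: flip_unif.
Qed.

Let flipc_good n (v : iseq R nat) : good v <-> good (flipc n v).
Proof.
split=> h k; have := h k; rewrite /flipc; case: eqP => // _.
  by move=> /flip_spec -/(_ (e n).2)[].
by rewrite /flip; case: ifP => // ->.
Qed.

Let flipc_merged n (v : iseq R nat) m : good v -> merged (flipc n v) m = merged v m (+) (m == n).
Proof.
move=> gv; rewrite /merged /flipc; case: eqP => [em|nem].
  have [_ ->] := flip_spec (e n).2 (gv (e m).1); congr (_ (+) _).
  apply/eqP/eqP => [em2|-> //].
  by rewrite -(eK m) -(eK n) (surjective_pairing (e m)) em em2 -surjective_pairing.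
by case: eqP => [mn|_]; [case: nem; rewrite mn|rewrite addbF].
Qed.

Let flipc_dnum n (v : iseq R nat) : good v -> dnum (merged (flipc n v)) n = dnum (merged v) n.
Proof.
move=> gv; suff h m : (m <= n)%N -> dnum (merged (flipc n v)) m = dnum (merged v) m by exact: h.
elim: m => //= m IH mn; rewrite IH ?(ltnW mn)// flipc_merged//.
by rewrite (ltn_eqF mn) addbF.
Qed.

(** Flipping the merged digit [n] preserves [P] and all earlier digits, so the two halves of each
    dyadic event are equally likely. Induction gives uniformity without treating independence of the
    digits separately. *)
Let Ev_law n i : (i < 2 ^ n)%N -> P (Ev n i) = (hp n)%:E.
Proof.
elim: n i => [|n IH] i.
  rewrite expn0 ltnS leqn0 expr0 => /eqP ->; rewrite -(probability_setT P).
  have [N [mN N0 GN]] := iid_unit_ae iP.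
  apply/eqP; rewrite eq_le le_measure ?inE//=.
  apply: (@le_trans _ _ (P (Ev 0 0 `|` N))).
    apply: le_measure; rewrite ?inE//; first exact: measurableU.
    by move=> v _; case: (pselect (good v)) => gv; [left|right; exact: GN].
  apply: (le_trans (measureU2 _ (mEv 0 0) mN)).
  by rewrite [X in (_ + X)%E]N0 adde0.
move=> i2; have i2' : (i./2 < 2 ^ n)%N by rewrite ltn_half_double -mul2n -expnS.
pose H b := Ev n i./2 `&` [set v | merged v n = b].
have mH b : measurable (H b).
  apply: measurableI => //; case: b; first exact: mdig.
  rewrite (_ : [set v | _] = ~` [set v | merged v n]); first by apply: measurableC; exact: mdig.
  by apply/seteqP; split=> v /=; [move=> ->|move=> /negP/negbTE].
have Hflip b : P (H b) = P (H (~~ b)).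
  rewrite -((flipc_law n).2 _ (mH (~~ b))); congr (P _).
  apply/seteqP; split=> v /=.
    move=> [[gv dv] mv]; rewrite /H /Ev /=; split; first split.
    - exact: (iffLR (flipc_good n v) gv).
    - by rewrite flipc_dnum.
    - by rewrite flipc_merged// eqxx addbT mv.
  move=> [[/(iffRL (flipc_good n v)) gv]]; rewrite flipc_dnum// => dv.
  by rewrite /= flipc_merged// eqxx addbT => /negb_inj.
have Hsum : (P (H true) + P (H false) = (hp n)%:E)%E.
  rewrite -measureU//; last first.
    by apply/seteqP; split=> v // [[_ h1] [_ h2]]; move: h1 h2 => /= ->.
  rewrite -(IH _ i2'); congr (P _); rewrite /H -setIUr.
  rewrite (_ : _ `|` _ = setT) ?setIT//; apply/seteqP; split=> v //= _.
  by case: (merged v n); [left|right].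
have -> : Ev n.+1 i = H (odd i).
  have E a (b : bool) : (a.*2 + b)%N = i <-> a = i./2 /\ b = odd i.
    split=> [<-|[-> ->]]; last by rewrite addnC odd_double_half.
    by rewrite addnC half_bit_double oddD odd_double addbF oddb.
  apply/seteqP; split=> v /=.
    by move=> [gv /E[]].
  by move=> [[gv dv] mv]; split=> //; apply/E.
have HE b : P (H b) = P (H true) by case: b => //; rewrite Hflip.
have Hfin : P (H true) \is a fin_num by exact: fin_num_measure.
rewrite HE; move: Hsum; rewrite (HE false) -(fineK Hfin) -EFinD => -[].
by rewrite (hpS n) => h; congr (_%:E); lra.
Qed.

Let Ev_below n a : (a <= 2 ^ n)%N ->
  P [set v | good v /\ (dnum (merged v) n < a)%N] = (a%:R * hp n)%:E.
Proof.
have mB b : measurable [set v : iseq R nat | good v /\ (dnum (merged v) n < b)%N].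
  rewrite (_ : [set v | _] = \bigcup_(i in [set i | (i < b)%N]) Ev n i).
    by apply: bigcup_measurable => i _.
  apply/seteqP; split=> v /=; first by move=> [gv h]; exists (dnum (merged v) n).
  by move=> [i /= ib [gv di]]; split=> //; rewrite di.
elim: a => [|a IH] ha.
  rewrite mul0r (_ : [set v | _] = set0) ?measure0//.
  by apply/seteqP; split=> // v [].
rewrite (_ : [set v | _] = [set v | good v /\ (dnum (merged v) n < a)%N] `|` Ev n a).
  rewrite -natr1 mulrDl mul1r EFinD -(IH (ltnW ha)) -(Ev_law ha).
  apply: measureU => //.
  by apply/seteqP; split=> // v [[_ h1] [_ h2]]; move: h1; rewrite h2 ltnn.
apply/seteqP; split=> v /=.
  move=> [gv]; rewrite ltnS leq_eqVlt => /orP[/eqP h|h]; first by right.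
  by left.
by move=> [[gv h]|[gv h]]; split=> //; [exact: ltnW|rewrite h].
Qed.

Let merge_itv01 (v : nat -> R) : good v -> 0 <= merge v < 1.
Proof. by move=> gv; apply: bin01; exact: many_zeros_merged. Qed.

(** For each [n] the probability lies between [i / 2^n] and [(i+1) / 2^n], the dyadic neighbours of
    [t], whose events are computed by [Ev_below]. *)
Let merge_cdf (t : R) : 0 <= t < 1 -> P (merge @^-1` `]-oo, t[) = t%:E.
Proof.
move=> /andP[t0 t1]; pose S : set (iseq R nat) := merge @^-1` `]-oo, t[; rewrite -/S.
have mS : measurable S by exact: (measurable_preimage measurable_merge (measurable_itv _)).
have Sfin : P S \is a fin_num by exact: fin_num_measure.
rewrite -(fineK Sfin); congr (_%:E); set x := fine _.
suff close n : `|x - t| <= hp n.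
  apply/eqP; rewrite -subr_eq0 -normr_eq0 eq_le normr_ge0 andbT.
  have hc : (fun n => hp n) @ \oo --> (0 : R).
    by apply: cvg_expr; rewrite ger0_norm ?invr_ge0// invf_lt1 ?ltr1n.
  rewrite -(cvg_lim _ hc)//; apply: limr_ge; first by apply: cvgP; exact: hc.
  by apply: nearW.
set i := Num.truncn (2 ^+ n * t).
have p0 : 0 < 2 ^+ n :> R by rewrite exprn_gt0.
have /andP[i1 i2] : i%:R <= 2 ^+ n * t < i.+1%:R by apply: truncn_itv; rewrite mulr_ge0// ltW.
have ilt : (i < 2 ^ n)%N.
  rewrite -(ltr_nat R) natrX; apply: le_lt_trans i1 _.
  by rewrite -[ltRHS]mulr1 ltr_pM2l.
have h0 := hp_gt0 n.
have tE : t = (2 ^+ n * t) * hp n by rewrite mulrAC hp_expr mul1r.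
have j1 : i%:R * hp n <= t by rewrite [leRHS]tE ler_pM2r.
have j2 : t < (i%:R + 1) * hp n by rewrite [ltLHS]tE ltr_pM2r// natr1.
have mA a : (a <= 2 ^ n)%N -> measurable [set v : iseq R nat | good v /\ (dnum (merged v) n < a)%N].
  move=> _; rewrite (_ : [set v | _] = \bigcup_(i in [set i | (i < a)%N]) Ev n i).
    by apply: bigcup_measurable => k _.
  apply/seteqP; split=> v /=; first by move=> [gv h]; exists (dnum (merged v) n).
  by move=> [k /= ib [gv di]]; split=> //; rewrite di.
have lo : i%:R * hp n <= x.
  rewrite -lee_fin fineK// -(Ev_below (ltnW ilt)).
  apply: le_measure; rewrite ?inE//; first exact: mA (ltnW ilt).
  move=> v [gv dv]; rewrite /S /= in_itv /=.
  apply: lt_le_trans (bin_lt (many_zeros_merged gv n)) _.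
  apply: le_trans j1; rewrite ler_pM2r// natr1 ler_nat; exact: dv.
have hi : x <= (i%:R + 1) * hp n.
  rewrite -lee_fin fineK// natr1 -(Ev_below ilt).
  have [N [mN N0 GN]] := iid_unit_ae iP.
  have mAi := mA _ ilt.
  apply: (@le_trans _ _ (P ([set v | good v /\ (dnum (merged v) n < i.+1)%N] `|` N))).
    apply: le_measure; rewrite ?inE//; first exact: measurableU.
    move=> v; rewrite /S /= in_itv /= => vt.
    case: (pselect (good v)) => gv; last by right; exact: GN.
    left; split=> //; rewrite -(ltr_nat R) -natr1.
    rewrite -(@ltr_pM2r _ (hp n))//; apply: le_lt_trans (bin_ge _ _) _.
    exact: lt_trans vt j2.
  apply: (le_trans (measureU2 _ mAi mN)).
  by rewrite [X in (_ + X)%E]N0 adde0.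
rewrite mulrDl mul1r in hi j2.
by rewrite ler_norml; apply/andP; split; lra.
Qed.

Lemma merge_law B : measurable B -> P (merge @^-1` B) = unif B.
Proof.
have m01 : measurable `[0%R : R, 1%R] by exact: measurable_itv.
have mm : measurable_fun setT (merge : iseq R nat -> measurableTypeR R).
  exact: measurable_merge.
have [Q hQ] := pushforward_prob P mm.
move=> mB; rewrite hQ.2//; apply/esym.
(* Open rays are closed under intersection and generate, so the distribution function settles the
   law. *)
pose rays := [set A : set R | exists x : R, A = `]-oo, x[%classic].
have rays1 (x : R) : Q `]-oo, x[%classic = unif `]-oo, x[%classic.
  rewrite -hQ.2; last exact: measurable_itv.
  have [N [mN N0 GN]] := iid_unit_ae iP.
  have mS : measurable (merge @^-1` `]-oo, x[ : set (iseq R nat)).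
    exact: (measurable_preimage measurable_merge (measurable_itv _)).
  case: (ltP x 0) => x0.
    rewrite (_ : _ `&` _ = set0); last first.
      apply/seteqP; split=> // y []; rewrite /= !in_itv /= => h /andP[h2 _].
      by move: (le_lt_trans h2 h) => h3; move: (lt_trans h3 x0); rewrite ltxx.
    rewrite measure0; apply: (@subset_measure0 _ _ _ P _ N) => // v /=.
    rewrite in_itv /= => h; apply: GN => /= gv; have /andP[h1 _] := merge_itv01 gv.
    by move: (le_lt_trans h1 h) => h3; move: (lt_trans h3 x0); rewrite ltxx.
  case: (ltP x 1) => x1.
    rewrite merge_cdf ?x0// (_ : _ `&` _ = `[0%R, x[%classic); last first.
      apply/seteqP; split=> y /=; rewrite !in_itv /=.
        by move=> [-> /andP[->]].
      by move=> /andP[-> yx]; split=> //; rewrite ltW// (lt_trans yx).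
    rewrite lebesgue_measure_itv /= lte_fin sube0; case: ifP => // /negbT.
    by rewrite -leNgt => xle; congr (_%:E); apply/eqP; rewrite eq_le xle x0.
  have -> : unif `]-oo, x[ = 1%E.
    apply/eqP; rewrite eq_le; apply/andP; split.
      rewrite -(@unif01 R); apply: le_measure; rewrite ?inE; try exact: measurableI.
      by move=> y [].
    apply: (@le_trans _ _ (leb `[0%R, 1%R[)).
      by rewrite lebesgue_measure_itv /= lte_fin ltr01 sube0.
    apply: le_measure; rewrite ?inE; [exact: measurable_itv|exact: measurableI|].
    move=> y /=; rewrite !in_itv /= => /andP[y0 y1].
    by rewrite (lt_le_trans y1 x1) y0 ltW.
  rewrite -(probability_setT P).
  apply/eqP; rewrite eq_le le_measure ?inE//=.
  apply: (@le_trans _ _ (P ((merge @^-1` `]-oo, x[) `|` N))).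
    apply: le_measure; rewrite ?inE//; first exact: measurableU.
    move=> v _; case: (pselect (good v)) => gv; [left|right; exact: GN].
    by rewrite /= in_itv /=; have /andP[_ h] := merge_itv01 gv; exact: lt_le_trans h x1.
  apply: (le_trans (measureU2 _ mS mN)).
  by rewrite [X in (_ + X)%E]N0 adde0.
pose lam := mrestr (@lebesgue_measure R) m01.
change (lam B = Q B).
apply: (@measure_unique _ R (measurableTypeR R) rays (fun n => `]-oo, n%:R[%classic)
  (@RGenInftyO.measurableE R) _ _ _ lam Q).
- move=> _ _ [x ->] [y ->]; exists (Order.min x y).
  by apply/seteqP; split=> z; rewrite /= !in_itv /= lt_min => /andP.
- by move=> n; exists n%:R.
- apply/seteqP; split=> // z _; exists (Num.truncn z).+1 => //=.
  by rewrite in_itv /= truncnS_gt.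
- by move=> _ [x ->]; rewrite /lam /mrestr; apply/esym/rays1.
- move=> k; rewrite /lam /mrestr; apply: (@le_lt_trans _ _ (leb `[0%R, 1%R])).
    apply: le_measure; rewrite ?inE; [exact: measurableI|by []|by move=> z []].
  by rewrite lebesgue_measure_itv /= lte_fin ltr01 sube0 ltey.
- exact: mB.
Qed.

End MergeLaw.
End Pairing.

(* A measure isomorphism between [0,1] and [0,1]^nat, obtained by distributing
   the binary digits along a bijection of nat with nat * nat. *)
Lemma merge_split : exists (psi : (nat -> R) -> R) (phi : nat -> R -> R),
  [/\ measurable_fun setT (psi : iseq R nat -> R),
      forall k, measurable_fun setT (phi k),
      forall v : nat -> R, (forall k, 0 <= v k < 1) ->
        forall k, phi k (psi v) = v k &
      forall P : probability (iseq R nat) R, iid P ->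
        forall B, measurable B -> P (psi @^-1` B) = unif B].
Proof.
have /card_set_bijP[e'] := card_nat2.
rewrite setTT_bijective => -[e e'K eK].
exists (merge e), (split_digits e'); split.
- exact: measurable_merge.
- exact: measurable_split_digits.
- by move=> v gv k; exact: split_merge.
- by move=> P iP B mB; exact: merge_law.
Qed.

End Merge.

(** * Products of standard Borel spaces *)

Section StandardProduct.
Context {R : realType} {dX dY : measure_display}.
Variables (X : measurableType dX) (Y : measurableType dY).

Section Metrics.
Variables (d1 : X -> X -> R) (d2 : Y -> Y -> R).
Hypotheses (m1 : is_metric d1) (m2 : is_metric d2).
Definition sum_metric (z z' : X * Y) : R := d1 z.1 z'.1 + d2 z.2 z'.2.

Lemma sum_metricP : is_metric sum_metric.
Proof.
have [p1 z1 s1 t1] := m1; have [p2 z2 s2 t2] := m2; split.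
- by move=> x y; rewrite addr_ge0.
- move=> [x x'] [y y']; rewrite /sum_metric /=; split=> [/eqP|[-> ->]].
    by rewrite paddr_eq0// => /andP[/eqP/z1 -> /eqP/z2 ->].
  by rewrite (iffRL (z1 _ _) erefl) (iffRL (z2 _ _) erefl) addr0.
- by move=> x y; rewrite /sum_metric s1 s2.
- move=> x y z; rewrite /sum_metric.
  by have := t1 x.1 y.1 z.1; have := t2 x.2 y.2 z.2; lra.
Qed.

Lemma sum_metric_complete :
  metric_complete d1 -> metric_complete d2 -> metric_complete sum_metric.
Proof.
have [p1 _ _ _] := m1; have [p2 _ _ _] := m2.
move=> c1 c2 s cs.
have [|x hx] := c1 (fun n => (s n).1).
  move=> e e0; have [N hN] := cs e e0; exists N => m n mN nN.
  by apply: le_lt_trans (hN m n mN nN); rewrite lerDl.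
have [|y hy] := c2 (fun n => (s n).2).
  move=> e e0; have [N hN] := cs e e0; exists N => m n mN nN.
  by apply: le_lt_trans (hN m n mN nN); rewrite lerDr.
exists (x, y) => e e0; have e20 : 0 < e / 2 by rewrite divr_gt0.
have [N1 h1] := hx _ e20; have [N2 h2] := hy _ e20.
exists (maxn N1 N2) => n; rewrite geq_max => /andP[/h1 a1 /h2 a2].
by rewrite /sum_metric /= [e]splitr ltrD.
Qed.

Lemma sum_metric_separable :
  metric_separable d1 -> metric_separable d2 -> metric_separable sum_metric.
Proof.
move=> [D1 [c1 h1]] [D2 [c2 h2]]; exists (D1 `*` D2); split.
  exact: countableX.
move=> [x y] e e0; have e20 : 0 < e / 2 by rewrite divr_gt0.
have [x' Dx hx] := h1 x _ e20; have [y' Dy hy] := h2 y _ e20.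
by exists (x', y') => //; rewrite /sum_metric /= [e]splitr ltrD.
Qed.

(** Separability makes every open set of the sum metric a countable union of open rectangles;
    conversely both projections pull open sets back to open sets. *)
Lemma sum_metric_measurable : metric_separable d1 -> metric_separable d2 ->
  (measurable : set (set X)) = <<s metric_open d1 >> ->
  (measurable : set (set Y)) = <<s metric_open d2 >> ->
  (measurable : set (set (X * Y))) = <<s metric_open sum_metric >>.
Proof.
have [p1 z1 _ _] := m1; have [p2 z2 _ _] := m2.
move=> s1 s2 E1 E2; apply/seteqP; split; last first.
  apply: smallest_sub; first exact: sigma_algebra_measurable.
  move=> W oW; have [U [oU hU]] := metric_countable_base m1 s1.
  have [V [oV hV]] := metric_countable_base m2 s2.
  rewrite (_ : W = \bigcup_n (if unpickle n is Some (i, j) then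
      if pselect (U i `*` V j `<=` W) then U i `*` V j else set0 else set0)).
    apply: bigcupT_measurable => n; case: (unpickle n) => [[i j]|] //.
    case: (pselect _) => /= _; last exact: measurable0.
    by apply: measurableX; rewrite ?E1 ?E2; apply: sub_sigma_algebra.
  apply/seteqP; split=> [[x y] Wxy|z [n _]].
    have [e e0 eW] := oW _ Wxy; have e20 : 0 < e / 2 by rewrite divr_gt0.
    have [i [ix iU]] := hU [set x' | d1 x x' < e / 2] x (metric_ball_open m1) (ltac:(by rewrite /= (iffRL (z1 _ _) erefl))).
    have [j [jy jV]] := hV [set y' | d2 y y' < e / 2] y (metric_ball_open m2) (ltac:(by rewrite /= (iffRL (z2 _ _) erefl))).
    exists (pickle (i, j)) => //; rewrite pickleK; case: (pselect _) => //= -[].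
    move=> [a b] [/= /iU ha /jV hb]; apply: eW.
    by rewrite /sum_metric /= [e]splitr ltrD.
  by case: (unpickle n) => [[i j]|] //; case: (pselect _) => // h /h.
have sX : sigma_algebra setT [set A : set X | <<s metric_open sum_metric >> (fst @^-1` A)].
  split=> /=.
  - by rewrite preimage_set0; exact: sigma_algebra0.
  - by move=> A hA; rewrite setTD preimage_setC -setTD; exact: sigma_algebraCD.
  - by move=> F hF; rewrite preimage_bigcup; exact: sigma_algebra_bigcup.
have sY : sigma_algebra setT [set A : set Y | <<s metric_open sum_metric >> (snd @^-1` A)].
  split=> /=.
  - by rewrite preimage_set0; exact: sigma_algebra0.
  - by move=> A hA; rewrite setTD preimage_setC -setTD; exact: sigma_algebraCD.
  - by move=> F hF; rewrite preimage_bigcup; exact: sigma_algebra_bigcup.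
apply: smallest_sub; first exact: smallest_sigma_algebra.
move=> A [[B mB <-]|[B mB <-]]; rewrite setTI.
- have : <<s metric_open d1 >> B by rewrite -E1.
  suff : <<s metric_open d1 >> `<=` [set A : set X | <<s metric_open sum_metric >> (fst @^-1` A)].
    by apply.
  apply: smallest_sub => // C oC; apply: sub_sigma_algebra => z /= /oC[e e0 eC].
  by exists e => // z' hz; apply: eC; apply: le_lt_trans hz; rewrite lerDl.
- have : <<s metric_open d2 >> B by rewrite -E2.
  suff : <<s metric_open d2 >> `<=` [set A : set Y | <<s metric_open sum_metric >> (snd @^-1` A)].
    by apply.
  apply: smallest_sub => // C oC; apply: sub_sigma_algebra => z /= /oC[e e0 eC].
  by exists e => // z' hz; apply: eC; apply: le_lt_trans hz; rewrite lerDr.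
Qed.

End Metrics.

Lemma standard_borel_prod : standard_borel R X -> standard_borel R Y ->
  standard_borel R (X * Y)%type.
Proof.
move=> [d1 [m1 c1 s1 E1]] [d2 [m2 c2 s2 E2]]; exists (sum_metric d1 d2); split.
- exact: sum_metricP.
- exact: sum_metric_complete.
- exact: sum_metric_separable.
- exact: sum_metric_measurable.
Qed.

End StandardProduct.

(** * Bernoulli measures as product measures *)

Section BernoulliSpace.
Context {R : realType} (H : cgroup) {dY : measure_display}.
Variables (Y : measurableType dY) (nu : probability Y R).
Local Open Scope ereal_scope.

Lemma measurable_from_bern :
  measurable_fun setT (fun z : bern_space R H Y => (z : Y * iseq R H)).
Proof.
apply/measurable_fun_pairP; split; first exact: measurable_bern_fst.
by apply: measurable_to_iseq => i; exact: measurable_bern_coord.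
Qed.

Lemma measurable_into_bern :
  measurable_fun setT (fun z : Y * iseq R H => (z : bern_space R H Y)).
Proof.
apply: measurable_to_bern; first exact: measurable_fst.
by move=> g; exact: measurableT_comp (measurable_coord g) (@measurable_snd _ _ Y (iseq R H)).
Qed.

(** The Bernoulli space and [Y * iseq R H] have the same points, and the identity is measurable both
    ways, so null sets correspond. [P] is the law of the labels under [lam]. *)
Lemma bern_decomp (lam : {measure set bern_space R H Y -> \bar R}) :
  is_bernoulli_measure nu lam -> exists P : probability (iseq R H) R, iid P /\
  forall Q : Y * gfun H R -> Prop,
    {ae lam, forall z, Q z} <-> {ae pprod nu P, forall z, Q z}.
Proof.
move=> hlam.
have lamT : lam setT = 1.
  have := hlam setT [::] (fun=> setT) measurableT isT (fun=> measurableT).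
  rewrite big_nil [X in X * _](probability_setT nu) mule1 => <-; congr (lam _).
  by apply/seteqP; split.
(* [lam] is given only as a measure. The cylinder without constraints shows total mass one, so
   normalising changes nothing but the type. *)
pose lamP : probability (bern_space R H Y) R := mnormalize lam (dirac point).
have lamPE A : lamP A = lam A.
  by rewrite /lamP /= /mnormalize lamT onee_eq0 /= invr1 mule1.
have [M hM] := pushforward_prob lamP measurable_from_bern.
have msnd : measurable_fun setT (fun z : bern_space R H Y => z.2 : iseq R H).
  by apply: measurable_to_iseq => i; exact: measurable_bern_coord.
have [P hP] := pushforward_prob lamP msnd.
have iP : iid P.
  move=> s B us mB; have mb : measurable [set x : iseq R H | forall i, i \in s -> B i (x i)].
    exact: (@measurable_box R H H id s B).
  have := hlam setT s B measurableT us mB.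
  rewrite [X in X * _](probability_setT nu) mul1e => <-.
  rewrite -(hP.2 _ mb) lamPE.
  by congr (lam _); apply/seteqP; split=> z //= [].
have ME X : measurable X -> M X = pprod nu P X.
  apply: iid_prod_unique => // A s B mA us mB.
  rewrite -hM.2; first by rewrite lamPE; exact: hlam.
  by apply: cylinders_measurable; exists A, s, B.
exists P; split=> // Q.
have l1 : law_preserving lamP (pprod nu P) (fun z : bern_space R H Y => (z : Y * iseq R H)).
  by split; [exact: hM.1|move=> A mA; rewrite -ME// -hM.2].
have l2 : law_preserving (pprod nu P) lamP (fun z : Y * iseq R H => (z : bern_space R H Y)).
  split; first exact: measurable_into_bern.
  move=> A mA; have mA' := measurable_preimage measurable_into_bern mA.
  by rewrite -ME// -hM.2.
have aeE : {ae lam, forall z, Q z} <-> {ae lamP, forall z, Q z}.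
  by split=> -[N [mN N0 QN]]; exists N; split=> //; move: N0; rewrite lamPE.
split=> [/aeE|h]; first exact: (law_ae l2).
by apply/aeE; exact: (law_ae l1).
Qed.

End BernoulliSpace.

(** * Finite groups *)

Section FiniteGroup.
Context {R : realType} (H : cgroup).
Hypothesis finH : finite_set [set: H].

(** Drawing the label [j] from an independent copy keeps the law; with that label fixed, the label
    [i] hits its value with probability zero. *)
Lemma iid_no_tie (P : probability (iseq R H) R) (i j : H) : iid P -> i != j ->
  {ae P, forall x, x i <> x j}.
Proof.
move=> iP ij; pose r k := if k == j then Some j else None.
have ri k l m : r k = Some m -> r l = Some m -> k = l.
  by rewrite /r; case: eqP => // -> _; case: eqP => // ->.
have [N [mN NE]] : exists N : set (iseq R H), measurable N /\ N = [set x | x i <> x j].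
  exists [set x : iseq R H | x i <> x j]; split=> //.
  rewrite (_ : [set x | _] = ~` ((fun x : iseq R H => x i - x j) @^-1` [set 0])).
    apply: measurableC.
    have mf : measurable_fun setT (fun x : iseq R H => x i - x j).
      by apply: measurable_funB; exact: measurable_coord.
    exact: (measurable_preimage mf (measurable_set1 _)).
  by apply/seteqP; split=> x /= h e; apply: h; apply/eqP; move/eqP: e; rewrite subr_eq0.
have lr := reindex_law iP iP ri.
have mN' := measurable_preimage lr.1 mN.
have := @ae_of_sections R _ _ _ _ P P _ mN'.
move=> h; suff : {ae pprod P P, forall z, N (reindex r z.1 z.2)}.
  move=> [A [mA A0 NA]]; exists (~` N); split; first exact: measurableC.
    rewrite -lr.2; last exact: measurableC.
    apply: (@subset_measure0 _ _ _ (pprod P P) _ A) => //.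
    exact: (measurable_preimage lr.1 (measurableC mN)).
  by rewrite NE => x /= h'.
apply: h; apply: aeW => x.
exists [set y | forall k, k \in [:: i] -> [set x j] (y k)]; split.
- apply: (@measurable_box R H H id [:: i] (fun=> [set x j])) => k.
  exact: measurable_set1.
- apply: etrans (iP [:: i] (fun=> [set x j]) isT (fun _ => measurable_set1 _)) _.
  rewrite big_seq1; apply: (@subset_measure0 _ _ _ (@lebesgue_measure R) _ [set x j]).
  + by apply: measurableI; [exact: measurable_set1|exact: measurable_itv].
  + exact: measurable_set1.
  + by move=> z [].
  + exact: lebesgue_measure_set1.
- move=> y /=; rewrite NE /reindex /r /= eqxx (negbTE ij) => /contrapT e k.
  by rewrite inE => /eqP ->.
Qed.

(** The position of the smallest label moves equivariantly. Let [F] be [w] at the element carrying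
    this position to the unit: by the cocycle identity [F (h z) w h z = F z], so [F] conjugates [w]
    to the constant cocycle one. *)
Lemma finite_superrigid (C : PolishGroup R -> Prop) : bernoulli_superrigid C H.
Proof.
move=> dY Y nu b stdY [[b1 bM] mb bnu] lam hlam L CL w [mw cw].
have [P [iP aeE]] := bern_decomp hlam.
exists (fun _ _ => pg_one L); split.
  split; first by move=> h; exact: borel_measurable_cst.
  by move=> g h; apply: aeW => y; rewrite pg_mul1.
pose Min (z : Y * gfun H R) i := forall j, j != i -> z.2 i < z.2 j.
pose am z := xget (cg_one H) [set i | Min z i].
have MinU z i j : Min z i -> Min z j -> i = j.
  move=> hi hj; apply/eqP; apply: contrapT => /negP ij.
  by have := lt_trans (hi j _) (hj i ij); rewrite ltxx eq_sym => /(_ ij).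
have amE z i : Min z i -> am z = i.
  move=> hi; apply: (MinU _ _ _ _ hi); rewrite /am.
  by apply: (@xgetPex _ (cg_one H) [set i | Min z i]); exists i.
pose k z := cg_inv (am z).
have [s sE] : exists s : seq H, forall i, i \in s.
  have /finite_seqP[s hs] := finH; exists s => i.
  by have : [set: H] i by []; rewrite hs.
have mMin i : measurable [set z : bern_space R H Y | Min z i].
  rewrite (_ : [set z | _] = [set z : bern_space R H Y | forall j, j \in s ->
     (if j == i then setT else [set t : R | 0 < t]) (z.2 j - z.2 i)]).
    apply: (@measurable_cylinder R _ (bern_space R H Y) H (fun z j => z.2 j - z.2 i) s
       (fun j => if j == i then setT else [set t : R | 0 < t])).
      by move=> j; apply: measurable_funB; exact: measurable_bern_coord.
    move=> j; case: ifP => // _.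
    rewrite (_ : [set t | _] = `]0%R, +oo[%classic); first exact: measurable_itv.
    by apply/seteqP; split=> t /=; rewrite in_itv /= andbT.
  apply/seteqP; split=> z /= h j; first by move=> _; case: ifP => //= ji; rewrite subr_gt0 h ?ji.
  by move=> ji; have := h j (sE j); rewrite (negbTE ji) /= subr_gt0.
have mam i : measurable [set z : bern_space R H Y | am z = i].
  (* [am] takes its default value, the unit, also where no strict minimum exists; that set must be
     added to the fibre over the unit. *)
  pose none := ~` (\bigcup_n (if unpickle n is Some j then
      [set z : bern_space R H Y | Min z j] else set0)).
  have mnone : measurable none.
    apply: measurableC; apply: bigcupT_measurable => n.
    by case: (unpickle n) => [j|].
  rewrite (_ : [set z | _] = [set z : bern_space R H Y | Min z i] `|`
      (if i == cg_one H then none else set0)).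
    by apply: measurableU => //; case: ifP.
  apply/seteqP; split=> z /=.
    move=> <-; move: (erefl (am z)); rewrite {1}/am.
    case: xgetP => [j _ hj <-|hn <-]; first by left.
    right; rewrite /= eqxx => -[n _]; case: (unpickle n) => // j; exact: hn.
  move=> [/amE //|]; case: eqP => // -> hn; rewrite /am; case: xgetP => // j _ hj.
  by case: hn; exists (pickle j) => //; rewrite pickleK.
have mF : borel_measurable (fun z : bern_space R H Y => w (k z) z).
  apply: (@borel_measurable_count R L _ (bern_space R H Y) H k w) => // h.
  rewrite (_ : _ @^-1` _ = [set z | am z = cg_inv h])//.
  by apply/seteqP; split=> z; [rewrite /= /k => <-|rewrite /= /k => ->]; rewrite cg_invK.
exists (fun z => w (k z) z); split=> // h.
have aeM : {ae lam, forall z, exists i, Min z i}.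
  apply/aeE.
  have : {ae P, forall x, forall p : H * H, p.1 != p.2 -> x p.1 <> x p.2}.
    apply: ae_forall_count => -[i j] /=; case: (eqVneq i j) => [->|ij].
      exact: aeW.
    by apply: (@filterS _ _ (ae_filter_ringOfSetsType P) _ _ _ (iid_no_tie iP ij)) => x hx _.
  move=> /(law_ae (snd_law nu P)); apply: filterS => z hz.
  have [i hi] : exists i, forall j, j \in s -> z.2 i <= z.2 j.
    elim: {sE} s => [|a s [i hi]]; first by exists (cg_one H).
    case: (leP (z.2 i) (z.2 a)) => ia.
      by exists i => j; rewrite inE => /orP[/eqP ->|/hi].
    exists a => j; rewrite inE => /orP[/eqP ->//|/hi]; exact: le_trans (ltW ia).
  exists i => j ji; rewrite lt_neqAle hi// andbT.
  by apply/eqP; apply: (hz (i, j)); rewrite eq_sym.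
have hall : {ae lam, forall z, forall p : H * H,
    w (cg_mul p.1 p.2) z = pg_mul (w p.1 (bern_action b p.2 z)) (w p.2 z)}.
  by apply: ae_forall_count => -[g g'] /=; exact: cw.
apply: (@filterS2 _ _ (ae_filter_ringOfSetsType lam) _ _ _ _ aeM hall) => z [i hi] hz.
have hM : Min (bern_action b h z) (cg_mul h i).
  move=> j ji; rewrite /bern_action /= cgKM; apply: hi.
  by apply: contra ji => /eqP <-; rewrite cgKVM.
rewrite /k (amE _ _ hM) (amE _ _ hi) cg_invM.
have := hz (cg_mul (cg_inv i) (cg_inv h), h); rewrite /= cgMVK => <-.
by rewrite pgMV.
Qed.

End FiniteGroup.

(** * Induced actions on fundamental domains *)

Section Induced.
Context {R : realType} {dO : measure_display} (O : measurableType dO).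
Variables (m : {measure set O -> \bar R}) (G H : cgroup).
Variables (a : G -> O -> O) (b : H -> O -> O) (O0 : set O) (kap : O -> H).
Hypotheses (hma : mp_action m a) (hmb : mp_action m b)
  (comm : forall g h x, a g (b h x) = b h (a g x))
  (mO0 : measurable O0) (O0a : forall g x, O0 x -> O0 (a g x))
  (O0b : forall h x, O0 x -> O0 (b h x))
  (kapb : forall h x, O0 x -> kap (b h x) = cg_mul h (kap x))
  (mkap : forall h, measurable (kap @^-1` [set h])).

Definition fdom : set O := O0 `&` kap @^-1` [set cg_one H].
Definition return_elt (g : G) (x : O) : H := cg_inv (kap (a g x)).
(** The action of [G] on the quotient by [H], transported to the domain. The identity outside the
    domain makes it an action on all of [O]. *)
Definition induced (g : G) (x : O) : O :=
  if pselect (fdom x) then b (return_elt g x) (a g x) else x.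

Let a1 x : a (cg_one G) x = x. Proof. by have [[]] := hma. Qed.
Let aM g h x : a (cg_mul g h) x = a g (a h x). Proof. by have [[]] := hma. Qed.
Let b1 x : b (cg_one H) x = x. Proof. by have [[]] := hmb. Qed.
Let bM g h x : b (cg_mul g h) x = b g (b h x). Proof. by have [[]] := hmb. Qed.
Let ma g : measurable_fun setT (a g). Proof. by have [] := hma. Qed.
Let mb h : measurable_fun setT (b h). Proof. by have [] := hmb. Qed.

Lemma measurable_fdom : measurable fdom.
Proof. exact: measurableI. Qed.

Lemma inducedE g x : fdom x -> induced g x = b (return_elt g x) (a g x).
Proof. by rewrite /induced; case: pselect. Qed.

Lemma inducedN g x : ~ fdom x -> induced g x = x.
Proof. by rewrite /induced; case: pselect. Qed.

Lemma induced_fdom g x : fdom x -> fdom (induced g x).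
Proof.
move=> Ex; rewrite inducedE//; have [Ox _] := Ex; split; first by apply/O0b/O0a.
by rewrite /= kapb ?cg_mulV//; exact: O0a.
Qed.

Lemma return_eltM g h x : fdom x ->
  return_elt (cg_mul g h) x = cg_mul (return_elt g (induced h x)) (return_elt h x).
Proof.
move=> Ex; have [Ox kx] := Ex; rewrite /return_elt inducedE// aM comm.
rewrite kapb; last by apply/O0a/O0a.
by rewrite cg_invM cgMVK.
Qed.

Lemma induced_action : is_action induced.
Proof.
split=> [x|g h x].
  rewrite /induced; case: pselect => // -[Ox kx].
  by rewrite /return_elt a1 kx cg_inv1 b1.
case: (pselect (fdom x)) => Ex; last first.
  by rewrite !inducedN.
rewrite (inducedE (cg_mul g h))// (inducedE g); last exact: induced_fdom.
by rewrite return_eltM// bM inducedE// comm aM.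
Qed.

Lemma measurable_return g h : measurable (return_elt g @^-1` [set h]).
Proof.
rewrite (_ : _ @^-1` _ = a g @^-1` (kap @^-1` [set cg_inv h])).
  exact: measurable_preimage.
apply/seteqP; split=> x; first by rewrite /= /return_elt => <-; rewrite cg_invK.
by rewrite /= /return_elt => ->; rewrite cg_invK.
Qed.

Lemma measurable_induced g : measurable_fun setT (induced g).
Proof.
pose k x : option H := if pselect (fdom x) then Some (return_elt g x) else None.
pose f (t : option H) x := if t is Some h then b h (a g x) else x.
rewrite (_ : induced g = fun x => f (k x) x); last first.
  by apply/funext => x; rewrite /induced /k; case: (pselect (fdom x)).
apply: measurable_fun_count; last first.
  case=> [h|]; last exact: measurable_id.
  exact: measurableT_comp (mb h) (ma g).
have mE := measurable_fdom.
case=> [h|].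
  rewrite (_ : _ @^-1` _ = fdom `&` return_elt g @^-1` [set h]).
    by apply: measurableI => //; exact: measurable_return.
  apply/seteqP; split=> x; rewrite /= /k; case: (pselect (fdom x)) => //= Ex.
  - by case=> ->.
  - by move=> [_ ->].
  - by case.
rewrite (_ : _ @^-1` _ = ~` fdom); first exact: measurableC.
by apply/seteqP; split=> x; rewrite /= /k; case: (pselect (fdom x)).
Qed.

Lemma measure_partition (k : O -> nat) (A : set O) :
  (forall n, measurable (k @^-1` [set n])) -> measurable A ->
  m A = (\sum_(n <oo) m (A `&` k @^-1` [set n]))%E.
Proof.
move=> mk mA; rewrite [RHS](_ : _ = (\sum_(n <oo | n \in setT) m (A `&` k @^-1` [set n]))%E).
  rewrite -measure_bigcup//.
  - congr (m _); apply/seteqP; split=> x; first by move=> Ax; exists (k x).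
    by move=> [n _ []].
  - by move=> n _; exact: measurableI.
  - by move=> i j _ _ [x [[_ <-] [_ <-]]].
by apply: eq_eseriesl => n; rewrite in_setT.
Qed.

(** Where the return element is [h], the induced map is [b h] after [a g], which preserves [m].
    Summation over [h] also needs the images of these pieces to partition the domain. *)
Lemma induced_mp g A : measurable A ->
  m (induced g @^-1` A `&` fdom) = m (A `&` fdom).
Proof.
move=> mA; have mE := measurable_fdom.
have mpre h g' B : measurable B -> m ((fun x => b h (a g' x)) @^-1` B) = m B.
  move=> mB; have [_ _ ha] := hma; have [_ _ hb] := hmb.
  by rewrite -(hb h B mB) -(ha g' _ (measurable_preimage (mb h) mB)).
pose k x := pickle (return_elt g x).
(* The return element of [g^-1] at an image point is the inverse of the [h] by which it was reached;
   this cuts the target into the images of the pieces of [k]. *)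
pose k' x := pickle (cg_inv (return_elt (cg_inv g) x)).
have mpick (f : O -> H) : (forall h, measurable (f @^-1` [set h])) ->
    forall n, measurable ((pickle \o f) @^-1` [set n]).
  move=> mf n; rewrite (_ : _ @^-1` _ =
     if (pickle_inv n : option H) is Some h then f @^-1` [set h] else set0).
    by case: (pickle_inv _).
  apply/seteqP; split=> x /=; first by move=> <-; rewrite pickleK_inv.
  case E : (pickle_inv n : option H) => [h|] //= ->.
  by have := @pickle_invK H n; rewrite E.
have mk n : measurable (k @^-1` [set n]) by apply: mpick => h; exact: measurable_return.
have mk' n : measurable (k' @^-1` [set n]).
  apply: (mpick (fun x => cg_inv (return_elt (cg_inv g) x))) => h.
  rewrite (_ : _ @^-1` _ = return_elt (cg_inv g) @^-1` [set cg_inv h]).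
    exact: measurable_return.
  by apply/seteqP; split=> x /=; [move=> <-; rewrite cg_invK|move=> ->; rewrite cg_invK].
have mI := measurable_preimage (measurable_induced g) mA.
rewrite (measure_partition mk (measurableI _ _ mI mE)).
rewrite (measure_partition mk' (measurableI _ _ mA mE)).
apply: eq_eseriesr => n _.
case E : (pickle_inv n : option H) => [h|]; last first.
  have nk (f : O -> H) (x : O) : pickle (f x) = n -> False.
    by move=> e; move: E; rewrite -e pickleK_inv.
  rewrite (_ : _ `&` _ = set0) ?[in RHS](_ : _ `&` _ = set0)//.
    by apply/seteqP; split=> // x [_]; exact: (nk (fun x => cg_inv (return_elt (cg_inv g) x))).
  apply/seteqP; split=> // x [_]; exact: (nk (return_elt g)).
have nE : n = pickle h by have := @pickle_invK H n; rewrite E.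
have pk (f : O -> H) x : pickle (f x) = n <-> f x = h.
  by rewrite nE; split=> [/(pcan_inj pickleK)|->].
rewrite -[RHS](mpre h g); last by apply: measurableI => //; exact: measurableI.
have TO x : O0 (b h (a g x)) -> O0 x.
  by move=> /(O0b (cg_inv h))/(O0a (cg_inv g)); rewrite -bM cg_mulV b1 -aM cg_mulV a1.
have back x : O0 x -> cg_inv (return_elt (cg_inv g) (b h (a g x))) = cg_mul h (kap x).
  by move=> Ox; rewrite /return_elt cg_invK comm -aM cg_mulV a1 kapb.
have invE (y z : H) : cg_inv y = z -> y = cg_inv z by move=> <-; rewrite cg_invK.
congr (m _); apply/seteqP; split=> x /=.
  move=> [[Ax Ex] /pk rx]; have [Ox kx] := Ex.
  have := induced_fdom g Ex; rewrite inducedE// rx => Tx.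
  move: Ax; rewrite inducedE// rx => Ax; split; first by split.
  by apply/(pk (fun x => cg_inv (return_elt (cg_inv g) x))); rewrite back// kx cgM1.
move=> [[Ax [/TO Ox]] /= kT].
move=> /(pk (fun x => cg_inv (return_elt (cg_inv g) x))); rewrite back// => kx.
have Ex : fdom x.
  by split=> //=; apply: (@cg_mulI _ h); rewrite kx cgM1.
have rx : return_elt g x = h.
  move: kT; rewrite kapb; last exact: O0a.
  move=> e; rewrite /return_elt; apply: (@cg_Imul _ (kap (a g x))).
  by rewrite cg_mulV e.
split; last by apply/pk.
by split=> //; rewrite inducedE// rx.
Qed.

End Induced.

(** * The probability carried by a set of positive finite measure *)

Section NormalizedRestriction.
Context {R : realType} {dO : measure_display} (O : measurableType dO).
Variables (m : {measure set O -> \bar R}) (E : set O).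
Hypotheses (mE : measurable E) (E0 : m E <> 0%E) (Eoo : (m E < +oo)%E).

Definition normalized_restr : probability O R :=
  mnormalize (mrestr m mE) (dirac point).

Lemma normalized_restrE A :
  normalized_restr A = (m (A `&` E) * ((fine (m E))^-1)%:E)%E.
Proof.
have mT X : (mrestr m mE : {measure set O -> \bar R}) X = m (X `&` E) by [].
rewrite /normalized_restr /= /mnormalize !mT setTI.
have /negbTE -> : m E != 0%E by apply/eqP.
by have /negbTE -> : m E != +oo%E by rewrite lt_eqF.
Qed.

Lemma normalized_restr0 A : measurable A ->
  normalized_restr A = 0%E <-> m (A `&` E) = 0%E.
Proof.
move=> mA; rewrite normalized_restrE; split=> [/eqP|->]; last by rewrite mul0e.
rewrite mule_eq0 => /orP[/eqP //|]; rewrite eqe invr_eq0 fine_eq0 ?ge0_fin_numE//.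
by move=> /eqP.
Qed.

Lemma normalized_restr_ae : {ae normalized_restr, forall x, E x}.
Proof.
exists (~` E); split; [exact: measurableC| |by []].
by apply/normalized_restr0; [exact: measurableC|rewrite setICl measure0].
Qed.

End NormalizedRestriction.

(** * From fundamental domains to equivariant maps into the groups *)

Section EquivariantMap.
Context {dO : measure_display} (O : measurableType dO).
Variables (G : cgroup) (a : G -> O -> O) (D O0 : set O).
Hypotheses (aA : is_action a) (ma : forall g, measurable_fun setT (a g))
  (mD : measurable D) (mO0 : measurable O0)
  (O0a : forall g x, O0 x -> O0 (a g x))
  (O0D : forall x, O0 x -> exists! g, D (a g x)).

(** [gam x] is the inverse of the unique element carrying [x] into [D]; the inverse makes it
    equivariant on the left. The default value off [O0] only keeps it total and measurable. *)
Lemma equivariant_map : exists gam : O -> G,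
  [/\ forall g x, O0 x -> gam (a g x) = cg_mul g (gam x),
      forall g, measurable (gam @^-1` [set g]) & fdom O0 gam `<=` D].
Proof.
have [a1 aM] := aA.
pose pk x := xget (cg_one G) [set g | D (a g x)].
pose gam x := if pselect (O0 x) then cg_inv (pk x) else cg_one G.
have pkD x : O0 x -> D (a (pk x) x).
  by move=> /O0D[g [Dg _]]; apply: (@xgetPex _ (cg_one G) [set g | D (a g x)]); exists g.
have pkU x g : O0 x -> D (a g x) -> g = pk x.
  move=> Ox Dg; have [g0 [_ U]] := O0D Ox.
  by rewrite -(U _ Dg) -(U _ (pkD _ Ox)).
have gamE x : O0 x -> gam x = cg_inv (pk x) by rewrite /gam; case: pselect.
exists gam; split.
- move=> g x Ox; rewrite !gamE//; last exact: O0a.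
  rewrite -(@pkU (a g x) (cg_mul (pk x) (cg_inv g))).
  + by rewrite cg_invM cg_invK.
  + exact: O0a.
  + by rewrite -aM cgMVK; exact: pkD.
- move=> g; rewrite (_ : _ @^-1` _ = (O0 `&` a (cg_inv g) @^-1` D) `|`
     (if g == cg_one G then ~` O0 else set0)).
    apply: measurableU.
      by apply: measurableI => //; exact: measurable_preimage.
    by case: ifP => // _; exact: measurableC.
  apply/seteqP; split=> x /=.
    case: (pselect (O0 x)) => Ox.
      by rewrite gamE// => <-; left; split=> //; rewrite cg_invK; exact: pkD.
    by rewrite /gam; case: pselect => // _ /= <-; right; rewrite eqxx.
  move=> [[Ox /(pkU _ _ Ox) e]|]; first by rewrite gamE// -e cg_invK.
  by case: eqP => // -> nOx; rewrite /gam; case: pselect.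
- move=> x [Ox]; rewrite /= gamE// => e.
  by have := pkD _ Ox; rewrite -(cg_invK (pk x)) e cg_inv1 a1.
Qed.

Lemma measurable_exists_unique : measurable [set x | exists! g, D (a g x)].
Proof.
pose N g x := forall g', g' = g \/ ~ D (a g' x).
have mDa g : measurable (a g @^-1` D) by exact: measurable_preimage.
have mN g : measurable [set x | N g x].
  rewrite (_ : [set x | _] = \bigcap_n (if unpickle n is Some g' then
     (if g' == g then setT else ~` (a g' @^-1` D)) else setT)).
    apply: bigcapT_measurable => n; case: (unpickle n) => // g'.
    by case: ifP => // _; exact: measurableC.
  apply/seteqP; split=> x /=.
    move=> Nx n _; case: (unpickle n) => // g'; case: eqP => // ne.
    by case: (Nx g').
  move=> h g'; have := h (pickle g') I; rewrite pickleK; case: eqP => [->|_]; first by left.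
  by right.
rewrite (_ : [set x | _] = \bigcup_n (if unpickle n is Some g then
   a g @^-1` D `&` [set x | N g x] else set0)).
  by apply: bigcupT_measurable => n; case: (unpickle n) => // g; exact: measurableI.
apply/seteqP; split=> x /=.
  move=> [g [Dg U]]; exists (pickle g) => //; rewrite pickleK; split=> // g'.
  by case: (pselect (D (a g' x))) => [/U|]; [left|right].
move=> [n _]; case: (unpickle n) => // g [Dg Ng]; exists g; split=> // g' Dg'.
by case: (Ng g').
Qed.

End EquivariantMap.

Section CouplingMaps.
Context {R : realType} {dO : measure_display} (O : measurableType dO).
Variables (m : {measure set O -> \bar R}) (G H : cgroup).
Variables (a : G -> O -> O) (b : H -> O -> O).
Hypotheses (hma : mp_action m a) (hmb : mp_action m b)
  (comm : forall g h x, a g (b h x) = b h (a g x)).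

Lemma mp_ae (K : cgroup) (c : K -> O -> O) (k : K) (P : O -> Prop) :
  mp_action m c -> {ae m, forall x, P x} -> {ae m, forall x, P (c k x)}.
Proof.
move=> [_ mc hc] [N [mN N0 PN]]; exists (c k @^-1` N); split.
- exact: measurable_preimage.
- by rewrite hc.
- by move=> x /= h; exact: PN.
Qed.

(** Every point of [O0] is carried into the slice by some element of the countable group [H], so a
    null slice would make the whole space null. *)
Lemma fdom_neq0 (O0 : set O) (kap : O -> H) : m setT <> 0%E ->
  measurable O0 -> {ae m, forall x, O0 x} ->
  (forall h x, O0 x -> O0 (b h x)) ->
  (forall h x, O0 x -> kap (b h x) = cg_mul h (kap x)) ->
  (forall h, measurable (kap @^-1` [set h])) -> m (fdom O0 kap) <> 0%E.
Proof.
move=> mT mO0 aeO O0b kapb mkap E0; apply: mT.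
have mE : measurable (fdom O0 kap) by exact: measurableI.
have aeE : {ae m, forall x, ~ fdom O0 kap x}.
  by exists (fdom O0 kap); split=> // x /= /contrapT.
have h1 : {ae m, forall x, forall h, ~ fdom O0 kap (b h x)}.
  by apply: ae_forall_count => h; exact: mp_ae hmb aeE.
have : m.-negligible setT; last exact: measure_negligible.
have : {ae m, forall x, False}.
  apply: (@filterS2 _ _ (ae_filter_ringOfSetsType m) _ _ _ _ h1 aeO) => x hx Ox.
  apply: (hx (cg_inv (kap x))); split; first exact: O0b.
  by rewrite /= kapb// cg_mulV.
by apply: negligibleS => x _.
Qed.

(** Unique return is known only almost everywhere. Keeping the points all of whose translates under
    [G] and [H] have it leaves a conull set exactly invariant under both actions. *)
Lemma coupling_maps :
  finite_fundamental_domain m a -> finite_fundamental_domain m b ->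
  exists (O0 : set O) (gam : O -> G) (kap : O -> H),
  [/\ measurable O0 /\ {ae m, forall x, O0 x},
      (forall g x, O0 x -> O0 (a g x)) /\ (forall h x, O0 x -> O0 (b h x)),
      (forall g x, O0 x -> gam (a g x) = cg_mul g (gam x)) /\
        (forall h x, O0 x -> kap (b h x) = cg_mul h (kap x)),
      (forall g, measurable (gam @^-1` [set g])) /\
        (forall h, measurable (kap @^-1` [set h])) &
      (m (fdom O0 gam) < +oo)%E /\ (m (fdom O0 kap) < +oo)%E].
Proof.
move=> [D [mD Doo aeD]] [E [mE Eoo aeE]].
have [aA ma _] := hma; have [bA mb _] := hmb.
have [a1 aM] := aA; have [b1 bM] := bA.
pose U x := (exists! g, D (a g x)) /\ (exists! h, E (b h x)).
have mU : measurable [set x | U x].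
  by apply: measurableI; exact: measurable_exists_unique.
pose O0 := [set x | forall p : G * H, U (a p.1 (b p.2 x))].
have mO0 : measurable O0.
  rewrite (_ : O0 = \bigcap_n (if (unpickle n : option (G * H)) is Some p then
     (fun x => a p.1 (b p.2 x)) @^-1` [set x | U x] else setT)).
    apply: bigcapT_measurable => n; case: (unpickle n) => // p.
    by apply: measurable_preimage => //; exact: measurableT_comp.
  apply/seteqP; split=> x /=.
    by move=> h n _; case: (unpickle n) => // p; exact: h.
  by move=> h p; have := h (pickle p) I; rewrite pickleK.
have aeO : {ae m, forall x, O0 x}.
  apply: ae_forall_count => p.
  have aeU : {ae m, forall x, U x}.
    by apply: (@filterS2 _ _ (ae_filter_ringOfSetsType m) _ _ _ _ aeD aeE).
  exact: mp_ae hmb (mp_ae p.1 hma aeU).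
have O0a g x : O0 x -> O0 (a g x).
  by move=> Ox p; rewrite -comm -aM; exact: (Ox (cg_mul p.1 g, p.2)).
have O0b h x : O0 x -> O0 (b h x).
  by move=> Ox p; rewrite -bM; exact: (Ox (p.1, cg_mul p.2 h)).
have O0U x : O0 x -> U x.
  by move=> /(_ (cg_one G, cg_one H)); rewrite /= a1 b1.
have [gam [ga gm gD]] := equivariant_map aA ma mD mO0 O0a (fun x Ox => (O0U x Ox).1).
have [kap [kb km kE]] := equivariant_map bA mb mE mO0 O0b (fun x Ox => (O0U x Ox).2).
exists O0, gam, kap; split=> //; split.
- apply: le_lt_trans Doo; apply: le_measure; rewrite ?inE//.
  by apply: measurableI => //; exact: gm.
- apply: le_lt_trans Eoo; apply: le_measure; rewrite ?inE//.
  by apply: measurableI => //; exact: km.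
Qed.

End CouplingMaps.

Lemma measure_equivalent_sym (R : realType) (G H : cgroup) :
  measure_equivalent R G H -> measure_equivalent R H G.
Proof.
move=> [dO [S [m [a [b [h1 [h2 h3] h4 [h5 h6] [h7 h8]]]]]]].
by exists dO, S, m, b, a; split.
Qed.

(** * Relabelling along the coupling *)

Section Labels.
Context {R : realType} {dO : measure_display} (O : measurableType dO).
Variables (G H : cgroup) (a : G -> O -> O) (b : H -> O -> O).
Variables (O0 : set O) (gam : O -> G) (kap : O -> H).
Hypotheses (aA : is_action a) (bA : is_action b)
  (ma : forall g, measurable_fun setT (a g)) (mb : forall h, measurable_fun setT (b h))
  (comm : forall g h x, a g (b h x) = b h (a g x))
  (O0a : forall g x, O0 x -> O0 (a g x)) (O0b : forall h x, O0 x -> O0 (b h x))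
  (gama : forall g x, O0 x -> gam (a g x) = cg_mul g (gam x))
  (kapb : forall h x, O0 x -> kap (b h x) = cg_mul h (kap x))
  (mgam : forall g, measurable (gam @^-1` [set g]))
  (mkap : forall h, measurable (kap @^-1` [set h])).

Local Notation I := (G * nat)%type.

Definition translate (g : G) (x : iseq R I) : iseq R I :=
  fun i => x (cg_mul (cg_inv g) i.1, i.2).

(* The points b h^-1 o of the H-orbit of o are sorted according to the
   G-translate of the fundamental domain they lie in; points lying in the same
   translate are told apart by their H-return element. *)
Definition lab (o : O) (h : H) : I :=
  let g := gam (b (cg_inv h) o) in
  (g, pickle (cg_mul (cg_inv h) (kap (a (cg_inv g) o)))).

Definition lab_inv (o : O) (i : I) : option H :=
  if pselect (exists h, lab o h = i) is left e then Some (projT1 (cid e)) else None.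

Definition relabel (o : O) (x : iseq R I) : iseq R H := fun h => x (lab o h).

Definition resample (o : O) (c : iseq R H) (x : iseq R I) : iseq R I :=
  reindex (lab_inv o) c x.

Let a1 x : a (cg_one G) x = x. Proof. by have [] := aA. Qed.
Let aM g h x : a (cg_mul g h) x = a g (a h x). Proof. by have [] := aA. Qed.
Let b1 x : b (cg_one H) x = x. Proof. by have [] := bA. Qed.
Let bM g h x : b (cg_mul g h) x = b g (b h x). Proof. by have [] := bA. Qed.

(** [a g] translates the [G]-component; the second component is read after returning along [G], so
    it does not see [g]. *)
Lemma lab_a g o h : O0 o -> lab (a g o) h = (cg_mul g (lab o h).1, (lab o h).2).
Proof.
move=> Oo; rewrite /lab /= -comm gama; last exact: O0b.
congr (_, pickle (cg_mul _ (kap _))).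
by rewrite cg_invM -aM cgMVK.
Qed.

Lemma lab_b h0 o h : O0 o -> lab (b h0 o) h = lab o (cg_mul (cg_inv h0) h).
Proof.
move=> Oo; rewrite /lab /= cg_invM cg_invK bM.
congr (_, pickle _).
by rewrite comm kapb ?cg_mulA//; exact: O0a.
Qed.

(** Once the [G]-components agree, the second components contain the same value of [kap], which
    cancels. *)
Lemma lab_inj o : injective (lab o).
Proof.
move=> h k; rewrite /lab => -[e /(pcan_inj pickleK)]; rewrite e => /cg_Imul h'.
by rewrite -(cg_invK h) h' cg_invK.
Qed.

Lemma lab_inv_Some o i h : lab_inv o i = Some h <-> lab o h = i.
Proof.
rewrite /lab_inv; case: (pselect _) => [e|ne]; last first.
  by split=> // e; case: ne; exists h.
case: (cid e) => k /= ek; split=> [[<-] //|eh]; congr Some.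
by apply: (@lab_inj o); rewrite ek eh.
Qed.

Lemma lab_inv_eq o o' i j (f : H -> H) (f' : H -> H) : cancel f f' -> cancel f' f ->
  (forall h, lab o' (f h) = j <-> lab o h = i) -> lab_inv o' j = omap f (lab_inv o i).
Proof.
move=> ff f'f hl; case E : (lab_inv o i) => [h|] /=.
  by apply/lab_inv_Some/hl/lab_inv_Some.
case E' : (lab_inv o' j) => [h|//].
move/lab_inv_Some : E'; rewrite -(f'f h) => /hl /lab_inv_Some.
by rewrite E.
Qed.

Lemma relabel_a g o x : O0 o -> relabel (a g o) (translate g x) = relabel o x.
Proof.
move=> Oo; apply/funext => h; rewrite /relabel /translate lab_a//.
by case: (lab o h) => u v /=; rewrite cgKM.
Qed.

Lemma relabel_b h o x : O0 o -> relabel (b h o) x = shift h (relabel o x).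
Proof. by move=> Oo; apply/funext => k; rewrite /relabel /shift lab_b. Qed.

Lemma relabel_resample o c x : relabel o (resample o c x) = c.
Proof.
apply/funext => h; rewrite /relabel /resample /reindex.
by rewrite (iffRL (lab_inv_Some o (lab o h) h) erefl).
Qed.

Lemma resample_a g o c x : O0 o ->
  resample (a g o) c (translate g x) = translate g (resample o c x).
Proof.
move=> Oo; apply/funext => -[g' n]; rewrite /resample /reindex /translate /=.
rewrite (@lab_inv_eq o (a g o) (cg_mul (cg_inv g) g', n) (g', n) id id) //.
  by case: (lab_inv _ _).
move=> h; rewrite lab_a//; case: (lab o h) => u v /=.
by split; [move=> -[<- <-]; rewrite cgKM|move=> -[-> ->]; rewrite cgKVM].
Qed.

(** Moving the base point renumbers its orbit by [h0] and shifting renumbers the inserted labels by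
    [h0], so each label is written at the same place. *)
Lemma resample_b h0 o c x : O0 o ->
  resample (b h0 o) (shift h0 c) x = resample o c x.
Proof.
move=> Oo; apply/funext => i; rewrite /resample /reindex.
rewrite (@lab_inv_eq o (b h0 o) i i (cg_mul h0) (cg_mul (cg_inv h0))).
- by case: (lab_inv o i) => [h|] //=; rewrite /shift cgKM.
- exact: cgKM.
- exact: cgKVM.
- by move=> h; rewrite lab_b// cgKM.
Qed.

Lemma measurable_lab h i : measurable [set o | lab o h = i].
Proof.
case: i => g n.
rewrite (_ : [set o | _] = b (cg_inv h) @^-1` (gam @^-1` [set g]) `&`
  a (cg_inv g) @^-1` (\bigcup_k (if (unpickle k : option H) is Some k then
     if pickle (cg_mul (cg_inv h) k) == n then kap @^-1` [set k] else set0 else set0))).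
  apply: measurableI; first exact: measurable_preimage.
  apply: measurable_preimage => //; apply: bigcupT_measurable => k.
  by case: (unpickle k) => // k'; case: ifP.
apply/seteqP; split=> o; rewrite /lab /=.
  move=> [-> <-]; split=> //; exists (pickle (kap (a (cg_inv g) o))) => //.
  by rewrite pickleK eqxx.
move=> [-> [k _]]; case: (unpickle k) => // k'; case: eqP => // <- <-.
by [].
Qed.

Lemma measurable_lab_inv i (t : option H) : measurable [set o | lab_inv o i = t].
Proof.
case: t => [h|].
  rewrite (_ : [set o | _] = [set o | lab o h = i]); first exact: measurable_lab.
  by apply/seteqP; split=> o /lab_inv_Some.
rewrite (_ : [set o | _] = ~` (\bigcup_k (if (unpickle k : option H) is Some h then
   [set o | lab o h = i] else set0))).
  apply: measurableC; apply: bigcupT_measurable => k.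
  by case: (unpickle k) => // h; exact: measurable_lab.
apply/seteqP; split=> o /=.
  move=> e [k _]; case: (unpickle k) => // h /= /lab_inv_Some; by rewrite e.
move=> nh; case E : (lab_inv o i) => [h|//]; case: nh.
by exists (pickle h) => //; rewrite pickleK; apply/lab_inv_Some.
Qed.

Lemma measurable_relabel :
  measurable_fun setT (fun z : O * iseq R I => relabel z.1 z.2).
Proof.
apply: measurable_to_iseq => h.
apply: (@measurable_fun_count _ _ (O * iseq R I)%type _ I (fun z => lab z.1 h) (fun i z => z.2 i)).
  by move=> i; exact: (measurable_preimage (@measurable_fst _ _ O (iseq R I)) (measurable_lab h i)).
by move=> i; exact: measurableT_comp (measurable_coord i) (@measurable_snd _ _ O (iseq R I)).
Qed.

Lemma measurable_resample : measurable_fun setT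
  (fun z : O * (iseq R H * iseq R I) => resample z.1 z.2.1 z.2.2).
Proof.
apply: measurable_to_iseq => i.
apply: (@measurable_fun_count _ _ (O * (iseq R H * iseq R I))%type _ (option H)
  (fun z => lab_inv z.1 i) (fun t z => if t is Some h then z.2.1 h else z.2.2 i)).
  move=> t; exact: (measurable_preimage (@measurable_fst _ _ O (iseq R H * iseq R I)%type)
    (measurable_lab_inv i t)).
case=> [h|].
  exact: measurableT_comp (measurable_coord h)
    (measurableT_comp (@measurable_fst _ _ (iseq R H) (iseq R I))
      (@measurable_snd _ _ O (iseq R H * iseq R I)%type)).
exact: measurableT_comp (measurable_coord i)
  (measurableT_comp (@measurable_snd _ _ (iseq R H) (iseq R I))
    (@measurable_snd _ _ O (iseq R H * iseq R I)%type)).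
Qed.

Lemma resample_law o (P : probability (iseq R H) R) (Q : probability (iseq R I) R) :
  iid P -> iid Q -> law_preserving (pprod P Q) Q (fun z => resample o z.1 z.2).
Proof.
move=> iP iQ; apply: reindex_law => // i j h /lab_inv_Some <- /lab_inv_Some <-.
by [].
Qed.

Lemma relabel_law o (P : probability (iseq R H) R) (Q : probability (iseq R I) R) :
  iid P -> iid Q -> law_preserving Q P (relabel o).
Proof. by move=> iP iQ; apply: inj_law => //; exact: lab_inj. Qed.

Lemma translate_law g (Q : probability (iseq R I) R) :
  iid Q -> law_preserving Q Q (translate g).
Proof.
move=> iQ; apply: (inj_law (f := fun i : I => (cg_mul (cg_inv g) i.1, i.2))) => //.
by move=> [g1 n1] [g2 n2] [/cg_mulI -> ->].
Qed.

Lemma measurable_translate_count dX (X : measurableType dX) (k : X -> G) :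
  (forall g, measurable (k @^-1` [set g])) ->
  measurable_fun setT (fun z : X * iseq R I => translate (k z.1) z.2).
Proof.
move=> mk; apply: (@measurable_fun_count _ _ (X * iseq R I)%type (iseq R I) G
  (fun z => k z.1) (fun g z => translate g z.2)).
  by move=> g; exact: (measurable_preimage (@measurable_fst _ _ X (iseq R I)) (mk g)).
move=> g; apply: measurable_to_iseq => i.
exact: measurableT_comp (measurable_coord _) (@measurable_snd _ _ X (iseq R I)).
Qed.

End Labels.

(** * Label sequences over other index sets *)

Section MoreLaw.
Context {R : realType}.

Lemma assoc_inv_law dX dY dZ (X : measurableType dX) (Y : measurableType dY)
    (Z : measurableType dZ) (P : probability X R) (Q : probability Y R)
    (S : probability Z R) :
  law_preserving (pprod P (pprod Q S)) (pprod (pprod P Q) S)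
    (fun z => ((z.1, z.2.1), z.2.2)).
Proof.
have m2 := @measurable_snd _ _ X (Y * Z)%type.
have mf : measurable_fun setT (fun z : X * (Y * Z) => ((z.1, z.2.1), z.2.2)).
  apply: measurable_fun_pair.
    apply: measurable_fun_pair; first exact: measurable_fst.
    exact: measurableT_comp (@measurable_fst _ _ Y Z) m2.
  exact: measurableT_comp (@measurable_snd _ _ Y Z) m2.
split=> // A mA; rewrite -(assoc_law P Q S).2; last exact: measurable_preimage.
by congr (pprod _ _ _); apply/seteqP; split=> -[[]].
Qed.

(** A countable set injects into an infinite one, and i.i.d. labels restrict along injections; this
    supplies the labels for [G * nat]. *)
Lemma iid_of_infinite (H : cgroup) (P : probability (iseq R H) R) (J : countType) :
  infinite_set [set: H] -> iid P -> exists Q : probability (iseq R J) R, iid Q.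
Proof.
move=> /infiniteP infH iP; have /card_leP[f] := infH.
have sT (n : nat) : n \in [set: nat] by rewrite inE.
apply: (iid_inj (f := fun j : J => \val (f (SigSub (sT (pickle j))))) iP) => i j.
move=> /val_inj /(@inj _ _ _ f); rewrite !inE => /(_ I I) [].
exact: (pcan_inj pickleK).
Qed.

Section Block.
Variables (G : countType) (PX : probability (iseq R (G * nat)%type) R).
Variables (psi : (nat -> R) -> R).
Hypotheses (iPX : iid PX) (mpsi : measurable_fun setT (psi : iseq R nat -> R))
  (lpsi : forall P : probability (iseq R nat) R, iid P ->
    forall B, measurable B -> P (psi @^-1` B) = lebesgue_measure (B `&` `[0%R, 1%R])).

Definition merge_blocks (x : iseq R (G * nat)%type) (g : G) : R :=
  psi (fun n => x (g, n)).

Lemma measurable_merge_blocks g : measurable_fun setT (merge_blocks ^~ g).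
Proof.
apply: (measurableT_comp (f := psi : iseq R nat -> R) mpsi).
apply: (@measurable_to_iseq R _ (iseq R (G * nat)%type) nat (fun x n => x (g, n))) => n.
exact: measurable_coord.
Qed.

(** Blocks over different elements of [G] read disjoint sets of coordinates, so they are
    independent, and [psi] sends each block to a uniform label. *)
Lemma merge_blocks_iid (s : seq G) (B : G -> set R) : uniq s ->
  (forall g, measurable (B g)) ->
  PX [set x | forall g, g \in s -> B g (merge_blocks x g)] =
  (\prod_(g <- s) lebesgue_measure (B g `&` `[0%R, 1%R]))%E.
Proof.
have mBB g B' : measurable B' -> measurable [set x | B' (merge_blocks x g)].
  by move=> mB'; exact: (measurable_preimage (measurable_merge_blocks g) mB').
move=> + mB; elim: s => [_|g s IH /= /andP[gs us]].
  by rewrite big_nil (_ : [set x | _] = setT) ?probability_setT//; apply/seteqP; split.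
rewrite big_cons -IH//.
have [P hP] := @pushforward_prob R _ _ _ _ PX (fun x => (fun n => x (g, n)) : iseq R nat)
  (@measurable_to_iseq R _ (iseq R (G * nat)%type) nat (fun x n => x (g, n))
     (fun n => measurable_coord _)).
have iP : iid P.
  move=> t C ut mC; rewrite -hP.2; last exact: (@measurable_box R nat nat id).
  by apply: (@iid_map R _ nat PX t (fun n => (g, n)) C) => // i j _ _ [].
have -> : lebesgue_measure (B g `&` `[0%R, 1%R]) = PX [set x | B g (merge_blocks x g)].
  rewrite -(lpsi iP)// -hP.2//; exact: (measurable_preimage mpsi (mB g)).
rewrite (_ : [set x | _] = [set x | B g (merge_blocks x g)] `&`
    [set x | forall k, k \in s -> B k (merge_blocks x k)]).
  apply: (iid_indep (K := fun i => i.1 == g)) => //.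
  - exact: mBB.
  - apply: (@measurable_cylinder R _ (iseq R (G * nat)%type) G merge_blocks s B) => // k.
    exact: measurable_merge_blocks.
  - move=> x y xy /=; rewrite /merge_blocks (_ : (fun n => x (g, n)) = fun n => y (g, n))//.
    by apply/funext => n; apply: xy; rewrite eqxx.
  - move=> x y xy /= h k ks; move: (h k ks); rewrite /merge_blocks.
    rewrite (_ : (fun n => x (k, n)) = fun n => y (k, n))//.
    apply/funext => n; apply: xy => /=; apply: contra gs => /eqP <-; exact: ks.
apply/seteqP; split=> x /=.
  by move=> h; split=> [|k ks]; apply: h; rewrite inE ?eqxx// ks orbT.
by move=> [h1 h2] k; rewrite inE => /orP[/eqP ->|]; [exact: h1|exact: h2].
Qed.

End Block.
End MoreLaw.

(** The converse direction of [law_ae]. Measurability of [S] is what lets the measure of its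
    complement be computed upstairs. *)
Lemma law_ae_measurable {R : realType} dX dY (X : measurableType dX)
    (Y : measurableType dY) (mu : probability X R) (nu : probability Y R)
    (f : X -> Y) (S : set Y) : law_preserving mu nu f -> measurable S ->
  {ae mu, forall x, S (f x)} -> {ae nu, forall y, S y}.
Proof.
move=> [mf hf] mS h; exists (~` S); split=> //; first exact: measurableC.
apply: etrans (esym (hf _ (measurableC mS))) _.
apply: measure_negligible; first exact: measurable_preimage mf (measurableC mS).
exact: h.
Qed.

(** * Transfer of superrigidity *)

Section Transfer.
Context {R : realType} {dO dY : measure_display}.
Variables (O : measurableType dO) (Y : measurableType dY) (G H : cgroup).
Variables (m : {measure set O -> \bar R}) (a : G -> O -> O) (b : H -> O -> O).
Variables (O0 : set O) (gam : O -> G) (kap : O -> H).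
Hypotheses (stdO : standard_borel R O) (stdY : standard_borel R Y)
  (hma : mp_action m a) (hmb : mp_action m b)
  (comm : forall g h x, a g (b h x) = b h (a g x))
  (mO0 : measurable O0)
  (O0a : forall g x, O0 x -> O0 (a g x)) (O0b : forall h x, O0 x -> O0 (b h x))
  (gama : forall g x, O0 x -> gam (a g x) = cg_mul g (gam x))
  (kapb : forall h x, O0 x -> kap (b h x) = cg_mul h (kap x))
  (mgam : forall g, measurable (gam @^-1` [set g]))
  (mkap : forall h, measurable (kap @^-1` [set h])).

Let E := fdom O0 kap.
Let D := fdom O0 gam.
Hypotheses (mEE : measurable E) (mDD : measurable D)
  (E0 : m E <> 0%E) (D0 : m D <> 0%E)
  (Eoo : (m E < +oo)%E) (Doo : (m D < +oo)%E).

Variables (nu : probability Y R) (bY : H -> Y -> Y).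
Hypothesis hbY : mp_action nu bY.
Variables (P : probability (iseq R H) R) (PX : probability (iseq R (G * nat)%type) R).
Hypotheses (iP : iid P) (iPX : iid PX).
Variables (psi : (nat -> R) -> R) (phi : nat -> R -> R).
Hypotheses (mpsi : measurable_fun setT (psi : iseq R nat -> R))
  (mphi : forall k, measurable_fun setT (phi k))
  (phi_psi : forall v : nat -> R, (forall k, 0 <= v k < 1) ->
      forall k, phi k (psi v) = v k)
  (lpsi : forall P : probability (iseq R nat) R, iid P ->
    forall B, measurable B -> P (psi @^-1` B) = lebesgue_measure (B `&` `[0%R, 1%R])).

Variables (L : PolishGroup R) (w : H -> Y * iseq R H -> L).
Hypotheses (Linv : G_inv L) (mw : forall h, borel_measurable (w h))
  (cw : {ae pprod nu P, forall z, forall p : H * H,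
     w (cg_mul p.1 p.2) z = pg_mul (w p.1 (diag bY p.2 z)) (w p.2 z)}).

Local Notation X := (iseq R (G * nat)%type).
Local Notation ind g := (induced a b O0 kap g).

Let aA : is_action a. Proof. by have [] := hma. Qed.
Let bA : is_action b. Proof. by have [] := hmb. Qed.
Let ma g : measurable_fun setT (a g). Proof. by have [] := hma. Qed.
Let mb h : measurable_fun setT (b h). Proof. by have [] := hmb. Qed.
Let yA : is_action bY. Proof. by have [] := hbY. Qed.
Let mY h : measurable_fun setT (bY h). Proof. by have [] := hbY. Qed.
Let y1 y : bY (cg_one H) y = y. Proof. by have [] := yA. Qed.
Let yM h k y : bY (cg_mul h k) y = bY h (bY k y). Proof. by have [] := yA. Qed.
Let b1 x : b (cg_one H) x = x. Proof. by have [] := bA. Qed.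
Let bM g h x : b (cg_mul g h) x = b g (b h x). Proof. by have [] := bA. Qed.
Let aM g h x : a (cg_mul g h) x = a g (a h x). Proof. by have [] := aA. Qed.
Let a1 x : a (cg_one G) x = x. Proof. by have [] := aA. Qed.
Let Ylaw h : law_preserving nu nu (bY h).
Proof. by have [_ h1 h2] := hbY; split; [exact: h1|exact: h2]. Qed.

Let muE := normalized_restr m mEE.
Let muD := normalized_restr m mDD.
Let muZ := pprod muE nu.

(** The unit off [E] matches the induced action being the identity there, so that the cocycle
    identity [retEM] holds everywhere. *)
Let retE g (x : O) : H := if pselect (E x) then return_elt a kap g x else cg_one H.

Let retEE g x : E x -> retE g x = return_elt a kap g x.
Proof. by rewrite /retE; case: pselect. Qed.

Let retEM g h x : retE (cg_mul g h) x = cg_mul (retE g (ind h x)) (retE h x).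
Proof.
case: (pselect (E x)) => Ex.
  rewrite !retEE//; first exact: (return_eltM hma comm O0a kapb).
  exact: (induced_fdom O0a O0b kapb).
by rewrite inducedN// /retE; case: (pselect (E x)) => //= _; rewrite cg_mul1.
Qed.

Let mretE g h : measurable (retE g @^-1` [set h]).
Proof.
have mr k : measurable (return_elt a kap g @^-1` [set k]) by exact: (measurable_return hma mkap).
rewrite (_ : _ @^-1` _ = (E `&` return_elt a kap g @^-1` [set h]) `|`
    (if h == cg_one H then ~` E else set0)).
  apply: measurableU; first by apply: measurableI => //; exact: mr.
  by case: ifP => // _; exact: measurableC.
apply/seteqP; split=> x; rewrite /= /retE; case: (pselect (E x)) => Ex /=.
- by move=> <-; left.
- by move=> <-; right; rewrite eqxx.
- by move=> [[] //|]; case: eqP.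
- by move=> [[] //|]; case: eqP.
Qed.

(** The action of [G] induced from the action of [H] on [Y], written in the coordinates of the
    domain [E]. *)
Let aZ g (z : O * Y) : O * Y := (ind g z.1, bY (retE g z.1) z.2).

Let aZ_action : is_action aZ.
Proof.
have [i1 iM] := induced_action hma hmb comm O0a O0b kapb.
split=> [[x y]|g h [x y]]; rewrite /aZ /=; last by rewrite retEM yM iM.
rewrite i1; congr (_, _).
rewrite /retE; case: (pselect (E x)) => //= -[Ox kx].
by rewrite /return_elt a1 kx cg_inv1.
Qed.

Let mYret g : measurable_fun setT (fun z : O * Y => bY (retE g z.1) z.2).
Proof.
apply: (@measurable_fun_count _ _ (O * Y)%type Y H (fun z => retE g z.1)
  (fun h z => bY h z.2)).
  by move=> h; exact: (measurable_preimage (@measurable_fst _ _ O Y) (mretE g h)).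
by move=> h; exact: measurableT_comp (mY h) (@measurable_snd _ _ O Y).
Qed.

Let ind_law g : law_preserving muE muE (ind g).
Proof.
have mi := measurable_induced hma hmb mO0 mkap g.
split=> // A mA; rewrite /muE !normalized_restrE//.
by rewrite (induced_mp hma hmb comm mO0 O0a O0b kapb mkap g mA).
Qed.

Let aZ_law g : law_preserving muZ muZ (aZ g).
Proof.
apply: (@skew_law R _ _ _ _ O O Y Y muE muE nu nu (ind g)
  (fun o y => bY (retE g o) y) (ind_law g)); first exact: mYret.
by apply: aeW => x A mA; exact: (Ylaw _).2.
Qed.

Let aZ_mp : mp_action muZ aZ.
Proof.
split; first exact: aZ_action.
  by move=> g; exact: (aZ_law g).1.
by move=> g A mA; exact: (aZ_law g).2.
Qed.

(** Presents the Bernoulli space of [G] as an image of a space with countably many labels per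
    element of [G]. [splitx] undoes the merging when all labels lie in [[0,1)], hence almost
    surely. *)
Let J (z : (O * Y) * X) : bern_space R G (O * Y)%type := (z.1, merge_blocks psi z.2).

Let mJ : measurable_fun setT J.
Proof.
apply: measurable_to_bern; first exact: measurable_fst.
move=> g; exact: measurableT_comp (measurable_merge_blocks mpsi g)
  (@measurable_snd _ _ (O * Y)%type X).
Qed.

Let splitx (x : gfun G R) : X := fun i => phi i.2 (x i.1).

Let splitx_translate g (x : gfun G R) :
  splitx (fun h => x (cg_mul (cg_inv g) h)) = translate g (splitx x).
Proof. by []. Qed.

Let splitx_merge (x : X) : (forall i, 0 <= x i < 1) -> splitx (merge_blocks psi x) = x.
Proof.
by move=> hx; apply/funext => -[g n]; rewrite /splitx /= /merge_blocks phi_psi.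
Qed.

Let rel := @relabel R _ O G H a b gam kap.

Let mrelsplit : measurable_fun setT (fun v : bern_space R G (O * Y)%type =>
   ((v.1.2, rel v.1.1 (splitx v.2)) : Y * iseq R H)).
Proof.
have m1 := @measurable_bern_fst R G _ (O * Y)%type.
apply: measurable_fun_pair.
  exact: measurableT_comp (@measurable_snd _ _ O Y) m1.
have mr := measurable_relabel (R := R) ma mb mgam mkap.
apply: (measurableT_comp mr (g := fun v : bern_space R G (O * Y)%type => (v.1.1, splitx v.2))).
apply: measurable_fun_pair; first exact: measurableT_comp (@measurable_fst _ _ O Y) m1.
apply: measurable_to_iseq => i.
exact: measurableT_comp (mphi i.2) (@measurable_bern_coord R G _ (O * Y)%type i.1).
Qed.

Let relsplit_law : law_preserving (pprod muZ PX) (pprod nu P)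
  (fun z => (z.1.2, rel z.1.1 z.2)).
Proof.
have mr := measurable_relabel (R := R) ma mb mgam mkap.
have l1 := assoc_law muE nu PX.
have l2 : law_preserving (pprod muE (pprod nu PX)) (pprod muE (pprod nu P))
    (fun z => (z.1, (z.2.1, rel z.1 z.2.2))).
  apply: (@skew_law R _ _ _ _ O O (Y * X)%type (Y * iseq R H)%type muE muE _ _ id
    (fun o z => (z.1, rel o z.2))); first exact: law_id.
    have m2 := @measurable_snd _ _ O (Y * X)%type.
    apply: measurable_fun_pair; first exact: measurableT_comp (@measurable_fst _ _ Y X) m2.
    apply: (measurableT_comp mr (g := fun z : O * (Y * X) => (z.1, z.2.2))).
    apply: measurable_fun_pair; first exact: measurable_fst.
    exact: measurableT_comp (@measurable_snd _ _ Y X) m2.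
  apply: aeW => o A mA.
  exact: (prod_law (law_id nu) (relabel_law a b gam kap o iP iPX)).2.
exact: law_comp l1 (law_comp l2 (snd_law muE (pprod nu P))).
Qed.

Let mE_ae : {ae pprod muZ PX, forall z, E z.1.1}.
Proof.
exact: (law_ae (fst_law muZ PX) (law_ae (fst_law muE nu) (normalized_restr_ae mEE E0 Eoo))).
Qed.

Let rel_ind g o x : E o -> rel (ind g o) (translate g x) = shift (retE g o) (rel o x).
Proof.
move=> Eo; have [Oo _] := Eo; rewrite inducedE// retEE//.
rewrite /rel (relabel_b gam bA comm O0a kapb); last exact: O0a.
by rewrite (relabel_a kap aA comm O0b gama).
Qed.

(** By [rel_ind] the relabelling intertwines the two actions through the return element, so [w]
    pulls back to a cocycle of [G]. The conclusion is put on unmerged labels, where the labels of an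
    orbit can be replaced. *)
Lemma coupling_superrigid (C : PolishGroup R -> Prop) :
  bernoulli_superrigid C G -> C L ->
  exists (u : G -> O * Y -> L) (F1 : (O * Y) * X -> L),
  [/\ forall g, borel_measurable (u g), borel_measurable F1 &
    forall g, {ae pprod muZ PX, forall z, u g z.1 =
      pg_mul (pg_mul (F1 (aZ g z.1, translate g z.2))
        (w (retE g z.1.1) (z.1.2, rel z.1.1 z.2))) (pg_inv (F1 z))}].
Proof.
move=> hG CL; have [d [dc dinv]] := Linv.
have [lamG hJ] := pushforward_prob (pprod muZ PX) mJ.
have bern : is_bernoulli_measure muZ lamG.
  move=> A s B mA us mB.
  have mb1 : measurable [set x : X | forall g, g \in s -> B g (merge_blocks psi x g)].
    apply: (@measurable_cylinder R _ X G (merge_blocks psi) s B) => // g.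
    exact: measurable_merge_blocks.
  have mS : measurable [set z : bern_space R G (O * Y)%type |
      A z.1 /\ forall g, g \in s -> B g (z.2 g)].
    apply: measurableI.
      exact: (measurable_preimage (@measurable_bern_fst R G _ (O * Y)%type) mA).
    apply: (@measurable_cylinder R _ (bern_space R G (O * Y)%type) G (fun z g => z.2 g) s B) => // g.
    exact: measurable_bern_coord.
  apply: etrans (esym (hJ.2 _ mS)) _.
  rewrite (_ : _ @^-1` _ =
     A `*` [set x : X | forall g, g \in s -> B g (merge_blocks psi x g)]) //.
  by rewrite pprodE//; congr (_ * _)%E; exact: merge_blocks_iid.
pose c g (v : bern_space R G (O * Y)%type) : L :=
  w (retE g v.1.1) (v.1.2, rel v.1.1 (splitx v.2)).
have mc g : borel_measurable (c g).
  apply: (@borel_measurable_count R L _ (bern_space R G (O * Y)%type) H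
    (fun v => retE g v.1.1) (fun h v => w h (v.1.2, rel v.1.1 (splitx v.2)))).
    move=> h; apply: (measurable_preimage (f := fun v : bern_space R G (O * Y)%type => v.1.1)) (mretE g h).
    exact: measurableT_comp (@measurable_fst _ _ O Y) (@measurable_bern_fst R G _ (O * Y)%type).
  by move=> h; exact: (borel_measurable_comp (@mw h) mrelsplit).
have mact g : measurable_fun setT (bern_action aZ g : bern_space R G (O * Y)%type -> _).
  apply: measurable_to_bern.
    exact: measurableT_comp (aZ_law g).1 (@measurable_bern_fst R G _ (O * Y)%type).
  by move=> h; exact: measurable_bern_coord.
have unit_ae : {ae pprod muZ PX, forall z, forall i, 0 <= z.2 i < 1}.
  exact: (law_ae (snd_law muZ PX) (iid_unit_ae iPX)).
have ccoc : cocycle lamG (bern_action aZ) c.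
  split=> // g g'.
  (* The identity is checked on unmerged labels and transported to [lamG], a direction that asks for
     a measurable solution set. *)
  have mS : measurable [set v : bern_space R G (O * Y)%type |
      c (cg_mul g g') v = pg_mul (c g (bern_action aZ g' v)) (c g' v)].
    apply: (measurable_eq_fun dc dinv) => //; apply: borel_measurable_mul => //.
    exact: (borel_measurable_comp (mc g) (mact g')).
  apply: (law_ae_measurable hJ mS).
  move: mE_ae (law_ae relsplit_law cw) unit_ae; apply: filterS3 => -[[q y] x] /= Eq hw hx.
  rewrite /c /J /= splitx_translate splitx_merge// retEM rel_ind//.
  exact: (hw (retE g (ind g' q), retE g' q)).
have [u [[mu_ _] [F [mF hF]]]] := hG _ _ muZ aZ (standard_borel_prod stdO stdY) aZ_mp lamG bern L CL c ccoc.
exists u, (F \o J); split=> //; first exact: (borel_measurable_comp mF mJ).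
move=> g; move: (law_ae hJ (hF g)) unit_ae; apply: filterS2 => -[z x] /= e hx.
by rewrite e /c /= splitx_merge.
Qed.

Let indD h := induced b a O0 gam h.

Let retD h (x : O) : G := if pselect (D x) then return_elt b gam h x else cg_one G.

Let retDE h x : D x -> retD h x = cg_inv (gam (b h x)).
Proof. by rewrite /retD; case: pselect. Qed.

Let comm' h g x : b h (a g x) = a g (b h x). Proof. by rewrite comm. Qed.

Let mretD h g : measurable (retD h @^-1` [set g]).
Proof.
have mr k : measurable (return_elt b gam h @^-1` [set k]) by exact: (measurable_return hmb mgam).
rewrite (_ : _ @^-1` _ = (D `&` return_elt b gam h @^-1` [set g]) `|`
    (if g == cg_one G then ~` D else set0)).
  apply: measurableU; first by apply: measurableI => //; exact: mr.
  by case: ifP => // _; exact: measurableC.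
apply/seteqP; split=> x; rewrite /= /retD; case: (pselect (D x)) => Dx /=.
- by move=> <-; left.
- by move=> <-; right; rewrite eqxx.
- by move=> [[] //|]; case: eqP.
- by move=> [[] //|]; case: eqP.
Qed.

Let indD_law h : law_preserving muD muD (indD h).
Proof.
have mi := measurable_induced hmb hma mO0 mgam h.
split=> // A mA; rewrite /muD !normalized_restrE//.
by rewrite (induced_mp hmb hma comm' mO0 O0b O0a gama mgam h mA).
Qed.

(** The coupling seen from [D]: the induced action of [H], together with translation of the labels
    by its return element in [G]. *)
Let tV h (v : O * X) : O * X := (indD h v.1, translate (retD h v.1) v.2).

Let tV_law h : law_preserving (pprod muD PX) (pprod muD PX) (tV h).
Proof.
apply: (@skew_law R _ _ _ _ O O X X muD muD PX PX (indD h)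
  (fun o x => translate (retD h o) x) (indD_law h)).
  exact: (measurable_translate_count (R := R) (mretD h)).
by apply: aeW => x A mA; exact: (translate_law _ iPX).2.
Qed.

Let kinv x := cg_inv (kap x).

Let mkinv h : measurable (kinv @^-1` [set h]).
Proof.
rewrite (_ : _ @^-1` _ = kap @^-1` [set cg_inv h]); first exact: mkap.
by apply/seteqP; split=> x; [rewrite /kinv /= => <-|rewrite /kinv /= => ->]; rewrite cg_invK.
Qed.

Let toE x := b (kinv x) x.

Let mtoE : measurable_fun setT toE.
Proof. exact: (measurable_fun_count (k := kinv) (f := b)). Qed.

Let toE_fdom x : O0 x -> E (toE x).
Proof. by move=> Ox; split; [exact: O0b|rewrite /= kapb// cg_mulV]. Qed.

(** The preimage of a null set is covered by its countably many [H]-translates. [toE] may superpose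
    many pieces of [D], so only null sets are respected. *)
Let toE_nonsingular : nonsingular muD muE toE.
Proof.
split=> // A mA /(normalized_restr0 mEE E0 Eoo mA) A0.
have mtA := measurable_preimage mtoE mA.
apply/(normalized_restr0 mDD D0 Doo mtA).
have mAE : measurable (A `&` E) by exact: measurableI.
have aeA : {ae m, forall x, ~ (A `&` E) x}.
  by exists (A `&` E); split=> // x /= /contrapT.
have h1 : {ae m, forall x, forall h, ~ (A `&` E) (b h x)}.
  by apply: ae_forall_count => h; exact: mp_ae hmb aeA.
apply: measure_negligible; first exact: measurableI.
apply: negligibleS h1 => x [Ax [Ox _]] /= h; apply: (h (kinv x)).
by split=> //; exact: toE_fdom.
Qed.

Let rsm := @resample R _ O G H a b gam kap.

(** The point where [F1] is evaluated: [toE] moves the base point into [E], [Y] follows by the same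
    element, and the labels of [H] are written at the places occupied by the orbit. *)
Let base (z : (O * X) * (Y * iseq R H)) : (O * Y) * X :=
  ((toE z.1.1, bY (kinv z.1.1) z.2.1), rsm z.1.1 z.2.2 z.1.2).

Let base_nonsingular :
  nonsingular (pprod (pprod muD PX) (pprod nu P)) (pprod muZ PX) base.
Proof.
have l1 := assoc_law muD PX (pprod nu P).
pose s (o : O) (z : X * (Y * iseq R H)) : Y * X :=
  (bY (kinv o) z.2.1, rsm o z.2.2 z.1).
have ms : measurable_fun setT (fun z : O * (X * (Y * iseq R H)) => s z.1 z.2).
  have m1 := @measurable_fst _ _ O (X * (Y * iseq R H))%type.
  have m2 := @measurable_snd _ _ O (X * (Y * iseq R H))%type.
  have m22 := measurableT_comp (@measurable_snd _ _ X (Y * iseq R H)%type) m2.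
  apply: measurable_fun_pair.
    apply: (@measurable_fun_count _ _ (O * (X * (Y * iseq R H)))%type Y H
      (fun z => kinv z.1) (fun h z => bY h z.2.2.1)).
      by move=> h; exact: (measurable_preimage m1 (mkinv h)).
    move=> h; apply: measurableT_comp (mY h) _.
    exact: measurableT_comp (@measurable_fst _ _ Y (iseq R H)) m22.
  have mr := measurable_resample (R := R) ma mb mgam mkap.
  apply: (measurableT_comp mr
    (g := fun z : O * (X * (Y * iseq R H)) => (z.1, (z.2.2.2, z.2.1)))).
  apply: measurable_fun_pair => //; apply: measurable_fun_pair.
    exact: measurableT_comp (@measurable_snd _ _ Y (iseq R H)) m22.
  exact: measurableT_comp (@measurable_fst _ _ X (Y * iseq R H)%type) m2.
have ls o : law_preserving (pprod PX (pprod nu P)) (pprod nu PX) (s o).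
  have l2 := law_comp (swap_law PX (pprod nu P)) (assoc_law nu P PX).
  exact: (law_comp l2 (prod_law (Ylaw (kinv o)) (resample_law a b gam kap o iP iPX))).
have l3 : nonsingular (pprod muD (pprod PX (pprod nu P))) (pprod muE (pprod nu PX))
    (fun z => (toE z.1, s z.1 z.2)).
  apply: (@skew_nonsingular R _ _ _ _ O O _ _ muD muE _ _ toE s toE_nonsingular ms).
  by apply: aeW => o A mA; exact: (ls o).2.
exact: (nonsingular_comp (law_nonsingular l1)
  (nonsingular_comp l3 (law_nonsingular (assoc_inv_law muE nu PX)))).
Qed.

Hypothesis infH : infinite_set [set: H].

Lemma transfer_descent (u : G -> O * Y -> L) (F1 : (O * Y) * X -> L) :
  (forall g, borel_measurable (u g)) -> borel_measurable F1 ->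
  (forall g, {ae pprod muZ PX, forall z, u g z.1 =
      pg_mul (pg_mul (F1 (aZ g z.1, translate g z.2))
        (w (retE g z.1.1) (z.1.2, rel z.1.1 z.2))) (pg_inv (F1 z))}) ->
  exists (F0 : Y * iseq R H -> L) (w0 : H -> Y -> L),
    [/\ borel_measurable F0, forall h, borel_measurable (w0 h) &
     forall h, {ae pprod nu P, forall z, w0 h z.1 =
       pg_mul (pg_mul (F0 (diag bY h z)) (w h z)) (pg_inv (F0 z))}].
Proof.
move=> mu_ mF1 hu.
(* [F1] is evaluated over the representative [toE p] rather than [p]; the factor [w (kinv p)]
   accounts for the passage between them. *)
pose F3 (z : (O * X) * (Y * iseq R H)) : L :=
  pg_mul (F1 (base z)) (w (kinv z.1.1) z.2).
pose U h (z : (O * X) * Y) : L :=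
  u (retD h z.1.1) (toE z.1.1, bY (kinv z.1.1) z.2).
have mF3 : borel_measurable F3.
  apply: borel_measurable_mul; first exact: (borel_measurable_comp mF1 base_nonsingular.1).
  apply: (@borel_measurable_count R L _ ((O * X) * (Y * iseq R H))%type H
    (fun z => kinv z.1.1) (fun h z => w h z.2)).
    move=> h; apply: (measurable_preimage (f := fun z : (O * X) * (Y * iseq R H) => z.1.1)) (mkinv h).
    exact: measurableT_comp (@measurable_fst _ _ O X) (@measurable_fst _ _ (O * X)%type (Y * iseq R H)%type).
  by move=> h; exact: (borel_measurable_comp (@mw h) (@measurable_snd _ _ (O * X)%type _)).
have m11 : measurable_fun setT (fun z : (O * X) * Y => z.1.1).
  exact: measurableT_comp (@measurable_fst _ _ O X) (@measurable_fst _ _ (O * X)%type Y).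
have mU h : borel_measurable (U h).
  apply: (@borel_measurable_count R L _ ((O * X) * Y)%type G (fun z => retD h z.1.1)
    (fun g z => u g (toE z.1.1, bY (kinv z.1.1) z.2))).
    by move=> g; exact: (measurable_preimage m11 (mretD h g)).
  move=> g; apply: (borel_measurable_comp (mu_ g)).
  apply: measurable_fun_pair; first exact: measurableT_comp mtoE m11.
  apply: (@measurable_fun_count _ _ ((O * X) * Y)%type Y H
    (fun z => kinv z.1.1) (fun h z => bY h z.2)).
    by move=> k; exact: (measurable_preimage m11 (mkinv k)).
  by move=> k; exact: measurableT_comp (mY k) (@measurable_snd _ _ (O * X)%type Y).
apply: (@descent R H L _ _ (O * X)%type Y (pprod muD PX) nu P tV bY infH iP Linv
  tV_law Ylaw w F3 U mF3 mU).
move=> h.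
have aeD : {ae pprod (pprod muD PX) (pprod nu P), forall z, D z.1.1}.
  exact: (law_ae (fst_law (pprod muD PX) (pprod nu P))
    (law_ae (fst_law muD PX) (normalized_restr_ae mDD D0 Doo))).
have aew := law_ae (snd_law (pprod muD PX) (pprod nu P)) cw.
have aeu := nonsingular_ae base_nonsingular (ae_forall_count hu).
move: aeD aew aeu; apply: filterS3 => -[[p x] [y c]] /= Dp hw hu'.
have [Op gp] := Dp.
set k := kinv p; set g := cg_inv (gam (b h p)).
set e := toE p; have Ee : E e by exact: toE_fdom.
have gE : retD h p = g by rewrite retDE.
have pE : p = b (cg_inv k) e by rewrite /e /toE -bM -/k cg_mulV b1.
set p' := a g (b h p).
have indE : indD h p = p' by rewrite /indD inducedE.
set r := cg_inv (kap (a g e)).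
have rE : retE g e = r by rewrite retEE.
have Oe : O0 e by have [] := Ee.
have p'E : p' = b (cg_mul h (cg_inv k)) (a g e).
  by rewrite /p' {1}pE -bM comm.
(* To return [p'] to [E], undo [h], apply [k] as for [p], which gives [a g e], then correct by
   [r]. *)
have kp' : kinv p' = cg_mul (cg_mul r k) (cg_inv h).
  rewrite /kinv p'E kapb; last exact: O0a.
  by rewrite !cg_invM cg_invK -/r cg_mulA.
have toEp' : toE p' = ind g e.
  rewrite /toE kp' p'E -bM inducedE//; congr (b _ _).
  by rewrite !cg_mulA cgMVK cgMK /return_elt.
have yE : bY (cg_mul (cg_mul r k) (cg_inv h)) (bY h y) = bY r (bY k y).
  by rewrite -!yM cgMVK yM.
have rsE : rsm p' (shift h c) (translate g x) = translate g (rsm p c x).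
  rewrite /rsm /p' (resample_a kap aA comm O0b gama); last exact: O0b.
  by rewrite (resample_b gam bA comm O0a kapb).
have relE : rel e (rsm p c x) = shift k c.
  rewrite /rel /e /toE (relabel_b gam bA comm O0a kapb)//.
  by rewrite /rsm relabel_resample.
have := hu' g; rewrite /U /F3 /base /tV /diag /= gE indE -/k -/e kp' toEp' yE rsE.
move=> ->; rewrite /aZ /= rE relE.
(* The cocycle identity expands [w] at [r k] in two ways, through [h] and through [k]; equating them
   matches the two sides. *)
have w1 := hw (cg_mul (cg_mul r k) (cg_inv h), h).
have w2 := hw (r, k).
rewrite /= cgMVK w2 /diag /= in w1.
rewrite pg_invM -!pg_mulA; congr (pg_mul _ _).
rewrite !pg_mulA; congr (pg_mul _ _).
by rewrite -w1 pgMK.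
Qed.

End Transfer.

Lemma bernoulli_superrigid_transfer (R : realType) (C : PolishGroup R -> Prop)
    (HC : forall L, C L -> G_inv L) (G H : cgroup) :
  measure_equivalent R G H -> bernoulli_superrigid C G -> bernoulli_superrigid C H.
Proof.
move=> [dO [S [m [a [b [[stdO [_ mT]] [hma hmb] comm _ [fda fdb]]]]]]] hG.
case: (pselect (finite_set [set: H])) => [finH|infH]; first exact: finite_superrigid.
have [S0 [gam [kap [[mS0 aeO] [S0a S0b] [gama kapb] [mgam mkap] [Doo Eoo]]]]] :=
  coupling_maps hma hmb comm fda fdb.
have E0 := fdom_neq0 hmb mT mS0 aeO S0b kapb mkap.
have D0 := fdom_neq0 hma mT mS0 aeO S0a gama mgam.
have mE : measurable (fdom S0 kap) by exact: measurableI (mkap _).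
have mD : measurable (fdom S0 gam) by exact: measurableI (mgam _).
move=> dY Y nu bY stdY hbY lam hlam L CL w [mw cw].
have [P [iP aeE]] := bern_decomp hlam.
(* The labels on the side of [G] are drawn from those of the infinite group [H]. *)
have [PX iPX] := iid_of_infinite (G * nat)%type infH iP.
have [psi [phi [mpsi mphi phi_psi lpsi]]] := @merge_split R.
have mw' h : @borel_measurable R _ (Y * iseq R H)%type L (w h).
  exact: (borel_measurable_comp (mw h) (@measurable_into_bern R H _ Y)).
have cw' : {ae pprod nu P, forall z, forall p : H * H,
     w (cg_mul p.1 p.2) z = pg_mul (w p.1 (diag bY p.2 z)) (w p.2 z)}.
  by apply: ae_forall_count => -[h k] /=; apply/aeE; exact: cw.
have [u [F1 [mu_ mF1 hu]]] := coupling_superrigid stdO stdY hma hmb comm mS0 S0a S0b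
  gama kapb mgam mkap mE E0 Eoo hbY iP iPX mpsi mphi phi_psi lpsi (HC _ CL) mw' cw' hG CL.
have [F0 [w0 [mF0 mw0 hw0]]] := transfer_descent hma hmb comm mS0 S0a S0b
  gama kapb mgam mkap mD E0 D0 Eoo Doo hbY iP iPX (HC _ CL) mw' cw' infH mu_ mF1 hu.
have [[b1 bM] mb bnu] := hbY.
exists w0; split; last first.
  exists F0; split; first exact: (borel_measurable_comp mF0 (@measurable_from_bern R H _ Y)).
  by move=> h; apply/aeE; exact: hw0.
split=> // h k.
have lk := diag_law iP (fun h => conj (mb h) (bnu h)) k.
have : {ae pprod nu P, forall z,
    w0 (cg_mul h k) z.1 = pg_mul (w0 h (bY k z.1)) (w0 k z.1)}.
  have h1 : {ae pprod nu P, forall z, w (cg_mul h k) z = pg_mul (w h (diag bY k z)) (w k z)}.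
    by apply: (@filterS _ _ (ae_filter_ringOfSetsType (pprod nu P)) _ _ _ cw') => z hz;
      exact: (hz (h, k)).
  have h2 : {ae pprod nu P, forall z, [/\ w0 (cg_mul h k) z.1 =
      pg_mul (pg_mul (F0 (diag bY (cg_mul h k) z)) (w (cg_mul h k) z)) (pg_inv (F0 z)) &
      w0 k z.1 = pg_mul (pg_mul (F0 (diag bY k z)) (w k z)) (pg_inv (F0 z))]}.
    by apply: (@filterS2 _ _ (ae_filter_ringOfSetsType (pprod nu P)) _ _ _ _
      (hw0 (cg_mul h k)) (hw0 k)) => z; split.
  apply: (@filterS3 _ _ (ae_filter_ringOfSetsType (pprod nu P)) _ _ _ _ _
    h1 h2 (law_ae lk (hw0 h))) => z e1 [e2 e3] e4.
  have e5 : diag bY h (diag bY k z) = diag bY (cg_mul h k) z.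
    rewrite /diag /= bM; congr (_, _); apply/funext => i.
    by rewrite /shift cg_invM cg_mulA.
  rewrite e2 e3 e1; have -> : bY k z.1 = (diag bY k z).1 by [].
  by rewrite e4 e5 !pg_mulA pgMVK.
(* Neither side involves the labels, so over almost every [y] a single sequence suffices. *)
move=> /ae_fubini; apply: filterS => y /ae_exists[c].
by [].
Qed.

Theorem theorem0p2 (R : realType) (C : PolishGroup R -> Prop)
  (HC : forall L, C L -> G_inv L) (G H : cgroup) :
  measure_equivalent R G H ->
  (bernoulli_superrigid C G <-> bernoulli_superrigid C H).
Proof.
move=> GH; split; first exact: bernoulli_superrigid_transfer.
exact: bernoulli_superrigid_transfer (measure_equivalent_sym GH).
Qed.
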